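(* Let $0<T<\infty$, $\delta\ge 0$, and consider the case without jumps, $\lambda=0$. Let $A(t)$ (scalar) and $B(t)$ ($\mathbb R^n$-valued) be the solution of $$\dot A=2A^2-a,\qquad \dot B-2AB=-b,\qquad A(T)=A_T,\quad B(T)=B_T,$$ where $a(t)$, $b(t)$ are the coefficients of the quadratic running cost described in the context, and assume that $$e^{-2\int_0^TA(\tau)\,d\tau}<\infty,\qquad \int_0^Te^{-2\int_\eta^TA(\tau)\,d\tau}B(\eta)\,d\eta<\infty .$$ Then the fundamental solution $\mathcal G(t,x,y)$ of the density equation, i.e. the solution of $$\partial_tm-\mathrm{div}\big(m\,(2A(t)x+B(t))\big)-\tfrac{\delta^2}{2}\Delta m=0,\qquad m(0,x)=\delta(x-y)$$ (Dirac mass at $y\in\mathbb R^n$), is $$\mathcal G(t,x,y)=\frac{1}{\big(\sqrt{2\pi\,\bar{\mathbb V}(X_t)}\big)^n}\exp\left[-\frac{\big|x-y\,e^{-2\int_0^tA(\tau)\,d\tau}-\bar{\mathbb E}(X_t)\big|^2}{2\,\bar{\mathbb V}(X_t)}\right],$$ where $\bar{\mathbb E}(X_t)$ and $\bar{\mathbb V}(X_t)$ are the expectation and the variance of the controlled process $X_t$ (described in the context) with $\mathbb E(X_0)=\mathbb V(X_0)=y=0$.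
   Context: Setting: the mean field game system on $[0,T]\times\mathbb R^n$, here with $\lambda=0$, for the value function $\Phi(t,x)$ and the density $m(t,x)$: $$-\partial_t\Phi+\tfrac12|\nabla\Phi|^2-\tfrac{\delta^2}{2}\Delta\Phi=g,\qquad \partial_tm-\mathrm{div}(m\nabla\Phi)-\tfrac{\delta^2}{2}\Delta m=0,$$ with $\Phi(T,x)=A_T|x|^2+B_T\cdot x+C_T$ ($A_T,C_T\in\mathbb R$, $B_T\in\mathbb R^n$ constant). The cost is quadratic, $g=a(t)|x|^2+b(t)\cdot x+c(t)$, where $a$, $c$ (scalar) and $b$ ($\mathbb R^n$-valued) are smooth functions that may depend on the expectation and variance of the process. The value function is taken in the form $\Phi=A(t)|x|^2+B(t)\cdot x+C(t)$, so that $\nabla\Phi=2Ax+B$. The solution $A,B$ is allowed to have singularities inside $(0,T)$ as long as the two finiteness conditions in the claim hold. $m(t,\cdot)$ is the density of the process $X_t$ with dynamics $dX_s=\alpha_s\,ds+\delta\,dW_s$, where $\alpha$ is the control and $W$ is a standard $n$-dimensional Brownian motion (the constant $\delta\ge0$ is the noise level; $\delta(x-y)$ denotes the Dirac mass). The variance $\bar{\mathbb V}(X_t)$ is scalar. *)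

(* Defs.v *)
From HB Require Import structures.
From mathcomp Require Import all_boot all_order all_algebra.
From mathcomp Require Import all_classical all_reals all_analysis.

Set Implicit Arguments.
Unset Strict Implicit.
Unset Printing Implicit Defensive.
Import Order.TTheory GRing.Theory Num.Theory.
Import numFieldNormedType.Exports.

Local Open Scope classical_set_scope.
Local Open Scope ring_scope.

(* R^n is 'rV[R]_n.  The norm `|x| of the library on it is the sup norm, hence
   the separate sqnorm for the Euclidean one (the topology is the same).  The
   sigma-algebra is the Borel one, generated by the coordinates as the library
   does for tuples. *)
Section rV_measurable.
Context (R : realType) (n : nat).

Let coors : 'I_n -> 'rV[R]_n -> R := fun i x => x ord0 i.

Let rV_set0 : g_sigma_preimage coors set0.
Proof. exact: sigma_algebra0. Qed.

Let rV_setC A : g_sigma_preimage coors A -> g_sigma_preimage coors (~` A).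
Proof. exact: sigma_algebraC. Qed.

Let rV_bigcup (F : _^nat) : (forall i, g_sigma_preimage coors (F i)) ->
  g_sigma_preimage coors (\bigcup_i (F i)).
Proof. exact: sigma_algebra_bigcup. Qed.

HB.instance Definition _ :=
  @isMeasurable.Build (measure_tuple_display default_measure_display)
    'rV[R]_n (g_sigma_preimage coors) rV_set0 rV_setC rV_bigcup.

End rV_measurable.

Section euclidean.
Context {R : realType} {n : nat}.
Implicit Types x y : 'rV[R]_n.

Definition dotv x y : R := \sum_i x ord0 i * y ord0 i.

Definition sqnorm x : R := dotv x x.

Definition unitv (i : 'I_n) : 'rV[R]_n := delta_mx ord0 i.

Definition grad (f : 'rV[R]_n -> R) x : 'rV[R]_n := \row_i 'D_(unitv i) f x.

Definition laplacian (f : 'rV[R]_n -> R) x : R :=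
  \sum_i 'D_(unitv i) ('D_(unitv i) f) x.

End euclidean.

(* Lebesgue measure on R^n, by iterated products lebesgue_measure \x ... *)
Fixpoint lebesgue_rV {R : realType} (n : nat) : set 'rV[R]_n -> \bar R :=
  match n with
  | 0%N => \d_(0 : 'rV[R]_0)
  | m.+1 => pushforward ((@lebesgue_measure R) \x (@lebesgue_rV R m))%E
              (fun p : R * 'rV[R]_m => row_mx p.1%:M p.2 : 'rV[R]_m.+1)
  end.

Section gaussian.
Context {R : realType} {n : nat}.

Definition gaussian_density (mean : 'rV[R]_n) (v : R) (x : 'rV[R]_n) : R :=
  (Num.sqrt (2 * pi * v) ^+ n)^-1 * expR (- (sqnorm (x - mean) / (2 * v))).

(* The mass distribution with the density above; for v = 0 (which occurs at the
   initial time, and at all times without noise) the density degenerates to the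
   Dirac mass at the mean. *)
Definition gaussian_law (mean : 'rV[R]_n) (v : R) (S : set 'rV[R]_n) : \bar R :=
  if v == 0 then \d_mean S
  else (\int[@lebesgue_rV R n]_(x in S) (gaussian_density mean v x)%:E)%E.

End gaussian.

Section coefficients.
Context {R : realType} {n : nat}.
Implicit Types (A : R -> R) (B : R -> 'rV[R]_n).

(* The gradient in x of A(t)|x|^2 + B(t).x + C(t). *)
Definition grad_value A B (t : R) (x : 'rV[R]_n) : 'rV[R]_n :=
  (2 * A t) *: x + B t.

Definition singular_time A (t : R) : Prop := `|A s| @[s --> t^'] --> +oo.

(* The equations hold at every time of ]0, T[ at which A does not blow up. *)
Definition riccati_solution (T : R) (a : R -> R) (b : R -> 'rV[R]_n)
    (AT : R) (BT : 'rV[R]_n) A B : Prop :=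
  [/\ forall t, 0 < t < T -> ~ singular_time A t ->
        is_derive t 1 A (2 * A t ^+ 2 - a t) /\
        is_derive t 1 B ((2 * A t) *: B t - b t),
      A T = AT, A s @[s --> T^'-] --> AT,
      B T = BT & B s @[s --> T^'-] --> BT].

(* exp(-2 \int_s^t A), extended-valued: the integral may be infinite, and the
   integral of the library is -oo as soon as that of the negative part is. *)
Definition propagator A (s t : R) : \bar R :=
  expeR (- (2%:E * \int[lebesgue_measure]_(tau in `[s, t]) (A tau)%:E))%E.

End coefficients.

Section process.
Context {R : realType} {n : nat} {d : measure_display} {Omega : measurableType d}.
Variable P : probability Omega R.
Implicit Types (W X alpha : R -> Omega -> 'rV[R]_n).

Definition mean (Y : Omega -> 'rV[R]_n) : 'rV[R]_n :=
  \row_i fine 'E_P[fun w => Y w ord0 i].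

(* Scalar variance of a vector, E|Y - E Y|^2 / n: the number v for which the
   covariance matrix is v%:M, when it is scalar. *)
Definition scalar_variance (Y : Omega -> 'rV[R]_n) : \bar R :=
  ((\sum_(i < n) 'V_P[fun w => Y w ord0 i]) * (n%:R^-1)%:E)%E.

(* Finite-dimensional laws: over disjoint time intervals, all coordinates of all
   increments are independent and centred normal.  The times are strictly
   increasing because normal_prob m 0 is not a Dirac mass in the library. *)
Definition brownian_motion W : Prop :=
  [/\ forall t, 0 <= t -> measurable_fun setT (W t),
      {ae P, forall w, W 0 w = 0 /\
        {within `[0, +oo[, continuous (fun t => W t w)}} &
      forall (k : nat) (t : nat -> R), 0 <= t 0%N ->
        (forall j, (j < k)%N -> t j < t j.+1) ->
        forall U : nat -> 'I_n -> set R, (forall j i, measurable (U j i)) ->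
        P [set w | forall j i, (j < k)%N ->
             U j i (W (t j.+1) w ord0 i - W (t j) w ord0 i)] =
        (\prod_(j < k) \prod_(i < n)
           normal_prob 0 (Num.sqrt (t j.+1 - t j)) (U j i))%E].

(* dX = alpha dt + delta dW on [0, T].  The noise is additive, so the stochastic
   integral is delta W and the equation is an integral equation along paths. *)
Definition solves_sde (T delta : R) W alpha X : Prop :=
  (forall t, 0 <= t <= T -> measurable_fun setT (X t)) /\
  {ae P, forall w, forall t, 0 <= t <= T -> forall i,
    lebesgue_measure.-integrable `[0, t]
      (fun s => (alpha s w ord0 i)%:E) /\
    X t w ord0 i = X 0 w ord0 i
      + \int[lebesgue_measure]_(s in `[0, t]) alpha s w ord0 i
      + delta * W t w ord0 i}.

End process.

Section density_equation.
Context {R : realType} {n : nat}.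
Implicit Types (phi : R -> 'rV[R]_n -> R) (mu : R -> probability 'rV[R]_n R).

(* C^{1,2} with support in x bounded uniformly in time; times outside [0, T]
   play no role. *)
Definition test_function phi : Prop :=
  [/\ exists M, forall s x, M < `|x| -> phi s x = 0,
      forall s x, derivable (phi^~ x) s 1,
      forall s x i, derivable (phi s) x (unitv i),
      forall s x i j, derivable ('D_(unitv i) (phi s)) x (unitv j) &
      [/\ continuous (fun p : R * 'rV[R]_n => phi p.1 p.2),
          continuous (fun p : R * 'rV[R]_n => 'D_1 (phi^~ p.2) p.1),
          forall i, continuous
            (fun p : R * 'rV[R]_n => 'D_(unitv i) (phi p.1) p.2) &
          forall i j, continuous
            (fun p : R * 'rV[R]_n =>
               'D_(unitv j) ('D_(unitv i) (phi p.1)) p.2)]].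

(* \int (d_t phi - (2 A x + B) . grad phi + delta^2/2 laplacian phi) dmu_s *)
Definition dual_term (delta : R) (A : R -> R) (B : R -> 'rV[R]_n) phi mu
    (s : R) : R :=
  \int[mu s]_x ('D_1 (phi^~ x) s - dotv (grad_value A B s x) (grad (phi s) x)
                + delta ^+ 2 / 2 * laplacian (phi s) x).

(* Measure-valued weak solution on [0, T] of
     d_t m - div (m (2 A x + B)) - delta^2/2 laplacian m = 0
   with initial value the Dirac mass at y. *)
Definition weak_solution (T delta : R) (A : R -> R) (B : R -> 'rV[R]_n)
    (y : 'rV[R]_n) mu : Prop :=
  forall phi, test_function phi -> forall t, 0 <= t <= T ->
    lebesgue_measure.-integrable `[0, t]
      (fun s => (dual_term delta A B phi mu s)%:E) /\
    \int[mu t]_x phi t x = phi 0 y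
      + \int[lebesgue_measure]_(s in `[0, t]) dual_term delta A B phi mu s.

End density_equation.

(* Main.v *)
(** If |A| blew up inside ]0, T[, there would be a last such time p.  As A + K t is
    nondecreasing when |a| <= K, A is bounded above, so it would tend to -oo at
    p from the right, where (ln (- A))' >= 2 A - K forces the integral of - A to
    diverge; this contradicts the finiteness of the propagator.  Hence A and B
    agree on ]0, T] with continuous At and Bt; let e(t) = exp(-2 \int_0^t At).

    With mb the solution started at 0 of mb' = - (2 A mb + B) and q' = e^-2,
    the Gaussian law of mean e(t) y + mb(t) and variance delta^2 e(t)^2 q(t) is a
    weak solution: differentiate \int phi(t, m(t) + sg(t) z) dgamma(z) and
    integrate by parts in z.

    Uniqueness is by duality.  The backward equation is solved explicitly by
    products of primitives Phi of exp(- u^2 / 2) composed with time-dependent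
    affine maps of the coordinates.  After a spatial cutoff these are test
    functions, and they determine the integral of such a product against mu_t;
    sharpening Phi into a step gives the mass of every orthant.

    Finally X solves a linear equation with additive noise, so
    X_t = mb(t) + delta (W_t - e(t) \int_0^t (2 A / e) W) almost surely, and its
    first two moments follow from those of W by Fubini. *)

From HB Require Import structures.
Require Import Defs.
From mathcomp Require Import all_boot all_order all_algebra.
From mathcomp Require Import all_classical all_reals all_analysis.
From mathcomp Require Import measurable_realfun ring lra.

Set Implicit Arguments.
Unset Strict Implicit.
Unset Printing Implicit Defensive.
Import Order.TTheory GRing.Theory Num.Theory.
Import numFieldNormedType.Exports.

Local Open Scope classical_set_scope.
Local Open Scope ring_scope.

(** * Calculus on the line *)

(** Two features of the data shape the proof. [A] and [B] are controlled only on ]0, T]: their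
    values at time 0 are arbitrary, and [A] is not known to be measurable across singular times. So
    boundedness has to be extracted from the propagator before integrals can be manipulated, and
    comparisons with [At] and [Bt] are made on half-open intervals. Moreover [delta] may vanish.
    Hence laws are affine images of a standard Gaussian, which survive zero variance, and the
    backward problem has a terminal profile of width [Num.sqrt eps] with eps > 0, smooth whatever
    the noise.

    The backward equation separates because the drift in coordinate i depends on that coordinate
    only and the noise is isotropic. One factor is the unnormalised probability that coordinate i at
    time t, blurred by an independent normal variable of variance eps, lies below a given bound. Its
    value at time 0 does not involve the weak solution, which is all that uniqueness uses. Cutting
    off costs terms in which the linearly growing drift meets the derivative of the cutoff c, so z
    c'(z) has to tend to 0 uniformly; this forces a logarithmic cutoff. *)

Section derivation_rules.
Context {R : realType}.
Implicit Types (f g : R -> R) (x : R).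

Lemma der_id x : is_derive x (1 : R) (fun z : R => z) 1.
Proof. exact: is_derive_id. Qed.

Lemma der_cst (c x : R) : is_derive x (1 : R) (fun=> c) 0.
Proof. exact: is_derive_cst. Qed.

Lemma derD f g x df dg : is_derive x 1 f df -> is_derive x 1 g dg ->
  is_derive x 1 (fun z => f z + g z) (df + dg).
Proof. by move=> Hf Hg; exact: (is_deriveD Hf Hg). Qed.

Lemma derN f x df : is_derive x 1 f df -> is_derive x 1 (fun z => - f z) (- df).
Proof. by move=> Hf; exact: (is_deriveN Hf). Qed.

Lemma derB f g x df dg : is_derive x 1 f df -> is_derive x 1 g dg ->
  is_derive x 1 (fun z => f z - g z) (df - dg).
Proof. by move=> Hf Hg; exact: (is_deriveB Hf Hg). Qed.

Lemma derM f g x df dg : is_derive x 1 f df -> is_derive x 1 g dg ->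
  is_derive x 1 (fun z => f z * g z) (f x * dg + g x * df).
Proof. by move=> Hf Hg; exact: (is_deriveM Hf Hg). Qed.

Lemma derZ f x (k : R) df : is_derive x 1 f df ->
  is_derive x 1 (fun z => k * f z) (k * df).
Proof. by move=> Hf; exact: (is_deriveZ k Hf). Qed.

Lemma derX f x (n : nat) df : is_derive x 1 f df ->
  is_derive x 1 (fun z => f z ^+ n) (n%:R * f x ^+ n.-1 * df).
Proof.
move=> Hf; have := is_deriveX n Hf.
by congr is_derive; apply/funext => z; rewrite exprfctE.
Qed.

Lemma der_comp f g x df dg : is_derive (g x) 1 f df -> is_derive x 1 g dg ->
  is_derive x 1 (fun z => f (g z)) (df * dg).
Proof. by move=> Hf Hg; exact: is_derive1_comp. Qed.

Lemma derV f x df : f x != 0 -> is_derive x 1 f df ->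
  is_derive x 1 (fun z => (f z)^-1) (- df / f x ^+ 2).
Proof.
move=> f0 Hf; apply: (is_derive_eq (is_deriveV f0 Hf)).
by rewrite /GRing.scale/= mulrC mulrN mulNr.
Qed.

Lemma der_expR f x df : is_derive x 1 f df ->
  is_derive x 1 (fun z => expR (f z)) (expR (f x) * df).
Proof. by move=> Hf; apply: der_comp. Qed.

Lemma der_gauss x :
  is_derive x (1 : R) (fun z : R => expR (- z ^+ 2 / 2)) (- (x * expR (- x ^+ 2 / 2))).
Proof.
have d2 : is_derive x (1 : R) (fun z : R => - z ^+ 2 / 2) (- x).
  rewrite (_ : (fun z => _) = fun z : R => - 2^-1 * z ^+ 2); last by apply/funext => z; ring.
  by apply: is_derive_eq (derZ (- 2^-1) (derX 2 (der_id x))) _; rewrite expr1; field.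
by apply: is_derive_eq (der_expR d2) _; rewrite mulrN mulrC.
Qed.

Lemma der_cont f x df : is_derive x 1 f df -> {for x, continuous f}.
Proof.
by case=> /derivable1_diffP Hf _; exact: differentiable_continuous.
Qed.

Lemma cont_der f df : (forall x : R, is_derive x (1 : R) f (df x)) -> continuous f.
Proof. by move=> H x; exact: (der_cont (H x)). Qed.

End derivation_rules.

Section monotonicity.
Context {R : realType}.

Lemma der_nondecreasing (F f : R -> R) :
  (forall x : R, is_derive x (1 : R) F (f x)) -> (forall x, 0 <= f x) ->
  {homo F : x y / x <= y}.
Proof.
move=> dF f0 x y xy; rewrite -subr_ge0.
have [|c _ ->] := @MVT_segment R F f x y xy.
  exact: continuous_subspaceT (cont_der dF).
by rewrite mulr_ge0// subr_ge0.
Qed.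

End monotonicity.

Section antiderivative.
Context {R : realType}.
Notation mu := (@lebesgue_measure R).
Implicit Types f F : R -> R.

Lemma continuous_integrable_itv f (a b : R) : continuous f ->
  mu.-integrable `[a, b] (EFin \o f).
Proof.
move=> cf; apply: continuous_compact_integrable; first exact: segment_compact.
exact: continuous_subspaceT.
Qed.

(** A primitive on the whole line, normalised at 0. Most time integrals below are evaluated by
    differentiating such a primitive, which reduces them to algebra. *)
Lemma exists_antiderivative f : continuous f ->
  exists F, F 0 = 0 /\ forall x : R, is_derive x (1 : R) F (f x).
Proof.
move=> cf.
pose G (N x : R) := \int[mu]_(t in `[N, x]) f t.
have GB (N M x : R) : N <= M -> M <= x -> G N x - G N M = G M x.
  move=> NM Mx; rewrite /G Rintegral_itvB ?bnd_simp//.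
    apply: Rintegral_itv_obnd_cbnd.
    by apply: integrableS (continuous_integrable_itv M x cf) => //;
      exact: subset_itv_oc_cc.
  exact: continuous_integrable_itv.
(* The base point lies to the left of both 0 and x, so negative x needs no signed integral; by [FE]
   any base point further left gives the same value. *)
pose F x := G (- (`|x| + 1)) x - G (- (`|x| + 1)) 0.
have FE (N x : R) : `|x| + 1 <= N -> F x = G (- N) x - G (- N) 0.
  move=> xN; rewrite /F -(GB (- N) (- (`|x| + 1)) x) ?lerN2//; last first.
    by rewrite lerNl; have := ler_norm (- x); rewrite normrN; lra.
  rewrite -(GB (- N) (- (`|x| + 1)) 0) ?lerN2//; first by ring.
exists F; split; first by rewrite /F subrr.
(* This [N] also serves every y within distance 1 of x, so that [F] is locally a primitive with a
   fixed base point. *)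
move=> x; pose N : R := `|x| + 2.
have [|||dG GE] := @continuous_FTC1_closed R f (- N) x (x + 1) _ _ _ (cf x).
- by rewrite ltrDl.
- exact: continuous_integrable_itv.
- by rewrite /N; have := ler_norm (- x); rewrite normrN; lra.
have : is_derive x 1 (fun y => G (- N) y - G (- N) 0) (f x - 0).
  have dGx : is_derive x 1 (G (- N)) (f x).
    by apply: DeriveDef; [exact: dG|rewrite -derive1E GE].
  exact: derB dGx (der_cst (G (- N) 0) x).
rewrite subr0; apply: near_eq_is_derive.
near=> y; apply/esym/FE.
have : `|x - y| < 1 by near: y; exact: (@nbhsx_ballx R R x 1 ltr01).
rewrite distrC /N; have := ler_normD (y - x) x; rewrite subrK; lra.
Unshelve. all: by end_near. Qed.

Lemma integral_derivative F f (a b : R) : a <= b ->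
  continuous f -> {within `[a, b], continuous F} ->
  (forall x : R, a < x < b -> is_derive x (1 : R) F (f x)) ->
  (\int[mu]_(x in `[a, b]) (f x)%:E = (F b - F a)%:E)%E.
Proof.
rewrite le_eqVlt => /predU1P[->|ab] cf cF dF.
  by rewrite subrr set_itv1 integral_set1.
have /continuous_within_itvP := cF => /(_ ab)[_ Fa Fb].
rewrite EFinB; apply: continuous_FTC2 => //.
- exact: continuous_subspaceT.
- by split=> // x; rewrite in_itv/= => /dF[].
- by move=> x; rewrite in_itv/= => /dF dFx; rewrite derive1E derive_val.
Qed.

Lemma Rintegral_derivative F f (a b : R) : a <= b ->
  continuous f -> {within `[a, b], continuous F} ->
  (forall x : R, a < x < b -> is_derive x (1 : R) F (f x)) ->
  \int[mu]_(x in `[a, b]) f x = F b - F a.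
Proof. by move=> *; rewrite /Rintegral (@integral_derivative F). Qed.

Lemma Rintegral_antiderivative f F (t : R) : 0 <= t ->
  continuous f -> F 0 = 0 -> (forall s : R, is_derive s (1 : R) F (f s)) ->
  \int[mu]_(s in `[0, t]) f s = F t.
Proof.
move=> t0 cf F0 dF.
by rewrite (Rintegral_derivative t0 cf (continuous_subspaceT (cont_der dF)) (fun s _ => dF s)) F0 subr0.
Qed.

End antiderivative.

Section continuity.
Context {R : realType} {T : topologicalType}.
Implicit Types f g : T -> R.

Lemma contD f g : continuous f -> continuous g -> continuous (fun x => f x + g x).
Proof. by move=> cf cg x; apply: cvgD; [exact: cf|exact: cg]. Qed.

Lemma contB f g : continuous f -> continuous g -> continuous (fun x => f x - g x).
Proof. by move=> cf cg x; apply: cvgB; [exact: cf|exact: cg]. Qed.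

Lemma contM f g : continuous f -> continuous g -> continuous (fun x => f x * g x).
Proof. by move=> cf cg x; apply: cvgM; [exact: cf|exact: cg]. Qed.

Lemma contX f (k : nat) : continuous f -> continuous (fun x => f x ^+ k).
Proof.
move=> cf x; apply: (@continuous_comp _ _ _ f (fun z : R => z ^+ k)); first exact: cf.
exact: exprn_continuous.
Qed.

Lemma cont_cst (c : R) : continuous (fun _ : T => c).
Proof. by move=> x; exact: cvg_cst. Qed.

Lemma cont_sum (I : finType) (F : I -> T -> R) :
  (forall i, continuous (F i)) -> continuous (fun x => \sum_i F i x).
Proof.
move=> cF; have : forall r : seq I, continuous (fun x => \sum_(i <- r) F i x).
  elim=> [|i r IH].
    by under eq_fun do rewrite big_nil; exact: cont_cst.
  by under eq_fun do rewrite big_cons; exact: contD.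
exact.
Qed.

End continuity.

Section positive_part_powers.
Context {R : realType}.

Definition pos (v : R) : R := Num.max 0 v.

Lemma pos_ge0 v : 0 <= pos v.
Proof. by rewrite /pos le_max lexx. Qed.

Lemma pos_id v : 0 <= v -> pos v = v.
Proof. by rewrite /pos; case: ltgtP. Qed.

Lemma pos_eq0 v : v <= 0 -> pos v = 0.
Proof. by rewrite /pos; case: ltgtP. Qed.

Lemma pos_continuous : continuous pos.
Proof. by move=> x; apply: continuous_max; [exact: cst_continuous|exact: cvg_id]. Qed.

Lemma posX_continuous (n : nat) : continuous (fun v => pos v ^+ n).
Proof. by apply: contX; exact: pos_continuous. Qed.

(** At the corner the slope function is [pos z ^+ n.+1], continuous and zero there. Squares and
    cubes of [pos] thus give the C^1 truncation of the variance and the C^2 cutoff. *)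
Lemma der_posX (n : nat) v :
  is_derive v (1 : R) (fun z => pos z ^+ n.+2) (n.+2%:R * pos v ^+ n.+1).
Proof.
case: (ltgtP 0 v) => v0.
- rewrite pos_id 1?ltW//.
  have := derX n.+2 (der_id v); rewrite mulr1; apply: near_eq_is_derive.
  by near=> z; rewrite pos_id// ltW//; near: z; exact: lt_nbhsr.
- rewrite pos_eq0 1?ltW// expr0n mulr0.
  have := der_cst 0 v; apply: near_eq_is_derive.
  by near=> z; rewrite pos_eq0 ?expr0n// ltW//; near: z; exact: lt_nbhsl.
- rewrite -v0 [in X in is_derive _ _ _ X]pos_id// expr0n mulr0.
  apply/is_derive1_caratheodory; exists (fun z => pos z ^+ n.+1); split.
  + move=> z; rewrite subr0 (pos_id (lexx 0)) [X in _ - X]expr0n subr0 exprSr.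
    case: (lerP 0 z) => z0; first by rewrite pos_id.
    by rewrite pos_eq0 1?ltW// expr0n/= !mul0r.
  + exact: posX_continuous.
  + by rewrite pos_id// expr0n.
Unshelve. all: by end_near. Qed.

End positive_part_powers.

Section gaussian_primitive.
Context {R : realType}.

(** The total mass is left unevaluated: only its finiteness and positivity matter. As [F] is odd,
    its supremum gives the limits at both ends, and adding that supremum makes the primitive start
    from 0. *)
Lemma exists_gaussian_primitive : exists (Phi : R -> R) (L : R),
  [/\ 0 < L, forall u : R, is_derive u (1 : R) Phi (expR (- u ^+ 2 / 2)),
      forall u, 0 <= Phi u <= L, Phi x @[x --> -oo] --> 0
    & Phi x @[x --> +oo] --> L].
Proof.
pose g (u : R) := expR (- u ^+ 2 / 2).
have [F [F0 dF]] := exists_antiderivative (cont_der (@der_gauss R)).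
have F_nd : {homo F : x y / x <= y}.
  by apply: der_nondecreasing dF _ => x; exact: expR_ge0.
have F_odd u : F (- u) = - F u.
  apply/eqP; rewrite -addr_eq0; apply/eqP.
  pose H x := F (- x) + F x.
  have dH (x : R) : is_derive x (1 : R) H 0.
    have := derD (der_comp (dF (- x)) (derN (der_id x))) (dF x).
    by rewrite /g sqrrN mulrN mulr1 addNr.
  by rewrite -[LHS]/(H u) (is_derive_0_is_cst u 0 dH) /H oppr0 F0 addr0.
(* [- u ^ 2 / 2 <= 1 / 2 - u] *)
have F_ub u : F u <= expR (2^-1).
  case: (leP u 0) => u0.
    by apply: (le_trans (F_nd _ _ u0)); rewrite F0 expR_ge0.
  pose H x := - F x - expR (2^-1 - x).
  have dH (x : R) : is_derive x (1 : R) H (- g x + expR (2^-1 - x)).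
    have := derB (derN (dF x)) (der_expR (derB (der_cst 2^-1 x) (der_id x))).
    by rewrite sub0r mulrN1 opprK.
  have dH_ge0 x : 0 <= - g x + expR (2^-1 - x).
    by rewrite addrC subr_ge0 ler_expR; have := sqr_ge0 (x - 1); lra.
  have := der_nondecreasing dH dH_ge0 (ltW u0).
  rewrite /H F0 subr0 oppr0 sub0r.
  by have := expR_ge0 (2^-1 - u); lra.
have ubF : has_ubound (range F) by exists (expR 2^-1) => _ [u _ <-].
have FL := nondecreasing_cvgr F_nd ubF.
set L := sup (range F) in FL.
have FleL u : F u <= L by apply: ub_le_sup => //; exists u.
have L0 : 0 < L.
  apply: lt_le_trans (FleL 1).
  have [|c _] := @MVT_segment R F g 0 1 ler01.
    exact: continuous_subspaceT (cont_der dF).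
  by rewrite F0 !subr0 mulr1 => ->; exact: expR_gt0.
exists (fun u => F u + L), (L + L); split.
- by rewrite addr_gt0.
- by move=> u; have := derD (dF u) (der_cst L u); rewrite addr0.
- by move=> u; have := FleL u; have := FleL (- u); rewrite F_odd; lra.
- rewrite -(addNr L); apply: cvgD; last exact: cvg_cst.
  apply/cvgNy_compNP; rewrite (_ : F \o _ = - F); first exact: cvgN.
  by apply/funext => u /=; rewrite F_odd.
- by apply: cvgD => //; exact: cvg_cst.
Qed.

End gaussian_primitive.

(** * Measurability in R^n *)

Section real_integrable.
Context d (T : measurableType d) (R : realType) (mu : {measure set T -> \bar R}).
Implicit Types f g : T -> R.

Lemma integrable_scale f (k : R) : mu.-integrable setT (EFin \o f) ->
  mu.-integrable setT (EFin \o (fun x => k * f x)).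
Proof. exact: integrableZl. Qed.

Lemma integrable_add f g : mu.-integrable setT (EFin \o f) ->
  mu.-integrable setT (EFin \o g) -> mu.-integrable setT (EFin \o (fun x => f x + g x)).
Proof. exact: integrableD. Qed.

Lemma integrable_sub f g : mu.-integrable setT (EFin \o f) ->
  mu.-integrable setT (EFin \o g) -> mu.-integrable setT (EFin \o (fun x => f x - g x)).
Proof. exact: integrableB. Qed.

End real_integrable.

Section measurable_countable.
Context d {T : measurableType d} {I : countType} d' {U : measurableType d'}.

(** Rounding to a grid gives a countably valued [h]. Measurability of continuous functions on R^n
    and of processes with continuous paths both follow from this case by pointwise limits. *)
Lemma measurable_fun_countable (h : T -> I) (F : I -> T -> U) :
  (forall i, measurable (h @^-1` [set i])) ->
  (forall i, measurable_fun setT (F i)) ->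
  measurable_fun setT (fun t => F (h t) t).
Proof.
move=> mh mF _ Y mY; rewrite setTI.
rewrite (_ : _ @^-1` Y = \bigcup_i (h @^-1` [set i] `&` F i @^-1` Y)).
  apply: countable_bigcupT_measurable; first exact: countableP.
  by move=> i; apply: measurableI => //; rewrite -[X in measurable X]setTI; exact: mF.
by apply/seteqP; split=> [t Yt|t [i _ [<-]]//]; exists (h t).
Qed.

End measurable_countable.

Section rV_measurability.
Context {R : realType}.

Lemma measurable_coord (n : nat) (i : 'I_n) :
  measurable_fun setT (fun x : 'rV[R]_n => x ord0 i).
Proof.
move=> _ Y mY; rewrite setTI; apply: sub_sigma_algebra => /=.
rewrite -bigcup_seq/=; exists i => /=; first by rewrite mem_index_enum.
by exists Y => //; rewrite setTI.
Qed.

Lemma measurable_fun_rVP d (T : measurableType d) (n : nat) (f : T -> 'rV[R]_n) :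
  measurable_fun setT f <->
  forall i, measurable_fun setT (fun t => f t ord0 i).
Proof.
split=> [mf i|mf].
  exact: (measurableT_comp (measurable_coord i) mf).
move=> _ Y mY; rewrite setTI.
move: Y mY; apply: smallest_sub.
  split => /=.
  - by rewrite preimage_set0; exact: measurable0.
  - by move=> A mA; rewrite setTD preimage_setC; exact: measurableC.
  - by move=> A mA; rewrite preimage_bigcup; exact: bigcupT_measurable.
rewrite -bigcup_seq/=; apply: bigcup_sub => i _ _ [B mB <-].
by rewrite setTI -[X in measurable X]setTI; exact: mf.
Qed.

Lemma cvg_rV (T : Type) (F : set_system T) (n : nat) (f : T -> 'rV[R]_n)
    (l : 'rV[R]_n) : Filter F ->
  (forall i, f t ord0 i @[t --> F] --> l ord0 i) -> f t @[t --> F] --> l.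
Proof.
move=> FF fl A [P lP PA].
suff : \forall t \near F, forall i, P ord0 i (f t ord0 i).
  by apply: filterS => t Pt; apply: PA => i j; rewrite (ord1 i).
by apply: filter_forall => i; apply: fl; exact: lP.
Qed.

Lemma continuous_rV (T : topologicalType) (n : nat) (f : T -> 'rV[R]_n) :
  (forall i, continuous (fun t => f t ord0 i)) -> continuous f.
Proof. by move=> cf t; apply: cvg_rV => i; exact: cf. Qed.

Lemma floor_cvg (x : R) :
  (Num.floor (x * k.+1%:R))%:~R / k.+1%:R @[k --> \oo] --> x.
Proof.
apply/cvgrPdist_lt => e e0; near=> k.
have k0 : 0 < k.+1%:R :> R by [].
have /andP[l u] := floor_itv (x * k.+1%:R).
have ke : k.+1%:R^-1 < e by near: k; exact: (near_infty_natSinv_lt (PosNum e0)).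
rewrite ger0_norm ?subr_ge0 ?ler_pdivrMr//.
rewrite (le_lt_trans _ ke)// lerBlDr -[X in X + _]mul1r -mulrDl.
by rewrite ler_pdivlMr// addrC; rewrite intrD in u; exact: ltW.
Unshelve. all: by end_near. Qed.

Lemma measurable_floor_eq d (T : measurableType d) (g : T -> R) (z : int) :
  measurable_fun setT g -> measurable ((fun t => Num.floor (g t)) @^-1` [set z]).
Proof.
move=> mg.
rewrite (_ : _ @^-1` _ = g @^-1` `[z%:~R, (z + 1)%:~R[).
  by rewrite -[X in measurable X]setTI; exact: mg.
apply/seteqP; split => t /=; rewrite in_itv/=.
  by move=> <-; exact: floor_itv.
by move=> ?; exact: floor_def.
Qed.

(** The sigma-algebra is generated by the coordinates and not by the open sets, so x is rounded down
    to the grid of mesh 1 / (k + 1). The rounded point ranges over a countable set, and [f] is the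
    limit of its values there. *)
Lemma continuous_measurable_rV (n : nat) (f : 'rV[R]_n -> R) :
  continuous f -> measurable_fun setT f.
Proof.
move=> cf.
pose h (k : nat) (x : 'rV[R]_n) : {ffun 'I_n -> int} :=
  [ffun i => Num.floor (x ord0 i * k.+1%:R)].
pose r (k : nat) (z : {ffun 'I_n -> int}) : 'rV[R]_n :=
  \row_i ((z i)%:~R / k.+1%:R).
apply: (@measurable_fun_cvg _ _ _ _ (fun k x => f (r k (h k x)))).
  move=> k; apply: (measurable_fun_countable (F := fun z _ => f (r k z))) => // z.
  rewrite (_ : h k @^-1` [set z] = \bigcap_(i in [set: 'I_n])
     [set x | Num.floor (x ord0 i * k.+1%:R) = z i]).
    apply: fin_bigcap_measurable => // i _.
    apply: measurable_floor_eq; apply: measurable_funM => //.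
    exact: measurable_coord.
  apply/seteqP; split => x /=.
    by move=> <- i _ /=; rewrite ffunE.
  by move=> H; apply/ffunP => i; rewrite ffunE; exact: H.
move=> x _; apply: (cvg_comp (fun k => r k (h k x))) (cf x).
apply: cvg_rV => i.
under eq_fun do rewrite mxE ffunE.
exact: floor_cvg.
Qed.

(** The map of the pushforward in [lebesgue_rV]; inductions on the dimension peel off the first
    coordinate through it. *)
Definition consv (n : nat) (p : R * 'rV[R]_n) : 'rV[R]_n.+1 := row_mx p.1%:M p.2.

Definition unconsv (n : nat) (x : 'rV[R]_n.+1) : R * 'rV[R]_n :=
  (x ord0 ord0, \row_j x ord0 (lift ord0 j)).

Lemma consv0 (n : nat) (p : R * 'rV[R]_n) : consv p ord0 ord0 = p.1.
Proof.
rewrite /consv (_ : ord0 = lshift n (ord0 : 'I_1)); last exact: val_inj.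
by rewrite (@row_mxEl _ 1 1 n) mxE mulr1n.
Qed.

Lemma consvS (n : nat) (p : R * 'rV[R]_n) j : consv p ord0 (lift ord0 j) = p.2 ord0 j.
Proof.
rewrite /consv (_ : lift ord0 j = rshift 1 j); last exact: val_inj.
by rewrite (@row_mxEr _ 1 1 n).
Qed.

Lemma unconsvK (n : nat) : cancel (@unconsv n) (@consv n).
Proof.
move=> x; apply/rowP => i; case: (unliftP ord0 i) => [j|] ->.
  by rewrite consvS mxE.
by rewrite consv0.
Qed.

Lemma consvK (n : nat) : cancel (@consv n) (@unconsv n).
Proof.
move=> [a v]; rewrite /unconsv consv0; congr pair.
by apply/rowP => j; rewrite mxE consvS.
Qed.

Lemma measurable_consv (n : nat) : measurable_fun setT (@consv n).
Proof.
apply/measurable_fun_rVP => i; case: (unliftP ord0 i) => [j|] ->.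
  under eq_fun do rewrite consvS.
  by apply: (measurableT_comp (measurable_coord j)).
by under eq_fun do rewrite consv0; exact: measurable_fst.
Qed.

Lemma measurable_unconsv (n : nat) : measurable_fun setT (@unconsv n).
Proof.
apply/measurable_fun_pairP; split; first exact: measurable_coord.
apply/measurable_fun_rVP => j; rewrite /comp/=.
by under eq_fun do rewrite mxE; exact: measurable_coord.
Qed.

Lemma measurable_orthant (n : nat) (b : 'rV[R]_n) :
  measurable [set x : 'rV[R]_n | forall i, x ord0 i <= b ord0 i].
Proof.
rewrite (_ : [set x | _] = \bigcap_(i in [set: 'I_n]) [set x : 'rV[R]_n | x ord0 i <= b ord0 i]).
  apply: fin_bigcap_measurable => // i _.
  rewrite (_ : [set x | _] = (fun x : 'rV[R]_n => x ord0 i) @^-1` `]-oo, b ord0 i]).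
    by rewrite -[X in measurable X]setTI; exact: measurable_coord.
  by apply/seteqP; split => x /=; rewrite in_itv.
by apply/seteqP; split=> [x xb i _|x xb i]; exact: xb.
Qed.

(** Orthants are stable under intersection, by coordinatewise minima of their corners; they generate
    the sigma-algebra, and those with corner (k, ..., k) exhaust the space. *)
Lemma orthant_measure_unique (n : nat) (m1 m2 : probability 'rV[R]_n R) :
  (forall b : 'rV[R]_n, m1 [set x | forall i, x ord0 i <= b ord0 i] =
     m2 [set x | forall i, x ord0 i <= b ord0 i]) ->
  forall S, measurable S -> m1 S = m2 S.
Proof.
move=> m12.
pose orth (b : 'rV[R]_n) := [set x : 'rV[R]_n | forall i, x ord0 i <= b ord0 i].
pose G := range orth.
have morth b : measurable (orth b) := measurable_orthant b.
have mG A : G A -> measurable A by move=> [b _ <-].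
have ub (x : 'rV[R]_n) : exists k : nat, forall i, x ord0 i <= k%:R.
  have : \forall k \near \oo, forall i, x ord0 i <= k%:R.
    by apply: filter_forall => i; exact: nbhs_infty_ger.
  by case=> k _ /(_ k (leqnn k)); exists k.
apply: (measure_unique G (fun k => orth (const_mx k%:R))) => //.
- apply/seteqP; split; last by apply: smallest_sub => //; exact: sigma_algebra_measurable.
  apply: smallest_sub; first exact: smallest_sigma_algebra.
  rewrite -bigcup_seq/=; apply: bigcup_sub => i _ _ [B mB <-].
  rewrite setTI.
  pose coord (x : g_sigma_algebraType G) : R := (x : 'rV[R]_n) ord0 i.
  suff : measurable_fun setT coord by move=> /(_ measurableT _ mB); rewrite setTI.
  apply: (measurability _ (RGenOInfty.measurableE R)) => _ [_ [c ->] <-].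
  rewrite setTI -[X in measurable X]setCK; apply: measurableC.
  (* A closed half-space is the increasing union of the orthants whose other bounds all equal k. *)
  pose bk (k : nat) : 'rV[R]_n := \row_j if j == i then c else k%:R.
  rewrite (_ : ~` _ = \bigcup_k orth (bk k)).
    by apply: bigcupT_measurable => k; apply: sub_sigma_algebra; exists (bk k).
  apply/seteqP; split => [x|x [k _ xk]] /=; rewrite in_itv/= andbT.
    move=> /negP; rewrite -leNgt => xc; have [k xk] := ub x.
    by exists k => // j; rewrite mxE; case: eqP => [->|_].
  by have := xk i; rewrite mxE eqxx /coord leNgt => /negP.
- move=> _ _ [b _ <-] [c _ <-]; exists (\row_i Num.min (b ord0 i) (c ord0 i)) => //.
  apply/seteqP; split => x /=.
    by move=> xbc; split => i; have := xbc i; rewrite mxE le_min => /andP[].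
  by move=> [xb xc] i; rewrite mxE le_min xb xc.
- by move=> k; exists (const_mx k%:R).
- apply/seteqP; split=> // x _; have [k xk] := ub x.
  by exists k => // i; rewrite mxE.
- by move=> _ [b _ <-]; exact: m12.
- by move=> k; rewrite (le_lt_trans (probability_le1 _ _))// ltry.
Qed.

End rV_measurability.

(** * Regularity of the Riccati solution *)

Section clamp.
Context {R : realType}.

(** Freezing the argument at the end points extends a function continuous on [a, b] to the whole
    line, where [exists_antiderivative] applies. *)
Definition clamp (a b x : R) : R := Num.max a (Num.min b x).

Lemma clamp_continuous (a b : R) : continuous (clamp a b).
Proof.
move=> x; apply: continuous_max; first exact: cst_continuous.
by apply: continuous_min; [exact: cst_continuous|exact: cvg_id].
Qed.

Lemma clamp_in (a b x : R) : a <= b -> a <= clamp a b x <= b.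
Proof. by move=> ab; rewrite /clamp le_max lexx ge_max ab/= ge_min lexx. Qed.

Lemma clamp_id (a b x : R) : a <= x <= b -> clamp a b x = x.
Proof.
by move=> /andP[ax xb]; rewrite /clamp (min_idPr xb) (max_idPr ax).
Qed.

Lemma continuous_clamp (a b : R) (f : R -> R) : a <= b ->
  {within `[a, b], continuous f} -> continuous (fun x => f (clamp a b x)).
Proof.
move=> ab cf x; have cx := clamp_in x ab.
have {cf} := (subspace_continuousP _ _).1 cf (clamp a b x).
rewrite /= in_itv/= => /(_ cx) cf; apply: cvg_comp cf => V V1.
have H : \forall y \near x, `[a, b]%classic (clamp a b y) -> V (clamp a b y).
  exact: (@clamp_continuous a b x _ V1).
suff : \forall y \near x, V (clamp a b y) by [].
by apply: filterS H => y; apply; rewrite /= in_itv/= (clamp_in y ab).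
Qed.

End clamp.

Section open_interval_monotonicity.
Context {R : realType}.
Variables (p q : R) (F f : R -> R).
Hypothesis dF : forall x : R, p < x < q -> is_derive x (1 : R) F (f x).

Lemma der_within_continuous (s t : R) : p < s -> t < q ->
  {within `[s, t], continuous F}.
Proof.
move=> ps tq; apply: derivable_within_continuous => x; rewrite in_itv/= => /andP[sx xt].
have := dF; case/(_ x) => //.
by rewrite (lt_le_trans ps)// (le_lt_trans xt).
Qed.

Lemma der_nondecreasing_oo (s t : R) : (forall x, p < x < q -> 0 <= f x) ->
  p < s -> s <= t -> t < q -> F s <= F t.
Proof.
move=> f0 ps st tq; rewrite -subr_ge0.
have H x : s <= x <= t -> p < x < q.
  by move=> /andP[sx xt]; rewrite (lt_le_trans ps)// (le_lt_trans xt).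
have [|c + ->] := @MVT_segment R F f s t st _ (der_within_continuous ps tq).
  by move=> x; rewrite in_itv/= => /andP[sx xt]; apply/dF/H; rewrite !ltW.
by rewrite in_itv/= => /H/f0 fc; rewrite mulr_ge0// subr_ge0.
Qed.

End open_interval_monotonicity.

Section integral_without_measurability.
Context d (T : measurableType d) (R : realType) (mu : {measure set T -> \bar R}).

Import HBNNSimple.

(** Immediate from the integral as a supremum over simple functions below the integrand.
    Measurability is avoided because [A] is not known to be measurable when its integral is first
    estimated. *)
Lemma ge0_subset_integral_nomeas (A B : set T) (f : T -> \bar R) :
  (forall x, B x -> 0 <= f x)%E -> A `<=` B ->
  (\int[mu]_(x in A) f x <= \int[mu]_(x in B) f x)%E.
Proof.
move=> f0 AB; rewrite !ge0_integralE//; last by move=> x /AB; exact: f0.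
apply: ge_ereal_sup => _ /= [h hA <-]; apply: ereal_sup_ubound; exists h => //= x.
apply: le_trans (hA x) _; rewrite /patch; case: ifPn => [/set_mem xA|_].
  by rewrite mem_set//; exact: AB.
by case: ifPn => // /set_mem; exact: f0.
Qed.

End integral_without_measurability.

Section riccati.
Context {R : realType}.
Notation mu := (@lebesgue_measure R).
Variables (p T K AT : R) (a A : R -> R).
Hypothesis pT : p < T.
Hypothesis aK : forall t : R, p < t < T -> `|a t| <= K.
Hypothesis dA : forall t : R, p < t < T ->
  is_derive t (1 : R) A (2 * A t ^+ 2 - a t).
Hypothesis A_T : A s @[s --> T^'-] --> AT.

Let K_ge0 : 0 <= K.
Proof.
have pm : p < (p + T) / 2 < T by rewrite (midf_lt pT).1 (midf_lt pT).2.
by apply: le_trans (aK pm); exact: normr_ge0.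
Qed.

Lemma riccati_slope (s t : R) : p < s -> s <= t -> t < T ->
  A s + K * s <= A t + K * t.
Proof.
apply: (@der_nondecreasing_oo _ p T (fun z => A z + K * z) (fun z => 2 * A z ^+ 2 - a z + K)).
  move=> x xpT; have := derD (dA xpT) (derZ K (der_id x)).
  by rewrite mulr1.
move=> x xpT; have := aK xpT; rewrite ler_norml => /andP[_ axK].
by have := sqr_ge0 (A x); lra.
Qed.

Lemma riccati_ub (s : R) : p < s < T -> A s + K * s <= AT + K * T.
Proof.
move=> /andP[ps sT].
have AKT : A t + K * t @[t --> T^'-] --> AT + K * T.
  apply: cvgD => //; apply: cvgM; first exact: cvg_cst.
  exact: cvg_at_left_filter.
apply: (cvgr_to_ge AKT); near=> t; apply: riccati_slope => //.
by near: t; apply: nbhs_left_ge.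
Unshelve. all: by end_near. Qed.

(** The differential inequality integrated up to a fixed time u: as s decreases, a bound on the
    integral of [- A] becomes a bound on [ln (- A s)]. *)
Lemma riccati_integral_bound (s u : R) : p < s -> s <= u -> u < T ->
  (forall t : R, p < t <= u -> A t <= - 1) ->
  \int[mu]_(t in `[s, u]) - A t >= 2^-1 * (ln (- A s) - ln (- A u) - K * (u - s)).
Proof.
move=> ps su uT A1.
have ps_ t : s <= t <= u -> p < t < T.
  by move=> /andP[st tu]; rewrite (lt_le_trans ps)// (le_lt_trans tu).
pose Ac t := - A (clamp s u t).
have cAc : continuous Ac.
  move=> x; apply: continuousN; move: x; apply: continuous_clamp => //.
  exact: (der_within_continuous dA).
have [F [_ dF]] := exists_antiderivative cAc.
have -> : \int[mu]_(t in `[s, u]) - A t = F u - F s.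
  rewrite -(@Rintegral_derivative _ F Ac)//.
  - apply: eq_Rintegral => t /set_mem/=; rewrite in_itv/= => tsu.
    by rewrite /Ac clamp_id.
  - exact: continuous_subspaceT (cont_der dF).
(* [(ln (- A))' = 2 A - a / A >= 2 A - K] where [A <= -1] *)
pose D t := ln (- A t) + 2 * F t + K * t.
have dD t : s <= t <= u -> is_derive t (1 : R) D (K - a t / A t).
  move=> stu; have /andP[st tu] := stu.
  have At1 : A t <= -1 by apply: A1; rewrite (lt_le_trans ps st).
  have At0 : 0 < - A t by lra.
  have dlnA := @der_comp _ (@ln R) (fun z => - A z) t _ _ (is_derive1_ln At0)
    (derN (dA (ps_ _ stu))).
  have := derD (derD dlnA (derZ 2 (dF t))) (derZ K (der_id t)).
  rewrite /Ac clamp_id// => /is_derive_eq; apply.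
  by field; rewrite -oppr_eq0 gt_eqF.
have cD : {within `[s, u], continuous D}.
  apply: derivable_within_continuous => t; rewrite in_itv/= => /dD.
  by case.
have [|c + Dsu] := @MVT_segment R D (fun t => K - a t / A t) s u su _ cD.
  by move=> x; rewrite in_itv/= => /andP[sx xu]; apply: dD; rewrite !ltW.
rewrite in_itv/= => csu.
have : 0 <= D u - D s.
  rewrite Dsu mulr_ge0 ?subr_ge0//.
  apply: le_trans (ler_norm _) _; rewrite normrM normfV.
  have Ac1 : 1 <= `|A c|.
    have : A c <= -1.
      by apply: A1; case/andP: csu => sc ->; rewrite (lt_le_trans ps sc).
    by move=> ?; rewrite ler0_norm; lra.
  rewrite ler_pdivrMr; last by lra.
  by apply: le_trans (aK (ps_ _ csu)) _; rewrite ler_peMr.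
by rewrite /D; lra.
Qed.

(** Either [A] stays above a fixed level, or it is below that level at some u. In the second case
    the slope bound keeps [A] negative on all of ]p, u], where the integral estimate up to u
    applies. *)
Lemma riccati_lb (I : R) :
  (forall s u : R, p < s -> s <= u -> u < T ->
    (forall t : R, s <= t <= u -> A t <= 0) -> \int[mu]_(t in `[s, u]) - A t <= I) ->
  exists M, forall s : R, p < s < T -> `|A s| <= M.
Proof.
move=> intA.
suff [M HM] : exists M, forall s : R, p < s < T -> - M <= A s.
  exists (Num.max M (AT + K * (T - p))) => s psT.
  rewrite ler_norml; apply/andP; split.
    by apply: le_trans (HM _ psT); rewrite lerN2 le_max lexx.
  rewrite le_max; apply/orP; right; have := riccati_ub psT.
  have : K * (T - s) <= K * (T - p) by rewrite ler_wpM2l ?K_ge0// lerD2l lerN2; case/andP: psT => /ltW.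
  by lra.
(* The level is chosen so that the slope bound, which loses at most K (T - p), still leaves
   [A t <= -1] for every t in ]p, u]. *)
have [[u puT Au]|] := pselect (exists2 u, p < u < T & A u <= - 1 - K * (T - p)); last first.
  move=> H; exists (1 + K * (T - p)) => s psT; rewrite leNgt; apply/negP => As.
  by apply: H; exists s => //; lra.
have /andP[pu uT] := puT.
have A1 t : p < t <= u -> A t <= -1.
  move=> /andP[pt tu]; have := riccati_slope pt tu uT.
  have : K * (u - t) <= K * (T - p) by rewrite ler_wpM2l ?K_ge0//; lra.
  by lra.
(* The integral estimate solved for [ln (- A s)]; the second entry of the maximum below covers s >
   u. *)
pose C := 2 * I + K * (T - p) + ln (- A u).
exists (Num.max (expR C) (- A u + K * (T - p))) => s /andP[ps sT].
rewrite -lerN2 opprK le_max; case: (leP s u) => su; last first.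
  apply/orP; right; have := riccati_slope pu (ltW su) sT.
  have : K * (s - u) <= K * (T - p) by rewrite ler_wpM2l ?K_ge0//; lra.
  by lra.
apply/orP; left.
have As0 : 0 < - A s by have := A1 s; rewrite ps su => /(_ isT); lra.
rewrite -[leLHS]lnK ?posrE// ler_expR /C.
have := riccati_integral_bound ps su uT A1.
have := intA s u ps su uT; set J := \int[_]_(_ in _) _.
have : K * (u - s) <= K * (T - p) by rewrite ler_wpM2l ?K_ge0//; lra.
have A0 t : s <= t <= u -> A t <= 0.
  by move=> /andP[st tu]; have := A1 t; rewrite (lt_le_trans ps st) tu => /(_ isT); lra.
by move=> H /(_ A0); lra.
Qed.

End riccati.

Lemma der_coord {R : realType} {n : nat} (f : R -> 'rV[R]_n) (t : R) (df : 'rV[R]_n)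
    (i : 'I_n) :
  is_derive t (1 : R) f df -> is_derive t (1 : R) (fun s => f s ord0 i) (df ord0 i).
Proof.
move=> [df1 dfE]; apply: DeriveDef; first by move/derivable_mxP : df1; exact.
by rewrite -dfE derive_mx// mxE.
Qed.

Section riccati_regularity.
Context {R : realType} {n : nat}.
Notation mu := (@lebesgue_measure R).
Variables (T : R) (a : R -> R) (b : R -> 'rV[R]_n) (AT : R) (BT : 'rV[R]_n).
Variables (A : R -> R) (B : R -> 'rV[R]_n).
Hypothesis T_gt0 : 0 < T.
Hypothesis a_cont : {within `[0, T], continuous a}.
Hypothesis b_cont : {within `[0, T], continuous b}.
Hypothesis AB_sol : riccati_solution T a b AT BT A B.
Hypothesis A_fin : (propagator A 0 T < +oo)%E.

Lemma within_continuous_bounded (f : R -> R) : {within `[0, T], continuous f} ->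
  exists K, forall t : R, 0 <= t <= T -> `|f t| <= K.
Proof.
move=> cf; have cnf : {within `[0, T], continuous (fun t => `|f t|)}.
  by move=> x; apply: cvg_norm; exact: cf.
have [c _ fc] := EVT_max (ltW T_gt0) cnf.
by exists `|f c| => t t0T; apply: fc; rewrite in_itv.
Qed.

(** If the negative part of [A] had infinite integral, the integral of [A] would be -oo by
    convention, whatever the positive part, and the propagator infinite. So the negative part has
    finite integral, which bounds it on every subinterval. *)
Lemma propagator_fin_lb : exists I, forall s u : R, 0 < s -> s <= u -> u < T ->
  (forall t : R, s <= t <= u -> A t <= 0) ->
  \int[mu]_(t in `[s, u]) - A t <= I.
Proof.
pose N := (\int[mu]_(t in `[0%R, T]) ((fun t => (A t)%:E)^\- t))%E.
have N_ge0 : (0 <= N)%E by apply: integral_ge0 => t _; exact: funeneg_ge0.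
have N_fin : (N < +oo)%E.
  rewrite ltNge leye_eq; apply/negP => /eqP N_oo.
  move: A_fin; rewrite /propagator integralE -/N N_oo.
  by rewrite addeNy gt0_muleNy//= ltxx.
exists (fine N) => s u s0 su uT A0.
pose J := (\int[mu]_(t in `[s, u]) ((fun t => (A t)%:E)^\- t))%E.
have -> : \int[mu]_(t in `[s, u]) - A t = fine J.
  congr fine; apply: eq_integral => t /set_mem/=; rewrite in_itv/= => /A0 At.
  by rewrite funenegE -EFinN max_l// lee_fin oppr_ge0.
have JN : (J <= N)%E.
  apply: ge0_subset_integral_nomeas; first by move=> t _; exact: funeneg_ge0.
  by apply: subset_itvScc; rewrite ?bnd_simp ltW.
have J0 : (0 <= J)%E by apply: integral_ge0 => t _; exact: funeneg_ge0.
by apply: fine_le => //; rewrite ge0_fin_numE// (le_lt_trans JN).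
Qed.

Lemma not_singular_bounded (t e M : R) : 0 < e ->
  (forall s : R, `|s - t| < e -> s != t -> `|A s| <= M) -> ~ singular_time A t.
Proof.
move=> e0 AM /cvgryPgt /(_ M) tA.
have : \forall s \near t^', False.
  near=> s; have : M < `|A s| by near: s.
  apply/negP; rewrite -leNgt; apply: AM; near: s; last exact: nbhs_dnbhs_neq.
  apply: nbhs_dnbhs; near=> s; rewrite distrC; near: s; exact: (@nbhsx_ballx _ R t e e0).
by move=> /filter_ex[].
Unshelve. all: by end_near. Qed.

Lemma exists_riccati_bound (p : R) : p < T -> 0 <= p ->
  (forall t : R, p < t < T -> ~ singular_time A t) ->
  exists M, forall s : R, p < s < T -> `|A s| <= M.
Proof.
move=> pT p0 ns; have [I HI] := propagator_fin_lb.
have [K aK] := within_continuous_bounded a_cont.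
case: AB_sol => dAB _ A_T _ _.
apply: (@riccati_lb _ p T K AT a A pT _ _ A_T I).
- by move=> t /andP[pt tT]; apply: aK; rewrite !ltW// (le_lt_trans p0).
- move=> t /andP[pt tT]; have [] := dAB t; rewrite ?(le_lt_trans p0 pt)//.
  by apply: ns; rewrite pt.
- by move=> s u ps; apply: HI; exact: le_lt_trans ps.
Qed.

Lemma riccati_no_singularity (t : R) : 0 < t < T -> ~ singular_time A t.
Proof.
move=> t0T tA; pose S := [set t | 0 < t < T /\ singular_time A t].
(* Convergence of [A] at T keeps singular times below T - e, so that their supremum is less than
   T. *)
have [e e0 AT_bd] : exists2 e : R, 0 < e & forall s : R, T - e < s < T -> `|A s| <= `|AT| + 1.
  case: AB_sol => _ _ /cvgrPdist_le/(_ _ ltr01)[e /= e0 He] _ _.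
  exists e => // s /andP[Tes sT].
  have Ts : `|T - s| < e by rewrite ltr_norml; apply/andP; split; lra.
  by have := He _ Ts sT; have := ler_normB AT (AT - A s); rewrite subKr; lra.
have S_ub s : S s -> s <= T - e.
  move=> [/andP[s0 sT] sA]; rewrite leNgt; apply/negP => sTe.
  have d0 : 0 < Num.min (s - (T - e)) (T - s) by rewrite lt_min !subr_gt0 sTe.
  apply: (not_singular_bounded d0 _ sA) => u + _; rewrite lt_min => /andP[u1 u2].
  by apply: AT_bd; move: u1 u2; rewrite !ltr_norml => /andP[? ?] /andP[? ?]; apply/andP; split; lra.
have supS : has_sup S by split; [exists t|exists (T - e)].
pose p := sup S.
have tp : t <= p by apply: ub_le_sup => //; case: supS.
have p0 : 0 < p by case/andP: t0T => t0 _; exact: lt_le_trans tp.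
have pT : p < T.
  have : p <= T - e by apply: ge_sup => //; exists t.
  by lra.
have pns (s : R) : p < s < T -> ~ singular_time A s.
  move=> /andP[ps sT] sA; have : s <= p; last by rewrite leNgt ps.
  by apply: ub_le_sup; [case: supS|split=> //; rewrite (lt_trans p0 ps)].
(* The supremum is attained: at a regular p the equation makes [A] continuous, hence bounded near p,
   whereas some singular time lies within any given distance of p. *)
have pA : singular_time A p.
  have p0T : 0 < p < T by rewrite p0.
  apply: contrapT => npA.
  have [dAp _] : is_derive p (1 : R) A (2 * A p ^+ 2 - a p) /\
      is_derive p 1 B ((2 * A p) *: B p - b p).
    by case: AB_sol => + _ _ _ _; apply.
  have /cvgrPdist_le/(_ _ ltr01)[d /= d0 Hd] := der_cont dAp.
  have [c Sc pdc] := sup_adherent d0 supS.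
  have cp : c <= p by apply: ub_le_sup => //; case: supS.
  have d'0 : 0 < d - (p - c) by rewrite -/p in pdc; lra.
  case: Sc => _; apply: (not_singular_bounded d'0 (M := `|A p| + 1)) => s sc _.
  have /Hd : `|p - s| < d by move: sc; rewrite !ltr_norml => /andP[? ?]; apply/andP; split; lra.
  by have := ler_normB (A p) (A p - A s); rewrite subKr; lra.
have [M AM] := exists_riccati_bound pT (ltW p0) pns.
have /cvgryPgt/(_ M)[d /= d0 Hd] := pA.
have d'0 : 0 < Num.min d (T - p) by rewrite lt_min d0 subr_gt0.
pose s := p + Num.min d (T - p) / 2.
have [d1 d2] : Num.min d (T - p) <= d /\ Num.min d (T - p) <= T - p.
  by rewrite !ge_min !lexx orbT.
have psT : p < s < T by rewrite /s; apply/andP; split; lra.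
have := AM s psT; rewrite leNgt => /negP; apply; apply: Hd.
  by rewrite /= ltr_norml /s; apply/andP; split; lra.
by rewrite gt_eqF//; case/andP: psT.
Qed.

(** Both f + C t and C t - f are nondecreasing, so f has a limit at 0 from the right; it replaces
    the arbitrary value [f 0]. *)
Lemma lipschitz_extension (f f' : R -> R) (C l : R) :
  (forall t : R, 0 < t < T -> is_derive t (1 : R) f (f' t)) ->
  (forall t : R, 0 < t < T -> `|f' t| <= C) ->
  f s @[s --> T^'-] --> l -> f T = l ->
  exists2 g : R -> R, continuous g & forall t : R, 0 < t <= T -> f t = g t.
Proof.
move=> df f'C fl fT.
pose h t := f t + C * t.
have dh (t : R) : 0 < t < T -> is_derive t (1 : R) h (f' t + C).
  by move=> t0T; have := derD (df t t0T) (derZ C (der_id t)); rewrite mulr1.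
have h_nd (s t : R) : 0 < s -> s <= t -> t < T -> h s <= h t.
  apply: (der_nondecreasing_oo dh) => x /f'C; rewrite ler_norml; lra.
pose k t := C * t - f t.
have dk (t : R) : 0 < t < T -> is_derive t (1 : R) k (C - f' t).
  by move=> t0T; have := derB (derZ C (der_id t)) (df t t0T); rewrite mulr1.
have k_nd (s t : R) : 0 < s -> s <= t -> t < T -> k s <= k t.
  apply: (der_nondecreasing_oo dk) => x /f'C; rewrite ler_norml; lra.
have C0 : 0 <= C.
  apply: le_trans (normr_ge0 _) (f'C (T / 2) _).
  by have := T_gt0; move=> ?; apply/andP; split; lra.
have /cvg_ex[/= h0 hh0] : cvg (h s @[s --> 0^'+]).
  apply: nondecreasing_at_right_is_cvgr.
    near=> x => s t; rewrite !in_itv/= => /andP[s0 sx] /andP[t0 tx] st.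
    apply: h_nd => //; apply: (lt_trans tx).
    by near: x; exact: nbhs_right_lt.
  (* The lower bound comes from [h s = 2 * C * s - k s] and the monotonicity of k. *)
  near=> x; exists (- k (T / 2)) => _ [s /= + <-].
  rewrite in_itv/= => /andP[s0 sx].
  have xT : x <= T / 2 by near: x; apply: nbhs_right_le; rewrite divr_gt0.
  have := @k_nd s (T / 2) s0; rewrite /k /h.
  have : 0 <= C * s by rewrite mulr_ge0// ltW.
  by move=> ? H; have := H ltac:(lra) ltac:(lra); lra.
have f0 : f s @[s --> 0^'+] --> h0.
  rewrite (_ : f = h - (fun s => C * s)); last first.
    by apply/funext => s; rewrite /h !fctE addrK.
  have -> : h0 = h0 - C * 0 by rewrite mulr0 subr0.
  apply: cvgB => //.
  by apply: cvgM; [exact: cvg_cst|exact: cvg_at_right_filter].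
pose g (t : R) := if t <= 0 then h0 else f t.
have cg : {within `[0, T], continuous g}.
  apply/continuous_within_itvP => //; split.
  - move=> x; rewrite in_itv/= => x0T; have /andP[x0 xT] := x0T.
    rewrite /continuous_at /g leNgt x0/=.
    apply: cvg_trans (der_cont (df x x0T)); apply: near_eq_cvg; near=> z.
    by rewrite /g leNgt ifF//; apply/negbTE; rewrite negbK; near: z; exact: lt_nbhsr.
  - rewrite {2}/g lexx; apply: cvg_trans f0; apply: near_eq_cvg; near=> z.
    by rewrite /g leNgt ifF//; apply/negbTE; rewrite negbK; near: z; exact: nbhs_right_gt.
  - rewrite {2}/g leNgt T_gt0/= fT; apply: cvg_trans fl; apply: near_eq_cvg; near=> z.
    by rewrite /g leNgt ifF//; apply/negbTE; rewrite negbK; near: z; exact: nbhs_left_gt.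
exists (fun x => g (clamp 0 T x)); first exact: (continuous_clamp (ltW T_gt0) cg).
by move=> t /andP[t0 tT]; rewrite clamp_id; [rewrite /g lt_geF|rewrite ltW].
Unshelve. all: by end_near. Qed.

(** Once [A] is bounded, so is its derivative. The derivative of [B] involves [B] itself, so the
    extension is applied to [E * B] with an integrating factor [E]: its derivative is - E b, which
    is bounded. *)
Lemma exists_continuous_coefficients :
  exists (At : R -> R) (Bt : R -> 'rV[R]_n),
    [/\ continuous At, (forall i, continuous (fun t => Bt t ord0 i)) &
      forall t : R, 0 < t <= T -> A t = At t /\ B t = Bt t].
Proof.
have ns := riccati_no_singularity.
have [M AM] := exists_riccati_bound T_gt0 (lexx 0) ns.
case: AB_sol => dAB A_T A_lim B_T B_lim.
have dA (t : R) : 0 < t < T -> is_derive t (1 : R) A (2 * A t ^+ 2 - a t).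
  by move=> t0T; case: (dAB t t0T (ns t t0T)).
have [K aK] := within_continuous_bounded a_cont.
have [At cAt AAt] : exists2 g : R -> R, continuous g & forall t : R, 0 < t <= T -> A t = g t.
  apply: (lipschitz_extension (C := 2 * M ^+ 2 + K) dA _ A_lim A_T) => t t0T.
  apply: le_trans (ler_normB _ _) _; apply: lerD; last first.
    by apply: aK; case/andP: t0T => t0 tT; rewrite !ltW.
  rewrite normrM normrX ger0_norm// ler_wpM2l// lerXn2r ?nnegrE//.
    by apply: le_trans (AM t t0T).
  exact: AM.
have [F [F0 dF]] := exists_antiderivative cAt.
pose E t := expR (- (2 * F t)).
have dE (t : R) : is_derive t (1 : R) E (E t * - (2 * At t)).
  exact: der_expR (derN (derZ 2 (dF t))).
have cE : continuous E := cont_der dE.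
have [C EC] : exists C, forall t : R, 0 <= t <= T -> `|E t| <= C.
  exact/within_continuous_bounded/continuous_subspaceT.
have /choice[g gE] : forall i, exists g : R -> R, continuous g /\
    forall t : R, 0 < t <= T -> E t * B t ord0 i = g t.
  move=> i; have [L bL] : exists L, forall t : R, 0 <= t <= T -> `|b t ord0 i| <= L.
    apply: within_continuous_bounded => x.
    by apply: (cvg_comp b (fun v : 'rV[R]_n => v ord0 i)); [exact: b_cont|exact: coord_continuous].
  have dEB (t : R) : 0 < t < T ->
      is_derive t (1 : R) (fun s => E s * B s ord0 i) (- (E t * b t ord0 i)).
    move=> t0T; have [_ dB] := dAB t t0T (ns t t0T).
    have := derM (dE t) (der_coord i dB); rewrite !mxE => /is_derive_eq; apply.
    rewrite (AAt t); last by case/andP: t0T => -> /ltW.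
    by rewrite mulrN; ring.
  have [|||g cg Bg] := @lipschitz_extension (fun s => E s * B s ord0 i)
    (fun t => - (E t * b t ord0 i)) (C * L) (E T * BT ord0 i) dEB.
  - move=> t /andP[t0 tT]; rewrite normrN normrM ler_pM//.
      by apply: EC; rewrite !ltW.
    by apply: bL; rewrite !ltW.
  - apply: cvgM; first by apply: cvg_at_left_filter; exact: cE.
    by apply: (cvg_comp B (fun v : 'rV[R]_n => v ord0 i)); [exact: B_lim|exact: coord_continuous].
  - by rewrite B_T.
  - by exists g.
exists At, (fun t => \row_i (g i t / E t)); split => // [i t|t t0T].
  under eq_fun do rewrite mxE.
  apply: cvgM; first by case: (gE i) => + _; exact.
  by apply: cvgV; [rewrite gt_eqF// expR_gt0|exact: cE].
split; first exact: AAt.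
apply/rowP => i; rewrite mxE; case: (gE i) => _ /(_ t t0T) <-.
by rewrite mulrAC divff ?mul1r// gt_eqF// expR_gt0.
Qed.

End riccati_regularity.

(** * Gaussian laws *)

Section image_law.
Context d d' (T : measurableType d) (T' : measurableType d') (R : realType).
Variables (P : probability T R) (f : T -> T').
Hypothesis mf : measurable_fun setT f.

Definition image_law : probability T' R :=
  distribution P (HB.pack f (isMeasurableFun.Build _ _ _ _ f mf) : {mfun T >-> T'}).

Lemma ge0_integral_image_law (g : T' -> \bar R) :
  measurable_fun setT g -> (forall x, 0 <= g x)%E ->
  (\int[image_law]_x g x = \int[P]_x g (f x))%E.
Proof. by move=> mg g0; rewrite ge0_integral_distribution. Qed.

Lemma Rintegral_image_law (g : T' -> R) :
  measurable_fun setT g -> P.-integrable setT (EFin \o (g \o f)) ->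
  \int[image_law]_x g x = \int[P]_x g (f x).
Proof.
move=> mg ig; rewrite /Rintegral integral_distribution//.
exact/measurable_EFinP.
Qed.

End image_law.

Section density.
Context d (T : measurableType d) (R : realType).
Variables (mu nu : {measure set T -> \bar R}) (g : T -> R).
Hypothesis g_ge0 : forall x, 0 <= g x.
Hypothesis mg : measurable_fun setT g.
Hypothesis nuE : forall S, measurable S -> nu S = (\int[mu]_(x in S) (g x)%:E)%E.

Import HBNNSimple.

Let nnsfun_density (h : {nnsfun T >-> R}) :
  (\int[nu]_x (h x)%:E = \int[mu]_x (h x * g x)%:E)%E.
Proof.
rewrite integralT_nnsfun sintegralE.
transitivity (\int[mu]_x (\sum_(r \in range h)
    (r * (\1_(h @^-1` [set r]) x * g x))%:E))%E; last first.
  apply: eq_integral => x _; rewrite fsumEFin//; congr EFin.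
  rewrite [in RHS](fimfunE h) fsbig_finite//= fsbig_finite//= mulr_suml.
  by apply: eq_bigr => r _; rewrite mulrA.
rewrite ge0_integral_fsum//; last 2 first.
- by move=> r; apply/measurable_EFinP; do 2 apply: measurable_funM => //.
- move=> r x _; rewrite lee_fin; have [xr|xr] := eqVneq (h x) r.
    by rewrite mulr_ge0// ?mulr_ge0// -?xr.
  by rewrite indicE memNset ?mul0r ?mulr0//=; exact/eqP.
apply: eq_fsbigr => r /set_mem[x _ hxr]; have r0 : 0 <= r by rewrite -hxr.
under eq_integral do rewrite EFinM.
rewrite ge0_integralZl//; last 2 first.
- by apply/measurable_EFinP; apply: measurable_funM => //; exact: measurable_indic.
- by move=> y _; rewrite lee_fin mulr_ge0.
rewrite nuE// integral_mkcond; congr (_ * _)%E; apply: eq_integral => y _.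
by rewrite patchE indicE; case: ifPn; rewrite ?mul1r ?mul0r.
Qed.

Lemma ge0_integral_density (f : T -> \bar R) :
  measurable_fun setT f -> (forall x, 0 <= f x)%E ->
  (\int[nu]_x f x = \int[mu]_x (f x * (g x)%:E))%E.
Proof.
move=> mf f0; pose f_ := nnsfun_approx measurableT mf.
transitivity (lim (\int[nu]_x (f_ n x)%:E @[n --> \oo])%E).
  rewrite -monotone_convergence//=.
  - by apply: eq_integral => x _; apply/esym/cvg_lim => //; exact: cvg_nnsfun_approx.
  - by move=> n; exact/measurable_EFinP.
  - by move=> n x _; rewrite lee_fin.
  - by move=> x _ m n mn; rewrite lee_fin; exact/lefP/nd_nnsfun_approx.
under eq_fun do rewrite nnsfun_density.
rewrite -monotone_convergence//=.
- apply: eq_integral => x _; apply/cvg_lim => //.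
  under eq_fun do rewrite EFinM.
  by apply: cvgeMr => //; exact: cvg_nnsfun_approx.
- by move=> n; apply/measurable_EFinP; exact: measurable_funM.
- by move=> n x _; rewrite lee_fin mulr_ge0.
- move=> x _ m n mn; rewrite lee_fin ler_wpM2r//.
  exact/lefP/nd_nnsfun_approx.
Qed.

Lemma integral_density (f : T -> R) : measurable_fun setT f ->
  mu.-integrable setT (fun x => (f x * g x)%:E) ->
  nu.-integrable setT (EFin \o f) /\
  (\int[nu]_x (f x)%:E = \int[mu]_x (f x * g x)%:E)%E.
Proof.
move=> mf intf; split.
  apply/integrableP; split; first exact/measurable_EFinP.
  rewrite ge0_integral_density//; last first.
    by apply: measurableT_comp => //; exact/measurable_EFinP.
  move/integrableP : intf => [_]; apply: le_lt_trans; rewrite le_eqVlt.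
  apply/orP; left; apply/eqP; apply: eq_integral => x _.
  by rewrite /= -EFinM normrM (ger0_norm (g_ge0 x)).
rewrite integralE [RHS]integralE !ge0_integral_density//.
- congr (_ - _)%E; apply: eq_integral => x _.
    by rewrite !funeposE -!EFin_max -EFinM maxr_pMl// mul0r.
  by rewrite !funenegE -!EFinN -!EFin_max -EFinM maxr_pMl// mul0r mulNr.
- exact/measurable_funeneg/measurable_EFinP.
- exact/measurable_funepos/measurable_EFinP.
Qed.

End density.

Section standard_normal.
Context {R : realType}.
Notation mu := (@lebesgue_measure R).
Notation N := (@normal_prob R 0 1).
Notation pdf := (@normal_pdf R 0 1).

Lemma stdpdfE (x : R) : pdf x = normal_peak 1 * expR (- x ^+ 2 / 2).
Proof.
by rewrite normal_pdfE ?oner_eq0// /normal_fun subr0 expr1n.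
Qed.

Lemma der_stdpdf (x : R) : is_derive x (1 : R) pdf (- (x * pdf x)).
Proof.
rewrite (_ : pdf = fun x => normal_peak 1 * expR (- x ^+ 2 / 2)); last first.
  by apply/funext => z; exact: stdpdfE.
by apply: is_derive_eq (derZ (normal_peak 1) (der_gauss x)) _; ring.
Qed.

Lemma stdpdfN (x : R) : pdf (- x) = pdf x.
Proof. by rewrite !stdpdfE sqrrN. Qed.

(** The inequality exp(u) >= 1 + u at u = x^2 / 2 bounds the product by a multiple of 1 / x. *)
Lemma stdpdf_cvg0 : (x * pdf x) @[x --> +oo] --> (0 : R).
Proof.
have ub : (2 * normal_peak 1 * x^-1) @[x --> +oo] --> (0 : R).
  rewrite -(mulr0 (2 * @normal_peak R 1)); apply: cvgM; first exact: cvg_cst.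
  by apply/gtr0_cvgV0; [exact: nbhs_pinfty_gt|exact: cvg_id].
apply: (squeeze_cvgr _ (cvg_cst 0) ub); near=> x.
have x0 : 0 < x by near: x; exact: nbhs_pinfty_gt.
rewrite mulr_ge0 ?normal_pdf_ge0 ?(ltW x0)//= stdpdfE mulNr expRN.
have H : 1 + x ^+ 2 / 2 <= expR (x ^+ 2 / 2) by exact: expR_ge1Dx.
have x2 : 0 < x ^+ 2 / 2 by rewrite divr_gt0// exprn_gt0.
have He : 0 < expR (x ^+ 2 / 2) by exact: expR_gt0.
rewrite mulrCA -subr_ge0.
rewrite (_ : _ - _ = normal_peak 1 * x^-1 * (expR (x ^+ 2 / 2))^-1 *
  (2 * (expR (x ^+ 2 / 2) - x ^+ 2 / 2))).
  rewrite mulr_ge0// ?mulr_ge0 ?normal_peak_ge0 ?invr_ge0 ?ltW//; lra.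
by field; rewrite !gt_eqF.
Unshelve. all: by end_near. Qed.

(** On the half-line, the primitives Phi of [pdf] and Phi - x pdf of x^2 pdf agree at 0 and, by
    [stdpdf_cvg0], at infinity. The second moment therefore equals the total mass, and their common
    limit [L] is never computed. *)
Lemma integral_sqr_stdpdf : (\int[mu]_x (x ^+ 2 * pdf x)%:E = 1)%E.
Proof.
have cpdf : continuous pdf := cont_der der_stdpdf.
have cxpdf : continuous (fun x : R => x ^+ 2 * pdf x).
  by move=> x; apply: cvgM; [exact: exprn_continuous|exact: cpdf].
rewrite -(integral_normal_pdf 0 1) !ge0_symfun_integralT//; last 4 first.
- by move=> x; exact: normal_pdf_ge0.
- by move=> x; rewrite /= stdpdfN.
- by move=> x; rewrite mulr_ge0 ?sqr_ge0 ?normal_pdf_ge0.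
- by move=> x; rewrite /= stdpdfN sqrrN.
congr (_ * _)%E; rewrite -set_itvcy.
have [Phi [Phi0 dPhi]] := exists_antiderivative cpdf.
have Phi_nd : {homo Phi : x y / x <= y}.
  by apply: der_nondecreasing dPhi _ => x; exact: normal_pdf_ge0.
have Phi1 x : 0 <= x -> Phi x <= 1.
  move=> x0; rewrite -[Phi x]subr0 -Phi0 -lee_fin.
  rewrite -(@integral_derivative _ Phi pdf)//; last exact: continuous_subspaceT (cont_der dPhi).
  rewrite -(integral_normal_pdf 0 1); apply: ge0_subset_integral => //.
    by apply/measurable_EFinP; exact: measurable_normal_pdf.
  by move=> y _; rewrite lee_fin normal_pdf_ge0.
have Phi_ub : has_ubound (range Phi).
  exists 1 => _ [x _ <-]; case: (leP 0 x) => [/Phi1//|x0].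
  by apply: le_trans (Phi_nd _ _ (ltW x0)) _; rewrite Phi0.
have Phi_lim := nondecreasing_cvgr Phi_nd Phi_ub.
set L := sup _ in Phi_lim.
rewrite (@ge0_continuous_FTC2y _ pdf Phi 0 L)//; first last.
- by move=> x _; rewrite derive1E; have [_ ->] := dPhi x.
- by apply: cvg_at_right_filter; exact: (der_cont (dPhi 0)).
- exact: continuous_subspaceT.
- by move=> x _; exact: normal_pdf_ge0.
pose F x := Phi x - x * pdf x.
have dF (x : R) : is_derive x (1 : R) F (x ^+ 2 * pdf x).
  have := derB (dPhi x) (derM (der_id x) (der_stdpdf x)); move/is_derive_eq; apply.
  by ring.
rewrite (@ge0_continuous_FTC2y _ _ F 0 L)//; first last.
- by move=> x _; rewrite derive1E; have [_ ->] := dF x.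
- by apply: cvg_at_right_filter; exact: (der_cont (dF 0)).
- by rewrite -(subr0 L); apply: cvgB => //; exact: stdpdf_cvg0.
- exact: continuous_subspaceT.
- by move=> x _; rewrite mulr_ge0 ?sqr_ge0 ?normal_pdf_ge0.
by rewrite /F Phi0 mul0r subrr.
Qed.

(** A substitution in the density identifies both sides on half-lines, a generating family closed
    under intersection. *)
Lemma normal_prob_affine (m s : R) (S : set R) : 0 < s -> measurable S ->
  normal_prob m s S = N ((fun z => m + s * z) @^-1` S).
Proof.
move=> s0 mS.
pose phi (z : measurableTypeR R) : measurableTypeR R := m + s * z.
have mphi : measurable_fun setT phi.
  by apply: measurable_funD => //; exact: measurable_funM.
pose G := range (fun b : R => [set` `]-oo, b]] : set (measurableTypeR R)).
transitivity (image_law N mphi S); last by [].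
move: S mS; apply: (@measure_unique _ R (measurableTypeR R) G (fun k => [set` `]-oo, k%:R]])).
- apply/seteqP; split; last first.
    by apply: smallest_sub => [|_ [b _ <-]//]; exact: sigma_algebra_measurable.
  rewrite [X in X `<=` _](RGenOInfty.measurableE R); apply: smallest_sub.
    exact: smallest_sigma_algebra.
  move=> _ [b ->]; rewrite -[X in <<s _ >> X]setCK; apply: sigma_algebraC.
  by apply: sub_sigma_algebra; exists b => //; rewrite setCitvr.
- move=> _ _ [b _ <-] [c _ <-]; exists (Num.min b c) => //.
  by apply/seteqP; split => x /=; rewrite !in_itv/= le_min => /andP.
- by move=> k; exists k%:R.
- apply/seteqP; split => // x _.
  have : \forall k \near \oo, x <= k%:R by exact: nbhs_infty_ger.
  by case=> k _ /(_ k (leqnn k)) xk; exists k => //; rewrite /= in_itv.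
- move=> _ [b _ <-].
  pose F (z : R) := m + s * z.
  have dF (z : R) : is_derive z (1 : R) F s.
    by have := derD (der_cst m z) (derZ s (der_id z)); rewrite add0r mulr1.
  have FE : F^`()%classic = cst s.
    by apply/funext => z; rewrite derive1E; case: (dF z).
  pose c := (b - m) / s.
  have Fc : F c = b by rewrite /F /c mulrCA divff ?gt_eqF// mulr1; ring.
  transitivity (N `]-oo, c]); last first.
    rewrite /image_law/= /distribution/pushforward/=.
    congr (normal_prob _ _ _); apply/seteqP; split => z /=; rewrite !in_itv/= /c /phi ler_pdivlMr//.
      by move=> ?; lra.
    by move=> ?; lra.
  transitivity (\int[mu]_(x in `]-oo, F c]) (normal_pdf m s x)%:E)%E; first by rewrite Fc.
  rewrite (@increasing_ge0_integration_by_substitutionNy _ F _ c).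
  + apply: eq_integral => z _; congr EFin; rewrite FE fctE/= /F stdpdfE normal_pdfE ?gt_eqF//.
    have -> : normal_peak s = s^-1 * normal_peak 1.
      rewrite /normal_peak expr1n mul1r -mulrnAr sqrtrM ?sqr_ge0//.
      by rewrite sqrtr_sqr gtr0_norm// invfM.
    have -> : normal_fun m s (m + s * z) = expR (- z ^+ 2 / 2).
      by rewrite /normal_fun; congr expR; field; rewrite gt_eqF.
    by field; rewrite gt_eqF.
  + by move=> x y _ _ xy; rewrite /F ltrD2l ltr_pM2l.
  + by rewrite FE => x _; exact: cst_continuous.
  + by rewrite FE; exact: is_cvg_cst.
  + by rewrite FE; exact: cvg_cst.
  + split; first by move=> x _; case: (dF x).
    by apply: cvg_at_left_filter; exact: (der_cont (dF c)).
  + rewrite /F; apply: (cvg_comp _ (fun y => m + y) _ (@cvg_addrl_Ny _ m)).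
    by apply: gt0_cvgMrNy => //; exact: cvg_id.
  + by apply: continuous_subspaceT; apply: continuous_normal_pdf; rewrite gt_eqF.
  + by move=> x _; exact: normal_pdf_ge0.
- by move=> k; rewrite (le_lt_trans (probability_le1 _ _))// ltry.
Qed.

(** Lebesgue measure is invariant under negation, so the integral is its own opposite; being finite,
    it is 0. *)
Lemma integral_odd (f : R -> R) : mu.-integrable setT (EFin \o f) ->
  (forall x, f (- x) = - f x) -> (\int[mu]_x (f x)%:E = 0)%E.
Proof.
move=> intf fN.
have mf := measurable_int _ intf.
have mopp : measurable_fun setT (-%R : measurableTypeR R -> measurableTypeR R) by [].
have fin := integrable_fin_num measurableT intf.
have E : (\int[mu]_x (f x)%:E = - \int[mu]_x (f x)%:E)%E.
  transitivity (\int[pushforward mu (-%R : measurableTypeR R -> measurableTypeR R)]_x (f x)%:E)%E.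
    by apply: eq_measure_integral => A mA _; exact/esym/lebesgue_measureN.
  have intfN : mu.-integrable setT ((EFin \o f) \o -%R).
    rewrite (_ : _ \o _ = fun x => (- (f x)%:E)%E); first exact: integrableN.
    by apply/funext => x; rewrite /= fN.
  rewrite integral_pushforward//= -integralN; last exact: integrable_add_def.
  by apply: eq_integral => x _; rewrite /= fN.
move: E fin; case: (integral _ _ _) => //= r [rE] _; congr EFin; lra.
Qed.

Let mpdf : measurable_fun setT pdf := @measurable_normal_pdf R 0 1.

Lemma integrable_sqr_stdpdf : mu.-integrable setT (fun x => (x ^+ 2 * pdf x)%:E).
Proof.
apply/integrableP; split.
  by apply/measurable_EFinP; apply: measurable_funM => //; exact: measurable_funX.
under eq_integral => x _.
  rewrite gee0_abs; last by rewrite lee_fin mulr_ge0 ?sqr_ge0 ?normal_pdf_ge0.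
  over.
by rewrite integral_sqr_stdpdf ltry.
Qed.

Lemma integrable_id_stdpdf : mu.-integrable setT (fun x => (x * pdf x)%:E).
Proof.
have /(integrableD measurableT) := integrable_sqr_stdpdf.
move=> /(_ _ (integrable_normal_pdf 0 1)); apply: le_integrable => //.
  by apply/measurable_EFinP; exact: measurable_funM.
move=> x _; rewrite -EFinD !abse_EFin lee_fin normrM.
rewrite (ger0_norm (normal_pdf_ge0 _ _ _)) -[X in _ <= `|_ + X|]mul1r -mulrDl.
rewrite normrM (ger0_norm (normal_pdf_ge0 _ _ _)) ler_wpM2r ?normal_pdf_ge0//.
rewrite [X in _ <= X]ger0_norm ?addr_ge0 ?sqr_ge0//.
have := sqr_ge0 (`|x| - 1); rewrite sqrrB1 real_normK ?num_real//.
by have := normr_ge0 x; lra.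
Qed.

Let stdnormal_density (S : set R) : measurable S ->
  N S = (\int[mu]_(x in S) (pdf x)%:E)%E.
Proof. by []. Qed.

Lemma ge0_integral_stdnormal (f : R -> R) :
  measurable_fun setT f -> (forall x, 0 <= f x) ->
  (\int[N]_x (f x)%:E = \int[mu]_x (f x * pdf x)%:E)%E.
Proof.
move=> mf f0; rewrite (@ge0_integral_density _ (measurableTypeR R) R mu N pdf (@normal_pdf_ge0 R 0 1)
  mpdf stdnormal_density)//.
exact/measurable_EFinP.
Qed.

Lemma ge0_integral_normal_prob (s : R) (f : R -> R) : 0 < s ->
  measurable_fun setT f -> (forall x, 0 <= f x) ->
  (\int[normal_prob 0 s]_x (f x)%:E = \int[N]_x (f (s * x))%:E)%E.
Proof.
move=> s0 mf f0.
have mphi : measurable_fun setT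
    ((fun z => 0 + s * z) : measurableTypeR R -> measurableTypeR R).
  by apply: measurable_funD => //; exact: measurable_funM.
transitivity (\int[image_law N mphi]_x (f x)%:E)%E.
  by apply: eq_measure_integral => A mA _; exact: normal_prob_affine.
rewrite ge0_integral_image_law; [|exact/measurable_EFinP|by move=> x; rewrite lee_fin].
by apply: eq_integral => x _; rewrite add0r.
Qed.

Lemma integral_sqr_normal_prob (s : R) : 0 < s ->
  (\int[normal_prob 0 s]_x (x ^+ 2)%:E = (s ^+ 2)%:E)%E.
Proof.
move=> s0; rewrite ge0_integral_normal_prob//; last by move=> x; exact: sqr_ge0.
under eq_integral do rewrite exprMn EFinM.
rewrite ge0_integralZl//; last 3 first.
- by apply/measurable_EFinP; exact: measurable_funX.
- by move=> x _; rewrite lee_fin sqr_ge0.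
- by rewrite lee_fin sqr_ge0.
rewrite ge0_integral_stdnormal//; last by move=> x; exact: sqr_ge0.
by rewrite integral_sqr_stdpdf mule1.
Qed.

Lemma integral_id_normal_prob (s : R) : 0 < s ->
  (normal_prob 0 s).-integrable setT (EFin \o id) /\
  (\int[normal_prob 0 s]_x x%:E = 0)%E.
Proof.
move=> s0.
have [iN N0] := @integral_density _ (measurableTypeR R) R mu N pdf
  (@normal_pdf_ge0 R 0 1) mpdf stdnormal_density _
  (@measurable_id _ _ setT) integrable_id_stdpdf.
have {}N0 : (\int[N]_x x%:E = 0)%E.
  rewrite N0; apply: (integral_odd integrable_id_stdpdf) => x.
  by rewrite stdpdfN mulNr.
have mphi : measurable_fun setT
    ((fun z => 0 + s * z) : measurableTypeR R -> measurableTypeR R).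
  by apply: measurable_funD => //; exact: measurable_funM.
have lawE A : measurable A -> A `<=` setT -> normal_prob 0 s A = image_law N mphi A.
  by move=> mA _; exact: normal_prob_affine.
have isN : N.-integrable setT (fun x => (s * x)%:E).
  by under eq_fun do rewrite EFinM; exact: integrableZl.
split.
- apply/integrableP; split; first exact/measurable_EFinP.
  rewrite (eq_measure_integral _ lawE) ge0_integral_image_law//; last first.
    by apply: measurableT_comp => //; exact/measurable_EFinP.
  move/integrableP : isN => [_]; apply: le_lt_trans; rewrite le_eqVlt.
  by apply/orP; left; apply/eqP; apply: eq_integral => x _; rewrite /= add0r.
- rewrite (eq_measure_integral _ lawE) integral_distribution//; last first.
    by rewrite (_ : _ \o _ = fun x => (s * x)%:E)//; apply/funext => x; rewrite /= add0r.
  transitivity (\int[N]_x (s%:E * x%:E))%E.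
    by apply: eq_integral => x _; rewrite /= add0r EFinM.
  by rewrite integralZl// N0 mule0.
Qed.

End standard_normal.

(** * The standard Gaussian law on R^n and its affine images *)

Section stdgauss.
Context {R : realType}.
Notation N := (@normal_prob R 0 1).

(** Same recursion as [lebesgue_rV], so that the comparison of the two is an induction on the
    dimension. *)
Fixpoint stdgauss (n : nat) : probability 'rV[R]_n R :=
  match n with
  | 0%N => \d_(0 : 'rV[R]_0)
  | m.+1 => image_law (N \x stdgauss m)%E (@measurable_consv R m)
  end.

Lemma ge0_integral_stdgaussS (n : nat) (f : 'rV[R]_n.+1 -> \bar R) :
  measurable_fun setT f -> (forall x, 0 <= f x)%E ->
  (\int[stdgauss n.+1]_x f x = \int[N]_x \int[stdgauss n]_v f (consv (x, v)))%E.
Proof.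
move=> mf f0; rewrite ge0_integral_image_law//.
apply: (@fubini_tonelli1 _ _ _ _ _ N (stdgauss n) (f \o @consv R n)).
  exact: measurableT_comp (@measurable_consv R n).
by move=> x; exact: f0.
Qed.

Lemma bounded_integrable d (T : measurableType d) (P : probability T R) (f : T -> R) (C : R) :
  measurable_fun setT f -> (forall x, `|f x| <= C) -> P.-integrable setT (EFin \o f).
Proof.
move=> mf fC; apply: (@le_integrable _ _ _ P setT measurableT _ (cst C%:E)).
- exact/measurable_EFinP.
- by move=> x _; rewrite /= lee_fin (le_trans (fC x))// ler_norm.
- exact: finite_measure_integrable_cst.
Qed.

(** Both orders are recorded: integration by parts in the first coordinate wants it innermost,
    integration by parts in any other one wants it outermost. *)
Lemma integral_stdgaussS (n : nat) (f : 'rV[R]_n.+1 -> R) (C : R) :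
  measurable_fun setT f -> (forall x, `|f x| <= C) ->
  (\int[stdgauss n.+1]_x (f x)%:E = \int[N]_x \int[stdgauss n]_v (f (consv (x, v)))%:E /\
   \int[stdgauss n.+1]_x (f x)%:E = \int[stdgauss n]_v \int[N]_x (f (consv (x, v)))%:E)%E.
Proof.
move=> mf fC.
have mfc : measurable_fun setT (f \o @consv R n).
  exact: measurableT_comp (@measurable_consv R n).
have ifc : (N \x stdgauss n)%E.-integrable setT (EFin \o (f \o @consv R n)).
  by apply: (@bounded_integrable _ _ (N \x stdgauss n)%E _ C) => // x; exact: fC.
rewrite integral_distribution//; last exact/measurable_EFinP.
by split; [exact: esym (integral12_prod_meas1 ifc)|exact: esym (integral21_prod_meas1 ifc)].
Qed.

End stdgauss.

Section lebesgue_rV_measure.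
Context {R : realType}.
Notation mu := (@lebesgue_measure R).

Lemma product_sigma_finite d d' (T : measurableType d) (T' : measurableType d')
    (m : {sigma_finite_measure set T -> \bar R})
    (m' : {sigma_finite_measure set T' -> \bar R}) : sigma_finite setT (m \x m')%E.
Proof.
have /sigma_finiteP[F [FT F_nd Foo]] := sigma_finiteT m.
have /sigma_finiteP[G [GT G_nd Goo]] := sigma_finiteT m'.
exists (fun k => F k `*` G k).
  apply/seteqP; split => // -[x y] _.
  have [i _ Fx] : (\bigcup_k F k) x by rewrite -FT.
  have [j _ Gy] : (\bigcup_k G k) y by rewrite -GT.
  exists (maxn i j) => //; split => /=.
    by move: x Fx; exact/subsetPset/F_nd/leq_maxl.
  by move: y Gy; exact/subsetPset/G_nd/leq_maxr.
move=> k; have [mF Fk] := Foo k; have [mG Gk] := Goo k.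
split; first exact: measurableX.
by rewrite product_measure1E// lte_mul_pinfty// ge0_fin_numE.
Qed.

(** The measurable left inverse [g] carries an exhausting sequence of finite measure to one for the
    pushforward, by preimages. *)
Lemma pushforward_sigma_finite d d' (T : measurableType d) (T' : measurableType d')
    {m : {measure set T -> \bar R}} {f : T -> T'} {g : T' -> T} : sigma_finite setT m ->
  measurable_fun setT f -> measurable_fun setT g -> cancel f g ->
  exists m' : {sigma_finite_measure set T' -> \bar R},
    forall S, m' S = pushforward m f S.
Proof.
move=> [F TF Fm] mf mg fK.
pose fm : {mfun T >-> T'} := HB.pack f (isMeasurableFun.Build _ _ _ _ f mf).
have sf : sigma_finite setT (pushforward m fm).
  exists (fun k => g @^-1` (F k)).
    by rewrite -preimage_bigcup -TF preimage_setT.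
  move=> k; have [mF Foo] := Fm k; split.
    by rewrite -[X in measurable X]setTI; exact: mg.
  rewrite /pushforward -comp_preimage (_ : g \o fm = id) ?preimage_id//.
  by apply/funext => x; exact: fK.
pose m' : {sigma_finite_measure set T' -> \bar R} :=
  HB.pack (pushforward m fm) (Measure.on (pushforward m fm))
    (Measure_isSigmaFinite.Build _ _ _ (pushforward m fm) sf).
by exists (m' mf mf mf).
Qed.

(** [lebesgue_rV] is a bare set function; Tonelli's theorem needs a sigma-finite measure with the
    same values. *)
Lemma lebesgue_rV_measure (n : nat) :
  exists m : {sigma_finite_measure set ('rV[R]_n : measurableType _) -> \bar R},
    (m : set 'rV[R]_n -> \bar R) = @lebesgue_rV R n.
Proof.
elim: n => [|n [m IH]].
  by exists (\d_(0 : 'rV[R]_0)).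
have [m' m'E] := pushforward_sigma_finite (product_sigma_finite mu m)
  (@measurable_consv R n) (@measurable_unconsv R n) (@consvK R n).
by exists m'; apply/funext => S; rewrite m'E /= -IH.
Qed.

End lebesgue_rV_measure.

Section gaussian_density_law.
Context {R : realType}.
Notation mu := (@lebesgue_measure R).
Notation N := (@normal_prob R 0 1).

Lemma sqnorm_consv (n : nat) (x : R) (v : 'rV[R]_n) :
  sqnorm (consv (x, v)) = x ^+ 2 + sqnorm v.
Proof.
rewrite /sqnorm /dotv big_ord_recl consv0 -expr2; congr (_ + _).
by apply: eq_bigr => i _; rewrite consvS.
Qed.

Lemma consv_affine (n : nat) (a s x : R) (m v : 'rV[R]_n) :
  consv (a, m) + s *: consv (x, v) = consv (a + s * x, m + s *: v).
Proof.
apply/rowP => i; rewrite [LHS]mxE [X in _ + X]mxE.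
case: (unliftP ord0 i) => [j|] ->; first by rewrite !consvS/= !mxE.
by rewrite !consv0.
Qed.

Lemma gaussian_density_consv (n : nat) (s a x : R) (m v : 'rV[R]_n) : 0 < s ->
  gaussian_density (consv (a, m)) (s ^+ 2) (consv (x, v)) =
  normal_pdf a s x * gaussian_density m (s ^+ 2) v.
Proof.
move=> s0; rewrite /gaussian_density normal_pdfE ?gt_eqF//.
have -> : consv (x, v) - consv (a, m) = consv (x - a, v - m).
  apply/rowP => i; rewrite [LHS]mxE [X in _ + X]mxE.
  case: (unliftP ord0 i) => [j|] ->; first by rewrite !consvS/= !mxE.
  by rewrite !consv0.
rewrite sqnorm_consv /normal_peak /normal_fun.
rewrite (_ : s ^+ 2 * pi *+ 2 = 2 * pi * s ^+ 2); last by rewrite -mulr_natr; ring.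
rewrite (_ : - (((x - a) ^+ 2 + sqnorm (v - m)) / (2 * s ^+ 2)) =
    - (x - a) ^+ 2 / (s ^+ 2 *+ 2) + - (sqnorm (v - m) / (2 * s ^+ 2))); last first.
  by rewrite -[s ^+ 2 *+ 2]mulr_natl; field; rewrite gt_eqF.
rewrite expRD [_ ^+ n.+1]exprS invfM.
by ring.
Qed.

Lemma gaussian_density_ge0 (n : nat) (m x : 'rV[R]_n) v : 0 <= gaussian_density m v x.
Proof.
by rewrite /gaussian_density mulr_ge0 ?expR_ge0// invr_ge0 exprn_ge0.
Qed.

Lemma measurable_gaussian_density (n : nat) (m : 'rV[R]_n) (v : R) :
  measurable_fun setT (gaussian_density m v).
Proof.
apply: measurable_funM => //; apply: measurableT_comp => //.
apply: measurable_funN; apply: measurable_funM => //.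
rewrite /sqnorm /dotv; apply: measurable_sum => i.
have mi : measurable_fun setT (fun x : 'rV[R]_n => (x - m) ord0 i).
  under eq_fun do rewrite !mxE.
  by apply: measurable_funB => //; exact: measurable_coord.
exact: measurable_funM.
Qed.

Lemma measurable_affine (n : nat) (m : 'rV[R]_n) (s : R) :
  measurable_fun setT (fun z : 'rV[R]_n => m + s *: z).
Proof.
apply/measurable_fun_rVP => i.
under eq_fun do rewrite !mxE.
by apply: measurable_funD => //; apply: measurable_funM => //; exact: measurable_coord.
Qed.

(** The substitution x = m + s z, coordinate by coordinate: the induction hypothesis treats the last
    n coordinates, [normal_prob_affine] the first, and Tonelli reassembles the product. *)
Lemma ge0_integral_gaussian (n : nat) (m : 'rV[R]_n) (s : R) (f : 'rV[R]_n -> \bar R) :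
  0 < s -> measurable_fun setT f -> (forall x, 0 <= f x)%E ->
  (\int[stdgauss n]_z f (m + s *: z)%R =
   \int[@lebesgue_rV R n]_x (f x * (gaussian_density m (s ^+ 2) x)%:E))%E.
Proof.
move=> s0; elim: n => [|n IH] in m f *; move=> mf f0.
  rewrite /= !integral_dirac//; last 2 first.
  - apply: emeasurable_funM => //; apply/measurable_EFinP.
    exact: measurable_gaussian_density.
  - exact: measurableT_comp mf (measurable_affine m s).
  rewrite !diracT !mul1e /gaussian_density /sqnorm /dotv big_ord0 mul0r oppr0 expR0.
  by rewrite expr0 invr1 mulr1 mule1; congr f; apply/rowP => -[].
have [L LE] := @lebesgue_rV_measure R n.
pose a := m ord0 ord0; pose m' := (unconsv m).2.
have mE : m = consv (a, m') by rewrite -[LHS]unconsvK.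
have s0' : s != 0 by rewrite gt_eqF.
pose g p := f (consv p).
have mg : measurable_fun setT g := measurableT_comp mf (@measurable_consv R n).
have mgx x : measurable_fun setT (fun v => g (x, v)).
  exact: measurableT_comp mg (measurable_pair1 x).
pose D p := (g p * (gaussian_density m' (s ^+ 2) p.2)%:E)%E.
have D0 p : (0 <= D p)%E by rewrite mule_ge0 ?f0// lee_fin gaussian_density_ge0.
have mD : measurable_fun setT D.
  apply: emeasurable_funM => //; apply/measurable_EFinP.
  exact: measurableT_comp (measurable_gaussian_density _ _) measurable_snd.
rewrite ge0_integral_stdgaussS//; last first.
  exact: measurableT_comp mf (measurable_affine m s).
transitivity (\int[N]_x \int[L]_v D (a + s * x, v)%R)%E.
  apply: eq_integral => x _; rewrite LE -IH//; last by move=> v; exact: f0.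
  by apply: eq_integral => v _; rewrite mE consv_affine.
have mF : measurable_fun setT (fun x => \int[L]_v D (x, v))%E.
  exact: (measurable_fun_fubini_tonelli_F (m2 := L) D).
have F0 x : (0 <= \int[L]_v D (x, v))%E by apply: integral_ge0 => v _; exact: D0.
transitivity (\int[normal_prob a s]_x \int[L]_v D (x, v))%E.
  have mphi : measurable_fun setT
      ((fun z => a + s * z) : measurableTypeR R -> measurableTypeR R).
    by apply: measurable_funD => //; exact: measurable_funM.
  transitivity (\int[image_law N mphi]_x \int[L]_v D (x, v))%E.
    exact/esym/(@ge0_integral_image_law _ _ _ _ R N _ mphi _ mF F0).
  by apply: eq_measure_integral => A mA _; exact/esym/normal_prob_affine.
transitivity (\int[mu]_x (\int[L]_v D (x, v) * (normal_pdf a s x)%:E))%E.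
  apply: (@ge0_integral_density _ (measurableTypeR R) R mu (normal_prob a s)
    (normal_pdf a s)) => //.
  - by move=> x; exact: normal_pdf_ge0.
  - exact: measurable_normal_pdf.
pose H (p : R * 'rV[R]_n) := (D p * (normal_pdf a s p.1)%:E)%E.
have H0 p : (0 <= H p)%E by rewrite mule_ge0// lee_fin normal_pdf_ge0.
have mH : measurable_fun setT H.
  apply: emeasurable_funM => //; apply/measurable_EFinP.
  exact: measurableT_comp (measurable_normal_pdf _ _) measurable_fst.
transitivity (\int[mu]_x \int[L]_v H (x, v))%E.
  apply: eq_integral => x _; apply/esym; rewrite /H/= ge0_integralZr//.
  - by apply: measurableT_comp mD _; exact: measurable_pair1.
  - by rewrite lee_fin normal_pdf_ge0.
transitivity (\int[(mu \x L)%E]_p H p)%E.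
  exact/esym/(fubini_tonelli1 (m1 := mu) (m2 := L) H).
transitivity (\int[pushforward (mu \x L)%E (@consv R n)]_x
    (f x * (gaussian_density m (s ^+ 2) x)%:E))%E; last by rewrite /= -LE.
rewrite ge0_integral_pushforward//; last 3 first.
- exact: measurable_consv.
- apply: emeasurable_funM => //; apply/measurable_EFinP.
  exact: measurable_gaussian_density.
- by move=> x _; rewrite mule_ge0// lee_fin gaussian_density_ge0.
apply: eq_integral => -[x v] _; rewrite /H /D /= mE gaussian_density_consv//.
by rewrite -muleA -EFinM [_ * normal_pdf _ _ _]mulrC.
Qed.

End gaussian_density_law.

Section gauss_law.
Context {R : realType} {n : nat}.

(** The law of m + s Z with Z standard normal. Unlike the density it makes sense for s = 0, where it
    is the Dirac mass at m, so one formula covers the initial time and the noiseless case. *)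
Definition gauss_law (m : 'rV[R]_n) (s : R) : probability 'rV[R]_n R :=
  image_law (stdgauss n) (measurable_affine m s).

Lemma gauss_lawE (m : 'rV[R]_n) (s : R) (S : set 'rV[R]_n) : 0 <= s ->
  measurable S -> gauss_law m s S = gaussian_law m (s ^+ 2) S.
Proof.
rewrite /gaussian_law sqrf_eq0 le_eqVlt => /predU1P[<-|s0] mS.
  rewrite eqxx diracE; have [mS'|mS'] := boolP (m \in S).
    rewrite -[RHS](probability_setT (stdgauss n)); congr (stdgauss n _).
    by apply/seteqP; split => // z _ /=; rewrite scale0r addr0; exact/set_mem.
  rewrite -[RHS](measure0 (stdgauss n)); congr (stdgauss n _).
  apply/seteqP; split => // z /=; rewrite scale0r addr0 => mS0.
  by move: mS'; rewrite (mem_set mS0).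
rewrite gt_eqF//.
have mind : measurable_fun setT (fun x : 'rV[R]_n => (\1_S x)%:E : \bar R).
  exact/measurable_EFinP/measurable_indic.
have ind0 x : (0 <= (\1_S x : R)%:E)%E by rewrite lee_fin.
have := ge0_integral_gaussian m s0 mind ind0.
rewrite integral_mkcond [in LHS]patch_setT => H.
transitivity (\int[gauss_law m s]_x (\1_S x)%:E)%E.
  by rewrite integral_indic// setIT.
have [L LE] := @lebesgue_rV_measure R n.
rewrite ge0_integral_image_law// H -LE [RHS]integral_mkcond.
by apply: eq_integral => x _; rewrite patchE indicE; case: ifPn => _; rewrite ?mul1e ?mul0e.
Qed.

End gauss_law.

(** * Chain rule and Gaussian integration by parts *)

Section directional.
Context {R : realType} {n : nat}.
Implicit Types f : 'rV[R]_n -> R.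

Lemma is_derive_line f (x : 'rV[R]_n) (i : 'I_n) (r : R) :
  derivable f (x + r *: unitv i) (unitv i) ->
  is_derive r (1 : R) (fun h => f (x + h *: unitv i)) ('D_(unitv i) f (x + r *: unitv i)).
Proof.
have E : (fun h : R => h^-1 *: (((fun h0 => f (x + h0 *: unitv i)) \o shift r) (h *: 1) -
    f (x + r *: unitv i))) =
    (fun h : R => h^-1 *: ((f \o shift (x + r *: unitv i)) (h *: unitv i) -
    f (x + r *: unitv i))).
  apply/funext => h /=; congr (_ *: (f _ - _)).
  by rewrite [h%:A]mulr1 scalerDl addrCA.
by move=> df; apply: DeriveDef; [rewrite /derivable E|rewrite /derive E].
Qed.

Lemma is_derive_of_line f (x : 'rV[R]_n) (i : 'I_n) (df : R) :
  is_derive (0 : R) (1 : R) (fun r => f (x + r *: unitv i)) df ->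
  is_derive x (unitv i) f df.
Proof.
have E : (fun k : R => k^-1 *: (((fun h => f (x + h *: unitv i)) \o shift 0) (k *: 1) -
    f (x + 0 *: unitv i))) =
    (fun k : R => k^-1 *: ((f \o shift x) (k *: unitv i) - f x)).
  apply/funext => k /=; rewrite scale0r !addr0; congr (_ *: (f _ - _)).
  by rewrite [k%:A]mulr1 addrC.
by case=> H1 H2; apply: DeriveDef; [move: H1; rewrite /derivable E|rewrite -H2 /derive E].
Qed.

Lemma MVT_line f (x : 'rV[R]_n) (i : 'I_n) (h : R) :
  (forall z, derivable f z (unitv i)) ->
  exists2 c : R, `|c| <= `|h| &
    f (x + h *: unitv i) - f x = 'D_(unitv i) f (x + c *: unitv i) * h.
Proof.
move=> df; pose g (r : R) := f (x + r *: unitv i).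
have dg (r : R) : is_derive r (1 : R) g ('D_(unitv i) f (x + r *: unitv i)).
  exact: is_derive_line.
have cg a b : {within `[a, b], continuous g} := continuous_subspaceT (cont_der dg).
have g0 : g 0 = f x by rewrite /g scale0r addr0.
case: (lerP 0 h) => h0.
  have [c + E] := @MVT_segment R g _ 0 h h0 (fun r _ => dg r) (cg _ _).
  rewrite in_itv/= => /andP[c0 ch]; exists c; first by rewrite (ger0_norm c0) (ger0_norm h0).
  by rewrite -g0 -/(g h) E subr0.
have [c + E] := @MVT_segment R g _ h 0 (ltW h0) (fun r _ => dg r) (cg _ _).
rewrite in_itv/= => /andP[hc c0]; exists c.
  by rewrite (ler0_norm c0) (ltr0_norm h0) lerN2.
by rewrite -g0 -/(g h) -opprB E sub0r mulrN opprK.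
Qed.

End directional.

Section chain_rule.
Context {R : realType} {n : nat}.
Variables (phi : R -> 'rV[R]_n -> R) (g : R -> 'rV[R]_n) (g' : 'I_n -> R) (s : R).
Hypothesis dphi_t : derivable (phi^~ (g s)) s 1.
Hypothesis dphi_x : forall r x i, derivable (phi r) x (unitv i).
Hypothesis cphi_x : forall i,
  continuous (fun p : R * 'rV[R]_n => 'D_(unitv i) (phi p.1) p.2).
Hypothesis dg : forall i, is_derive s (1 : R) (fun r => g r ord0 i) (g' i).

Let mix (k : nat) (r : R) : 'rV[R]_n :=
  \row_i if (i < k)%N then g r ord0 i else g s ord0 i.

Let mix_cvg k : mix k r @[r --> s] --> g s.
Proof.
apply: cvg_rV => i; under eq_fun do rewrite mxE.
case: (i < k)%N; [exact: (der_cont (@dg i))|exact: cvg_cst].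
Qed.

Let mixS (k : 'I_n) r : mix k.+1 r = mix k r + (g r ord0 k - g s ord0 k) *: unitv k.
Proof.
apply/rowP => i; rewrite !mxE eqxx/= ltnS.
case: (ltngtP i k) => [ik|ik|/val_inj ->].
- by rewrite -val_eqE/= (ltn_eqF ik) mulr0 addr0.
- by rewrite -val_eqE/= (gtn_eqF ik) mulr0 addr0.
- by rewrite eqxx mulr1 addrC subrK.
Qed.

(** Only partial derivatives are available, so the coordinates are moved from time s to time r one
    by one; [mix k] has moved the first k. By the mean value theorem each increment is a partial
    derivative at an intermediate point times the displacement, and joint continuity gives the limit
    of its slope. *)
Lemma chain_rule : is_derive s (1 : R) (fun r => phi r (g r))
  ('D_1 (phi^~ (g s)) s + \sum_i g' i * 'D_(unitv i) (phi s) (g s)).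
Proof.
suff H k : (k <= n)%N -> is_derive s (1 : R) (fun r => phi r (mix k r))
    ('D_1 (phi^~ (g s)) s + \sum_(i < n | (i < k)%N) g' i * 'D_(unitv i) (phi s) (g s)).
  have := H n (leqnn n).
  rewrite (eq_bigl xpredT) => [|i]; last by rewrite ltn_ord.
  congr (is_derive _ _ _ _); apply/funext => r; congr (phi r _).
  by apply/rowP => i; rewrite mxE ltn_ord.
elim: k => [_|k IH kn].
  rewrite big_pred0// addr0.
  rewrite (_ : (fun r => _) = phi^~ (g s)); first exact: derivableP.
  apply/funext => r; congr (phi r _).
  by apply/rowP => i; rewrite mxE.
pose K := Ordinal kn.
have /is_derive1_caratheodory[c [cE cc c_s]] := @dg K.
have /choice[theta th] : forall r, exists th : R, `|th| <= `|g r ord0 K - g s ord0 K| /\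
    phi r (mix k.+1 r) - phi r (mix k r) =
    'D_(unitv K) (phi r) (mix k r + th *: unitv K) * (g r ord0 K - g s ord0 K).
  move=> r; have [th th1 th2] := MVT_line (mix k r) (g r ord0 K - g s ord0 K)
    (fun z => @dphi_x r z K).
  by exists th; split => //; rewrite (mixS K).
have dinc : is_derive s (1 : R) (fun r => phi r (mix k.+1 r) - phi r (mix k r))
    (g' K * 'D_(unitv K) (phi s) (g s)).
  apply/is_derive1_caratheodory.
  exists (fun r => 'D_(unitv K) (phi r) (mix k r + theta r *: unitv K) * c r); split.
  - move=> r; have [_ ->] := th r; have [_ ->] := th s.
    by rewrite subrr mulr0 subr0 cE mulrA.
  - have ths : theta s = 0.
      by have [+ _] := th s; rewrite subrr normr0 normr_le0 => /eqP.
    have th_cvg : theta r @[r --> s] --> (0 : R).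
      have d0 : `|g r ord0 K - g s ord0 K| @[r --> s] --> (0 : R).
        rewrite -(normr0 R) -(subrr (g s ord0 K)).
        by apply: cvg_norm; apply: cvgB; [exact: (der_cont (@dg K))|exact: cvg_cst].
      apply: norm_cvg0; apply: (squeeze_cvgr _ (cvg_cst 0) d0).
      by near=> r; have [+ _] := th r; rewrite normr_ge0.
    apply: cvgM => //.
    have : (r, mix k r + theta r *: unitv K) @[r --> s] --> (s, g s).
      have mth : (mix k r + theta r *: unitv K) @[r --> s] --> g s.
        rewrite -[g s]addr0 -(scale0r (unitv K)).
        by apply: cvgD; [exact: mix_cvg|exact: cvgZr_tmp].
      exact: (cvg_pair cvg_id mth).
    rewrite /continuous_at ths scale0r addr0.
    have -> : mix k s = g s by apply/rowP => i; rewrite mxE if_same.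
    by move=> H; exact: (cvg_comp _ _ H (@cphi_x K (s, g s))).
  - rewrite c_s mulrC; congr (_ * _).
    have [+ _] := th s; rewrite subrr normr0 normr_le0 => /eqP ->.
    rewrite scale0r addr0; congr ('D__ _ _).
    by apply/rowP => i; rewrite mxE if_same.
have := derD (IH (ltnW kn)) dinc.
rewrite (_ : (fun z => _) = fun r => phi r (mix k.+1 r)); last first.
  by apply/funext => r; rewrite addrC subrK.
move=> /is_derive_eq; apply.
rewrite -addrA; congr (_ + _); rewrite [RHS](bigD1 K)//= addrC; congr (_ + _).
apply: eq_bigl => i; rewrite ltnS -val_eqE/=.
by rewrite andbC ltn_neqAle.
Unshelve. all: by end_near. Qed.

End chain_rule.

Section compact_support.
Context {R : realType}.
Notation mu := (@lebesgue_measure R).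

Lemma coord_le_norm (n : nat) (x : 'rV[R]_n) i : `|x ord0 i| <= `|x|.
Proof.
rewrite [leRHS]/Num.Def.normr/= mx_normrE.
exact: (le_bigmax _ (fun ij : 'I_1 * 'I_n => `|x ij.1 ij.2|) (ord0, i)).
Qed.

Lemma norm_le_coord (n : nat) (x : 'rV[R]_n) (C : R) : 0 <= C ->
  (forall i, `|x ord0 i| <= C) -> `|x| <= C.
Proof.
move=> C0 xC; rewrite [leLHS]/Num.Def.normr/= mx_normrE.
by apply: bigmax_le => // -[i j] _; rewrite (ord1 i).
Qed.

Lemma near_norm_gt (V : normedModType R) (x : V) (M : R) : M < `|x| ->
  \forall y \near x, M < `|y|.
Proof. by move=> Mx; apply: (@cvgr_norm_gt _ _ _ (nbhs x) _ id x) => //; exact: cvg_id. Qed.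

Lemma is_derive_outside_support (V : normedModType R) (f : V -> R) (M : R) (x v : V) :
  (forall y, M < `|y| -> f y = 0) -> M < `|x| -> is_derive x v f 0.
Proof.
move=> fM Mx; apply: near_eq_is_derive (is_derive_cst (0 : R) x v).
by near=> y; rewrite fM//; near: y; exact: near_norm_gt.
Unshelve. all: by end_near. Qed.

Lemma compact_ball_rV (n : nat) (C : R) : compact [set x : 'rV[R]_n | `|x| <= C].
Proof.
apply: bounded_closed_compact.
  exists C; split; first exact: num_real.
  by move=> D CD x /= xC; exact: (le_trans xC (ltW CD)).
apply: (@closed_comp _ _ (fun x : 'rV[R]_n => `|x|) [set r | r <= C]).
  by move=> x _; exact: norm_continuous.
exact: closed_le.
Qed.

Lemma compact_support_bounded (n : nat) (f : 'rV[R]_n -> R) (M : R) :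
  continuous f -> (forall x, M < `|x| -> f x = 0) -> exists C, forall x, `|f x| <= C.
Proof.
move=> cf fM.
have cB := @compact_ball_rV n `|M|.
have [||c _ fc] := EVT_max_rV (f := fun x => `|f x|) _ cB.
- by exists 0; rewrite /= normr0.
- apply: continuous_subspaceT => x.
  by apply: (@continuous_comp _ _ _ f (fun r : R => `|r|)); [exact: cf|exact: norm_continuous].
exists `|f c| => x; case: (lerP `|x| `|M|) => xM; first exact/fc/mem_set.
by rewrite fM ?normr0// (le_lt_trans (ler_norm M)).
Qed.

Lemma compact_support_integrable (f : R -> R) (M : R) :
  continuous f -> (forall x, M < `|x| -> f x = 0) -> mu.-integrable setT (EFin \o f).
Proof.
move=> cf fM.
have := (@integrable_mkcond _ (measurableTypeR R) R mu _ (EFin \o f) (measurable_itv `[- `|M|, `|M|])).1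
  (continuous_integrable_itv (- `|M|) `|M| cf).
congr (integrable _ _ _).
apply/funext => x; rewrite patchE; case: ifPn => //; rewrite notin_setE/= in_itv/= => xM.
by rewrite fM// (le_lt_trans (ler_norm M))// ltNge ler_norml; apply/negP.
Qed.

End compact_support.

Section gaussian_integration_by_parts.
Context {R : realType}.
Notation N := (@normal_prob R 0 1).
Notation mu := (@lebesgue_measure R).
Notation pdf := (@normal_pdf R 0 1).

Lemma integral_derivative_compact_support (F f : R -> R) (M : R) :
  continuous f -> (forall x : R, is_derive x (1 : R) F (f x)) ->
  (forall x, M < `|x| -> F x = 0) ->
  (\int[mu]_x (f x)%:E = 0)%E.
Proof.
(* Enlarged by 1 because [F] vanishes only strictly beyond M. *)
move=> cf dF FM; pose M1 : R := `|M| + 1.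
have M1M : M < M1 by rewrite /M1; have := ler_norm M; lra.
have M10 : 0 < M1 by rewrite /M1; have := normr_ge0 M; lra.
have f0 x : M1 < `|x| -> f x = 0.
  move=> xM; have [_ <-] := dF x.
  by have [_ ->] := is_derive_outside_support (V := R) (1 : R) FM (lt_trans M1M xM).
transitivity (\int[mu]_(x in `[(- M1)%R, M1]%classic) (f x)%:E)%E.
  rewrite [RHS]integral_mkcond; apply: eq_integral => x _.
  rewrite patchE; case: ifPn => //; rewrite notin_setE/= in_itv/= => xM.
  by rewrite f0// ltNge ler_norml; apply/negP.
rewrite (@integral_derivative _ F)//; last 2 first.
- by lra.
- exact: continuous_subspaceT (cont_der dF).
by rewrite !FM ?subrr// ?normrN gtr0_norm.
Qed.

(** The derivative of f pdf is f' pdf - x f pdf, and the derivative of a compactly supported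
    function integrates to 0. *)
Lemma stdnormal_by_parts (f f' : R -> R) (M : R) :
  continuous f' -> (forall x : R, is_derive x (1 : R) f (f' x)) ->
  (forall x, M < `|x| -> f x = 0) ->
  (\int[N]_x (x * f x)%:E = \int[N]_x (f' x)%:E)%E.
Proof.
move=> cf' df fM.
have cpdf : continuous pdf := cont_der (@der_stdpdf R).
have f'M x : M < `|x| -> f' x = 0.
  move=> xM; have [_ <-] := df x.
  by have [_ ->] := is_derive_outside_support (V := R) (1 : R) fM xM.
have cxf : continuous (fun x : R => x * f x * pdf x).
  move=> x; apply: cvgM; last exact: cpdf.
  by apply: cvgM; [exact: cvg_id|exact: (cont_der df)].
have cf'p : continuous (fun x : R => f' x * pdf x).
  by move=> x; apply: cvgM; [exact: cf'|exact: cpdf].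
have ixf := compact_support_integrable (M := M) cxf.
have if' := compact_support_integrable (M := M) cf'p.
have {}ixf := ixf (fun x xM => ltac:(by rewrite (fM x xM) mulr0 mul0r)).
have {}if' := if' (fun x xM => ltac:(by rewrite (f'M x xM) mul0r)).
have stdnormal_density (S : set R) : measurable S ->
  N S = (\int[mu]_(x in S) (pdf x)%:E)%E by [].
have [_ ->] := @integral_density _ (measurableTypeR R) R mu N pdf (@normal_pdf_ge0 R 0 1)
  (@measurable_normal_pdf R 0 1) stdnormal_density (fun x : R => x * f x)
  ltac:(by apply: measurable_funM => //; exact: continuous_measurable_fun (cont_der df)) ixf.
have [_ ->] := @integral_density _ (measurableTypeR R) R mu N pdf (@normal_pdf_ge0 R 0 1)
  (@measurable_normal_pdf R 0 1) stdnormal_density f'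
  (continuous_measurable_fun cf') if'.
have H : (\int[mu]_x ((f' x * pdf x)%:E - (x * f x * pdf x)%:E) = 0)%E.
  apply: (@integral_derivative_compact_support (fun x => f x * pdf x)
    (fun x => f' x * pdf x - x * f x * pdf x) M).
  - by move=> x; apply: cvgB; [exact: cf'p|exact: cxf].
  - move=> x; have := derM (df x) (der_stdpdf x); move/is_derive_eq; apply.
    by ring.
  - by move=> x xM; rewrite fM// mul0r.
rewrite integralB//= in H.
have fin1 : (\int[mu]_x (f' x * pdf x)%:E)%E \is a fin_num := integrable_fin_num measurableT if'.
have fin2 : (\int[mu]_x (x * f x * pdf x)%:E)%E \is a fin_num := integrable_fin_num measurableT ixf.
by move: H; rewrite -(fineK fin1) -(fineK fin2) -EFinB => -[] /subr0_eq ->.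
Qed.

Lemma unitv0 (n : nat) : unitv (ord0 : 'I_n.+1) = consv (1, 0) :> 'rV[R]_n.+1.
Proof.
apply/rowP => i; have [j ->|->] := unliftP ord0 i.
  by rewrite [RHS]consvS !mxE.
by rewrite [RHS]consv0 mxE !eqxx.
Qed.

Lemma unitv_lift (n : nat) (j : 'I_n) :
  unitv (lift ord0 j) = consv (0, unitv j) :> 'rV[R]_n.+1.
Proof.
apply/rowP => i; have [k ->|->] := unliftP ord0 i.
  by rewrite [RHS]consvS !mxE/= (inj_eq lift_inj).
by rewrite [RHS]consv0 mxE.
Qed.

Lemma continuous_comp_consvr (n : nat) (x : R) (f : 'rV[R]_n.+1 -> R) :
  continuous f -> continuous (fun v => f (consv (x, v))).
Proof.
move=> cf v; apply: (@continuous_comp _ _ _ (fun v => consv (x, v)) f); last exact: cf.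
move: v; apply: continuous_rV => i; have [j ->|->] := unliftP ord0 i.
  by under eq_fun do rewrite consvS; exact: coord_continuous.
by under eq_fun do rewrite consv0; exact: cst_continuous.
Qed.

Lemma continuous_comp_consvl (n : nat) (v : 'rV[R]_n) (f : 'rV[R]_n.+1 -> R) :
  continuous f -> continuous (fun x => f (consv (x, v))).
Proof.
move=> cf x; apply: (@continuous_comp _ _ _ (fun x => consv (x, v)) f); last exact: cf.
move: x; apply: continuous_rV => i; have [j ->|->] := unliftP ord0 i.
  by under eq_fun do rewrite consvS; exact: cst_continuous.
by under eq_fun do rewrite consv0; move=> x; exact: cvg_id.
Qed.

(** If i is the coordinate peeled off, the one-dimensional identity applies with that variable
    innermost; otherwise the induction hypothesis applies at a fixed first coordinate. *)
Lemma stdgauss_by_parts (n : nat) (i : 'I_n) (f : 'rV[R]_n -> R) (M : R) :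
  continuous f -> (forall x, derivable f x (unitv i)) ->
  continuous ('D_(unitv i) f) ->
  (forall x, M < `|x| -> f x = 0) ->
  (\int[stdgauss n]_x (x ord0 i * f x)%:E = \int[stdgauss n]_x ('D_(unitv i) f x)%:E)%E.
Proof.
elim: n => [|n IH] in i f *; first by case: i.
move=> cf df cdf fM.
have DM x : M < `|x| -> 'D_(unitv i) f x = 0.
  by move=> xM; have [_ ->] := is_derive_outside_support (unitv i) fM xM.
have [C fC] := compact_support_bounded cf fM.
have [C' DC] := compact_support_bounded cdf DM.
have mf := continuous_measurable_rV cf.
have mDf := continuous_measurable_rV cdf.
have mxf : measurable_fun setT (fun x : 'rV[R]_n.+1 => x ord0 i * f x).
  by apply: measurable_funM => //; exact: measurable_coord.
have xfC (x : 'rV[R]_n.+1) : `|x ord0 i * f x| <= `|M| * C.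
  case: (lerP `|x| M) => xM; last first.
    by rewrite fM// mulr0 normr0 mulr_ge0// (le_trans _ (fC 0)).
  rewrite normrM ler_pM//; apply: le_trans (coord_le_norm x i) _.
  exact: le_trans xM (ler_norm M).
have [E1 E2] := integral_stdgaussS mxf xfC.
have [D1 D2] := integral_stdgaussS mDf DC.
have fcM (x : R) (v : 'rV[R]_n) : M < `|x| \/ M < `|v| -> f (consv (x, v)) = 0.
  move=> xvM; apply: fM; case: xvM => [xM|vM].
    by have := coord_le_norm (consv (x, v)) ord0; rewrite consv0; exact: lt_le_trans.
  rewrite (lt_le_trans vM)// norm_le_coord// => j.
  by have := coord_le_norm (consv (x, v)) (lift ord0 j); rewrite consvS.
have [j iE|iE] := unliftP ord0 i.
  rewrite E1 D1; apply: eq_integral => x _.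
  have lineE (v : 'rV[R]_n) :
    (fun h : R => h^-1 *: ((f \o shift (consv (x, v))) (h *: unitv i) - f (consv (x, v)))) =
    (fun h : R => h^-1 *: (((fun v => f (consv (x, v))) \o shift v) (h *: unitv j) -
      f (consv (x, v)))).
    apply/funext => h /=; congr (_ *: (f _ - _)).
    rewrite iE unitv_lift (addrC (h *: _)) consv_affine.
    by rewrite mulr0 addr0 (addrC (h *: _)).
  have DE v : 'D_(unitv i) f (consv (x, v)) = 'D_(unitv j) (fun v => f (consv (x, v))) v.
    by rewrite /derive lineE.
  under [RHS]eq_integral do rewrite DE.
  rewrite -IH.
  - by apply: eq_integral => v _; rewrite iE consvS.
  - by move=> v; exact: (@continuous_comp_consvr n x f cf v).
  - by move=> v; have := df (consv (x, v)); rewrite /derivable lineE.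
  - rewrite (_ : 'D_(unitv j) _ = fun v => 'D_(unitv i) f (consv (x, v))).
      by move=> v; exact: (@continuous_comp_consvr n x _ cdf v).
    by apply/funext => v; rewrite DE.
  - by move=> v vM; apply: fcM; right.
rewrite E2 D2; apply: eq_integral => v _.
have dline (x : R) : is_derive x (1 : R) (fun x => f (consv (x, v)))
    ('D_(unitv i) f (consv (x, v))).
  have := @is_derive_line _ _ f (consv (0, v)) i x; rewrite iE unitv0.
  rewrite consv_affine add0r mulr1 scaler0 addr0 -unitv0 -iE => /(_ (df _)).
  congr (is_derive _ _ _ _); apply/funext => h.
  by rewrite iE unitv0 consv_affine add0r mulr1 scaler0 addr0.
rewrite -(@stdnormal_by_parts (fun x => f (consv (x, v)))
  (fun x => 'D_(unitv i) f (consv (x, v))) M)//.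
- by apply: eq_integral => x _; rewrite iE consv0.
- by move=> x; exact: (@continuous_comp_consvl n v _ cdf x).
- by move=> x xM; apply: fcM; left.
Qed.

Lemma continuous_comp_affine (n : nat) (m : 'rV[R]_n) (s : R) (f : 'rV[R]_n -> R) :
  continuous f -> continuous (fun z : 'rV[R]_n => f (m + s *: z)).
Proof.
move=> cf z; apply: (@continuous_comp _ _ _ (fun z : 'rV[R]_n => m + s *: z) f); last exact: cf.
move: z; apply: continuous_rV => j; under eq_fun do rewrite !mxE.
have cr : continuous (fun r : R => m ord0 j + s * r).
  by apply: cont_der => r; exact: (derD (der_cst _ _) (derZ s (der_id r))).
by move=> z; apply: (@continuous_comp _ _ _ (fun z : 'rV[R]_n => z ord0 j)
  (fun r : R => m ord0 j + s * r)); [exact: coord_continuous|exact: cr].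
Qed.

(** Differentiating z -> f (m + s z) produces the second factor s. For s = 0 this function is
    constant rather than compactly supported, hence the separate case. *)
Lemma stdgauss_affine_by_parts (n : nat) (i : 'I_n) (f : 'rV[R]_n -> R) (M : R)
    (m : 'rV[R]_n) (s : R) :
  continuous f -> (forall x, derivable f x (unitv i)) ->
  continuous ('D_(unitv i) f) ->
  (forall x, M < `|x| -> f x = 0) ->
  \int[stdgauss n]_z (s * z ord0 i * f (m + s *: z)) =
  s ^+ 2 * \int[stdgauss n]_z 'D_(unitv i) f (m + s *: z).
Proof.
move=> cf df cdf fM.
have [->|s0] := eqVneq s 0.
  under eq_Rintegral do rewrite !mul0r.
  by rewrite expr2 !mul0r /Rintegral integral0.
pose h (z : 'rV[R]_n) : R := f (m + s *: z).
have DM x : M < `|x| -> 'D_(unitv i) f x = 0.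
  by move=> xM; have [_ ->] := is_derive_outside_support (unitv i) fM xM.
have [C' DC] := compact_support_bounded cdf DM.
have line (z : 'rV[R]_n) : (fun r : R => h (z + r *: unitv i)) =
    (fun r => f ((m + s *: z) + r *: unitv i)) \o ( *%R s).
  by apply/funext => r /=; rewrite /h scalerDr addrA scalerA.
have dh (z : 'rV[R]_n) : is_derive z (unitv i) h (s * 'D_(unitv i) f (m + s *: z)).
  have H : is_derive (0 : R) (1 : R) (fun r => h (z + r *: unitv i)) (s * 'D_(unitv i) f (m + s *: z)).
    rewrite line.
    have := @is_derive_line _ _ f (m + s *: z) i (s * 0); rewrite mulr0 scale0r addr0 => /(_ (df _)) H.
    have := der_comp (f := fun r => f (m + s *: z + r *: unitv i)) (x := 0)
      (g := fun r => s * r) _ (derZ s (der_id (0 : R))).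
    rewrite mulr0 mulr1 => /(_ _ H); move/is_derive_eq; apply; exact: mulrC.
  exact: is_derive_of_line.
have Dh : 'D_(unitv i) h = fun z : 'rV[R]_n => s * 'D_(unitv i) f (m + s *: z).
  by apply/funext => z; have [_ ->] := dh z.
have cD : continuous (fun z : 'rV[R]_n => 'D_(unitv i) f (m + s *: z)).
  by move=> z; exact: (@continuous_comp_affine n m s _ cdf z).
have ch : continuous h.
  by move=> z; exact: (@continuous_comp_affine n m s _ cf z).
have hM (z : 'rV[R]_n) : (M + `|m|) / `|s| < `|z| -> h z = 0.
  rewrite ltr_pdivrMr ?normr_gt0// => zM; apply: fM.
  rewrite -(ltrD2r `|m|) (lt_le_trans zM)// mulrC -normrZ.
  rewrite -[X in `|X| <= _](addrK m) (addrC (s *: z)) .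
  by apply: le_trans (ler_normB _ _) _; rewrite lerD2r.
have := @stdgauss_by_parts n i h _ ch (fun z => @ex_derive _ _ _ _ _ _ _ (dh z)).
rewrite Dh => /(_ _ _ hM) H.
have -> : \int[stdgauss n]_z (s * z ord0 i * h z) = s * \int[stdgauss n]_z (z ord0 i * h z).
  under eq_Rintegral do rewrite -mulrA.
  have czh : continuous (fun z : 'rV[R]_n => z ord0 i * h z).
    have cz : continuous (fun z : 'rV[R]_n => z ord0 i) := @coord_continuous R 1 n ord0 i.
    exact (contM cz ch).
  have zhM (z : 'rV[R]_n) : (M + `|m|) / `|s| < `|z| -> z ord0 i * h z = 0.
    by move=> /hM ->; rewrite mulr0.
  have [C zhC] := compact_support_bounded czh zhM.
  by rewrite RintegralZl//; exact: bounded_integrable (continuous_measurable_rV czh) zhC.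
rewrite [in LHS]/Rintegral H; last first.
  exact (contM (@cont_cst _ _ s) cD).
have -> : (\int[stdgauss n]_x ('D_(unitv i) h x)%:E =
    \int[stdgauss n]_x (s * 'D_(unitv i) f (m + s *: x)%R)%:E)%E.
  by apply: eq_integral => z _; have [_ ->] := dh z.
rewrite -/(Rintegral _ _ _) RintegralZl//.
  by rewrite mulrA -expr2.
apply: bounded_integrable (fun z => DC _).
exact: continuous_measurable_rV.
Qed.

End gaussian_integration_by_parts.

Section continuity_joint.
Context {R : realType} {n : nat}.
Notation V := 'rV[R]_n.

Lemma cont_fst (f : R -> R) : continuous f -> continuous (fun p : R * V => f p.1).
Proof. by move=> cf p; apply: (@continuous_comp _ _ _ fst f); [exact: cvg_fst|exact: cf]. Qed.

Lemma cont_coord2 (i : 'I_n) : continuous (fun p : R * V => p.2 ord0 i).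
Proof.
move=> p; apply: (@continuous_comp _ _ _ snd (fun x : V => x ord0 i)); first exact: cvg_snd.
exact: (@coord_continuous R 1 n ord0 i).
Qed.

Lemma cont_section (H : R -> V -> R) (s : R) :
  continuous (fun p : R * V => H p.1 p.2) -> continuous (H s).
Proof.
move=> cH x; apply: (@continuous_comp _ _ _ (fun x : V => (s, x)) (fun p : R * V => H p.1 p.2)).
  by exact (cvg_pair (cvg_cst s) (@cvg_id _ (nbhs x))).
exact: cH.
Qed.

Lemma cont_curve (H : R -> V -> R) (g : R -> V) (s : R) :
  continuous (fun p : R * V => H p.1 p.2) -> {for s, continuous g} ->
  {for s, continuous (fun r => H r (g r))}.
Proof.
move=> cH cg; apply: (@continuous_comp _ _ _ (fun r => (r, g r)) (fun p : R * V => H p.1 p.2)).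
  exact: (cvg_pair cvg_id cg).
exact: cH.
Qed.

Lemma compact_support_bounded2 (H : R -> V -> R) (M u v : R) :
  continuous (fun p : R * V => H p.1 p.2) ->
  (forall s x, M < `|x| -> H s x = 0) ->
  exists C, forall s x, u <= s <= v -> `|H s x| <= C.
Proof.
move=> cH HM.
have [uv|vu] := lerP u v; last first.
  by exists 0 => s x /andP[us sv]; move: vu; rewrite ltNge (le_trans us sv).
have cK := compact_setX (@segment_compact R u v) (@compact_ball_rV R n `|M|).
have [||[s0 x0] _ fc] := compact_EVT_max (f := fun p : R * V => `|H p.1 p.2|) _ cK.
- by exists (u, 0); split => /=; rewrite ?in_itv/= ?lexx// normr0.
- apply: continuous_subspaceT => p.
  by apply: (@continuous_comp _ _ _ (fun p : R * V => H p.1 p.2) (fun r : R => `|r|));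
    [exact: cH|exact: norm_continuous].
exists `|H s0 x0| => s x usv; case: (lerP `|x| `|M|) => xM.
  by apply: (fc (s, x)); apply/mem_set; split => /=; rewrite ?in_itv.
by rewrite HM ?normr0// (le_lt_trans (ler_norm M)).
Qed.

End continuity_joint.

Lemma Rintegral_sum d (T : measurableType d) (R : realType) (mu : {measure set T -> \bar R})
    (I : finType) (F : I -> T -> R) :
  (forall i, mu.-integrable setT (EFin \o F i)) ->
  mu.-integrable setT (EFin \o (fun x => \sum_i F i x)) /\
  \int[mu]_x (\sum_i F i x) = \sum_i \int[mu]_x F i x.
Proof.
move=> iF; suff H (r : seq I) : mu.-integrable setT (EFin \o (fun x => \sum_(i <- r) F i x)) /\
    \int[mu]_x (\sum_(i <- r) F i x) = \sum_(i <- r) \int[mu]_x F i x by exact: H.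
elim: r => [|i r [IH1 IH2]].
  split; last by rewrite big_nil /Rintegral; under eq_integral do rewrite big_nil; rewrite integral0.
  rewrite (_ : _ \o _ = cst 0%E); first exact: integrable0.
  by apply/funext => x /=; rewrite big_nil.
split; last by rewrite big_cons -IH2 -RintegralD//; apply: eq_Rintegral => x _; rewrite big_cons.
rewrite (_ : _ \o _ = EFin \o (fun x => F i x + \sum_(j <- r) F j x)).
  exact: integrable_add.
by apply/funext => x /=; rewrite big_cons.
Qed.

(** * The Gaussian flow is a weak solution *)

Section gaussian_expectation.
Context {R : realType} {n : nat}.
Notation V := 'rV[R]_n.

Lemma gaussian_expectation_continuous (H : R -> V -> R) (m : R -> V) (sg : R -> R) (M : R) :
  continuous (fun p : R * V => H p.1 p.2) ->
  (forall s x, M < `|x| -> H s x = 0) ->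
  continuous m -> continuous sg ->
  continuous (fun s => \int[stdgauss n]_z H s (m s + sg s *: z)).
Proof.
move=> cH HM cm cs s.
have [C HC] := compact_support_bounded2 (s - 1) (s + 1) cH HM.
have mH (r : R) : measurable_fun setT (fun z : V => H r (m r + sg r *: z)).
  by apply: continuous_measurable_rV; apply: continuous_comp_affine; exact: cont_section.
apply: (@continuity_under_integral R _ _ (stdgauss n) (fun s z => H s (m s + sg s *: z))
  setT measurableT (s - 1) (s + 1) _ _ (cst C)).
- move=> r /=; rewrite in_itv/= => /andP[/ltW r1 /ltW r2].
  have Hr z : `|H r (m r + sg r *: z)| <= C by apply: HC; rewrite r1.
  exact: (bounded_integrable _ (mH r) Hr).
- apply: nearW => z _ r _; apply: cont_curve => //.
  by apply: cvgD; [exact: cm|apply: cvgZr_tmp; exact: cs].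
- exact: finite_measure_integrable_cst.
- move=> r /=; rewrite in_itv/= => /andP[/ltW r1 /ltW r2].
  by apply: nearW => z _; apply: HC; rewrite r1.
by rewrite inE/= in_itv/=; apply/andP; split; lra.
Qed.

End gaussian_expectation.

Section existence.
Context {R : realType} {n : nat}.
Notation V := 'rV[R]_n.
Variables (delta : R) (At : R -> R) (Bt : R -> V) (m : R -> V) (sg kappa : R -> R).
Hypothesis cAt : continuous At.
Hypothesis cBt : forall i, continuous (fun t => Bt t ord0 i).
Hypothesis dm : forall (s : R) i,
  is_derive s (1 : R) (fun r => m r ord0 i) (- (2 * At s * m s ord0 i + Bt s ord0 i)).
Hypothesis csg : continuous sg.
Hypothesis dsg : forall s : R, 0 < s -> is_derive s (1 : R) sg (kappa s * sg s).
Hypothesis ckappa : forall s : R, 0 < s -> {for s, continuous kappa}.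
Hypothesis kappaE : forall s : R, 0 < s ->
  kappa s * sg s ^+ 2 = - (2 * At s * sg s ^+ 2) + delta ^+ 2 / 2.
Variable phi : R -> V -> R.
Hypothesis phi_test : test_function phi.

Definition dual_integrand (s : R) (x : V) : R :=
  'D_1 (phi^~ x) s - dotv (grad_value At Bt s x) (grad (phi s) x)
  + delta ^+ 2 / 2 * laplacian (phi s) x.

Let cm : continuous m.
Proof. by apply: continuous_rV => i; exact: cont_der (fun s => @dm s i). Qed.

Let cmi i : continuous (fun t => m t ord0 i).
Proof. exact: cont_der (fun s => @dm s i). Qed.

Lemma test_function_support : exists M, forall s x, M < `|x| ->
  [/\ phi s x = 0, 'D_1 (phi^~ x) s = 0, forall i, 'D_(unitv i) (phi s) x = 0 &
    forall i j, 'D_(unitv j) ('D_(unitv i) (phi s)) x = 0].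
Proof.
have [[M phiM] _ _ _ _] := phi_test; exists M => s x xM.
have D0 i z : M < `|z| -> 'D_(unitv i) (phi s) z = 0.
  by move=> zM; have [_ ->] := is_derive_outside_support (unitv i) (phiM s) zM.
split; [exact: phiM| |by move=> i; exact: D0|].
  rewrite (_ : phi^~ x = cst 0); first exact: derive_cst.
  by apply/funext => r; exact: phiM.
by move=> i j; have [_ ->] := is_derive_outside_support (unitv j) (D0 i) xM.
Qed.

Lemma dual_integrand_continuous : continuous (fun p : R * V => dual_integrand p.1 p.2).
Proof.
have [_ _ _ _ [_ c1 c2 c3]] := phi_test.
rewrite /dual_integrand /dotv /laplacian.
apply: contD; first apply: contB => //.
- apply: cont_sum => i; apply: contM.
    rewrite (_ : (fun x => _) = fun p : R * V => 2 * At p.1 * p.2 ord0 i + Bt p.1 ord0 i); last first.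
      by apply/funext => p; rewrite !mxE.
    apply: contD; last exact: (cont_fst (@cBt i)).
    by apply: contM; [apply: contM; [exact: cont_cst|exact: cont_fst]|exact: cont_coord2].
  rewrite (_ : (fun x => _) = fun p : R * V => 'D_(unitv i) (phi p.1) p.2)//.
  by apply/funext => p; rewrite !mxE.
- by apply: contM; [exact: cont_cst|apply: cont_sum => i; exact: c3].
Qed.

Lemma dual_integrand_support : exists M, forall s x, M < `|x| -> dual_integrand s x = 0.
Proof.
have [M HM] := test_function_support; exists M => s x /(HM s)[_ D1 Di Dij].
rewrite /dual_integrand D1 /dotv /laplacian big1 => [|i _]; last first.
  by rewrite /grad [X in _ * X]mxE Di mulr0.
by rewrite big1 ?mulr0 ?subr0 ?addr0.
Qed.

Definition gauss_dual (s : R) : R :=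
  \int[stdgauss n]_z dual_integrand s (m s + sg s *: z).

Lemma gauss_dual_continuous : continuous gauss_dual.
Proof.
have [M HM] := dual_integrand_support.
exact: gaussian_expectation_continuous dual_integrand_continuous HM cm csg.
Qed.

(** The time derivative of phi along m s + sg s z, written in terms of the position x: as [kappa] is
    the logarithmic derivative of [sg], the fluctuation sg z moves with velocity kappa (x - m). *)
Let K (s : R) (x : V) : R := 'D_1 (phi^~ x) s +
  \sum_i (- (2 * At s * m s ord0 i + Bt s ord0 i) + kappa s * (x ord0 i - m s ord0 i))
    * 'D_(unitv i) (phi s) x.

Let dphi (s : R) (z : V) : 0 < s ->
  is_derive s (1 : R) (fun r => phi r (m r + sg r *: z)) (K s (m s + sg s *: z)).
Proof.
move=> s0; have [_ d1 d2 _ [_ c1 c2 _]] := phi_test.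
have dg i : is_derive s (1 : R) (fun r => (m r + sg r *: z) ord0 i)
    (- (2 * At s * m s ord0 i + Bt s ord0 i) + kappa s * (sg s * z ord0 i)).
  rewrite (_ : (fun r => _) = fun r => m r ord0 i + z ord0 i * sg r); last first.
    by apply/funext => r; rewrite !mxE [sg r * _]mulrC.
  apply: is_derive_eq (derD (dm s i) (derZ (z ord0 i) (dsg s0))) _.
  by ring.
apply: is_derive_eq (chain_rule (d1 _ _) d2 c2 dg) _.
rewrite /K; congr (_ + _); apply: eq_bigr => i _; congr (_ * _).
by rewrite !mxE; ring.
Qed.

(* Truncating the time argument of kappa makes K jointly continuous without
   changing it on [u, v]. *)
Let K_bounded (u v : R) : 0 < u -> u <= v -> exists C, forall s x, u <= s <= v ->
  `|K s x| <= C.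
Proof.
move=> u0 uv; have [_ d1 d2 _ [_ c1 c2 _]] := phi_test.
pose Kc (s : R) (x : V) : R := 'D_1 (phi^~ x) s +
  \sum_i (- (2 * At s * m s ord0 i + Bt s ord0 i) +
    kappa (clamp u v s) * (x ord0 i - m s ord0 i)) * 'D_(unitv i) (phi s) x.
have ck : continuous (fun s => kappa (clamp u v s)).
  move=> s; apply: (@continuous_comp _ _ _ (clamp u v) kappa); first exact: clamp_continuous.
  by apply: ckappa; have /andP[+ _] := clamp_in s uv; exact: lt_le_trans.
have cKc : continuous (fun p : R * V => Kc p.1 p.2).
  apply: contD => //; apply: cont_sum => i; apply: contM => //.
  apply: contD.
    under eq_fun do rewrite opprD.
    apply: contB; last exact: (cont_fst (@cBt i)).
    under eq_fun do rewrite -mulNr -mulrN.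
    apply: contM; last exact: (cont_fst (@cmi i)).
    apply: contM; first exact: cont_cst.
    by move=> p; apply: cvgN; exact: (cont_fst cAt).
  apply: contM; first exact: (cont_fst ck).
  by apply: contB; [exact: cont_coord2|exact: (cont_fst (@cmi i))].
have [M HM] := test_function_support.
have KcM s x : M < `|x| -> Kc s x = 0.
  move=> /(HM s)[_ D1 Di _]; rewrite /Kc D1 big1 ?addr0// => i _.
  by rewrite Di mulr0.
have [C KC] := compact_support_bounded2 u v cKc KcM.
exists C => s x usv; have := KC s x usv.
by rewrite /Kc clamp_id.
Qed.

(** The integrands differ by the sum of the [rest i]. Integration by parts turns the mean of (x_i -
    m_i) D_i phi into sg^2 times the mean of D_ii phi, and [kappaE] says that (kappa + 2 At) sg^2 =
    delta^2 / 2: the spreading of the Gaussian accounts exactly for the Laplacian. *)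
Let K_integral (s : R) : 0 < s ->
  \int[stdgauss n]_z K s (m s + sg s *: z) = gauss_dual s.
Proof.
move=> s0; have [_ _ d2 d3 [_ _ c2 c3]] := phi_test.
have [M HM] := test_function_support.
pose ev (h : V -> R) (z : V) := h (m s + sg s *: z).
have int_ev (h : V -> R) : continuous h -> (forall x, M < `|x| -> h x = 0) ->
    (stdgauss n).-integrable setT (EFin \o ev h).
  move=> ch hM; have [C hC] := compact_support_bounded ch hM.
  have mh : measurable_fun setT (ev h).
    by apply: continuous_measurable_rV; exact: continuous_comp_affine.
  exact: (bounded_integrable _ mh (fun z => hC _)).
have cD i : continuous ('D_(unitv i) (phi s)) :=
  cont_section (H := fun s => 'D_(unitv i) (phi s)) (s := s) (c2 i).
have cDD i : continuous ('D_(unitv i) ('D_(unitv i) (phi s))).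
  exact: (cont_section (H := fun s => 'D_(unitv i) ('D_(unitv i) (phi s))) (s := s) (c3 i i)).
have DM i x : M < `|x| -> 'D_(unitv i) (phi s) x = 0 by move=> /(HM s)[_ _ + _]; exact.
pose h1 i (x : V) := (x ord0 i - m s ord0 i) * 'D_(unitv i) (phi s) x.
pose h2 i (x : V) := 'D_(unitv i) ('D_(unitv i) (phi s)) x.
have ih1 i : (stdgauss n).-integrable setT (EFin \o ev (h1 i)).
  apply: int_ev => [|x xM]; last by rewrite /h1 DM// mulr0.
  apply: contM (cD i); apply: contB; last exact: cont_cst.
  exact: (@coord_continuous R 1 n ord0 i).
have ih2 i : (stdgauss n).-integrable setT (EFin \o ev (h2 i)).
  by apply: int_ev => [|x /(HM s)[_ _ _ +]]; [exact: cDD|exact].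
have H12 i : \int[stdgauss n]_z ev (h1 i) z = sg s ^+ 2 * \int[stdgauss n]_z ev (h2 i) z.
  rewrite -(@stdgauss_affine_by_parts _ n i ('D_(unitv i) (phi s)) M (m s) (sg s))//.
    by apply: eq_Rintegral => z _; rewrite /ev /h1 !mxE addrAC subrr add0r.
  exact: DM.
pose k := kappa s + 2 * At s.
pose rest i z := k * ev (h1 i) z - delta ^+ 2 / 2 * ev (h2 i) z.
have irest i : (stdgauss n).-integrable setT (EFin \o rest i).
  by apply: integrable_sub; exact: integrable_scale.
have rest0 i : \int[stdgauss n]_z rest i z = 0.
  rewrite RintegralB//; [|exact: integrable_scale|exact: integrable_scale].
  rewrite !RintegralZl// H12; set I2 := \int[stdgauss n]_z _.
  transitivity ((kappa s * sg s ^+ 2 + 2 * At s * sg s ^+ 2 - delta ^+ 2 / 2) * I2).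
    by rewrite /k; ring.
  by rewrite kappaE//; ring.
have [M' LM] := dual_integrand_support.
have [C LC] := compact_support_bounded (cont_section (s := s) dual_integrand_continuous) (LM s).
have mL : measurable_fun setT (ev (dual_integrand s)).
  apply: continuous_measurable_rV; apply: continuous_comp_affine.
  exact: (cont_section (s := s) dual_integrand_continuous).
have iL : (stdgauss n).-integrable setT (EFin \o ev (dual_integrand s)).
  exact: (bounded_integrable _ mL (fun z => LC _)).
have [isum Esum] := Rintegral_sum irest.
transitivity (\int[stdgauss n]_z (ev (dual_integrand s) z + \sum_i rest i z)).
  apply: eq_Rintegral => z _; rewrite /K /ev /dual_integrand /dotv /laplacian /rest /ev.
  rewrite sumrB -!mulr_sumr -/(ev _ _).
  rewrite -!addrA; congr (_ + _).
  have cancel (S1 S2 S3 : R) : S1 + (S2 + (S3 - S2)) = S1 + S3 by ring.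
  rewrite /h2 cancel mulr_sumr -sumrN -big_split/=; apply: eq_bigr => i _.
  by rewrite /h1 !mxE /k; ring.
rewrite RintegralD// Esum big1 ?addr0// => i _; exact: rest0.
Qed.

Let dF (s : R) : 0 < s ->
  is_derive s (1 : R) (fun r => \int[stdgauss n]_z phi r (m r + sg r *: z)) (gauss_dual s).
Proof.
move=> s0; have [_ d1 d2 _ [c0 c1 c2 _]] := phi_test.
(* The window ]s / 2, s + 1[ stays away from time 0, where [kappa] may be unbounded. *)
have u0 : 0 < s / 2 by lra.
have uv : s / 2 <= s + 1 by lra.
have [C KC] := K_bounded u0 uv.
have [M HM] := test_function_support.
have phiM r x : M < `|x| -> phi r x = 0 by move=> /(HM r)[].
have [C' phiC] := compact_support_bounded2 (s / 2) (s + 1) c0 phiM.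
have Is : [set` `]s / 2, s + 1[] s by rewrite /= in_itv/=; apply/andP; split; lra.
pose f (r : R) (z : V) := phi r (m r + sg r *: z).
have intf (r : R) : [set` `]s / 2, s + 1[] r -> (stdgauss n).-integrable setT (EFin \o f r).
  rewrite /= in_itv/= => /andP[/ltW r1 /ltW r2].
  have mf : measurable_fun setT (f r).
    by apply: continuous_measurable_rV; apply: continuous_comp_affine; exact: cont_section.
  have fC z : `|f r z| <= C' by apply: phiC; rewrite r1.
  exact: (bounded_integrable _ mf fC).
have dKf (r : R) (z : V) : [set` `]s / 2, s + 1[] r -> is_derive r (1 : R) (f^~ z) (K r (m r + sg r *: z)).
  by rewrite /= in_itv/= => /andP[r1 _]; apply: dphi; lra.
have derf (r : R) (z : V) : [set` `]s / 2, s + 1[] r -> [set: V] z -> derivable (f^~ z) r 1.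
  by move=> /(dKf _ z)[].
have G_ub (r : R) (z : V) : [set` `]s / 2, s + 1[] r -> [set: V] z -> `|partial1of2 f r z| <= cst `|C| z.
  move=> Ir _; rewrite partial1of2E; have [_ ->] := dKf r z Ir.
  move: Ir; rewrite /= in_itv/= => /andP[/ltW r1 /ltW r2].
  by rewrite (le_trans (KC _ _ _)) ?r1 ?ler_norm.
have G0 (z : V) : 0 <= cst `|C| z by [].
have intG : (stdgauss n).-integrable setT (EFin \o cst `|C|).
  exact: finite_measure_integrable_cst.
have D := derivable_under_integral measurableT Is intf derf G0 intG G_ub.
have E := differentiation_under_integral measurableT Is intf derf G0 intG G_ub.
apply: DeriveDef => //.
rewrite -derive1E E -K_integral//; apply: eq_Rintegral => z _.
by rewrite partial1of2E; have [_ ->] := dKf s z Is.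
Qed.

(** Differentiability of [sg] is known at positive times only, but the fundamental theorem on [0, t]
    asks no more than continuity of [F] at the end points. *)
Lemma gauss_weak_identity (y : V) (t : R) : m 0 = y -> sg 0 = 0 -> 0 <= t ->
  \int[stdgauss n]_z phi t (m t + sg t *: z) =
  phi 0 y + \int[lebesgue_measure]_(s in `[0, t]) gauss_dual s.
Proof.
move=> m0 sg0 t0.
have [M HM] := test_function_support.
have phiM r x : M < `|x| -> phi r x = 0 by move=> /(HM r)[].
have [_ _ _ _ [c0 _ _ _]] := phi_test.
pose F r := \int[stdgauss n]_z phi r (m r + sg r *: z).
have cF : continuous F := gaussian_expectation_continuous c0 phiM cm csg.
have -> : phi 0 y = F 0.
  rewrite /F sg0 m0; under eq_Rintegral do rewrite scale0r addr0.
  rewrite /Rintegral integral_cst//= probability_setT mule1//.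
have dFt (s : R) : 0 < s < t -> is_derive s (1 : R) F (gauss_dual s).
  by move=> /andP[s0 _]; exact: dF.
have := Rintegral_derivative t0 gauss_dual_continuous (continuous_subspaceT cF) dFt.
by move=> ->; rewrite addrC subrK.
Qed.

End existence.

Section intervals.
Context {R : realType}.
Notation mu := (@lebesgue_measure R).

(** The left end point is a null set. It is left out because [A] and [B] agree with [At] and [Bt] at
    positive times only. *)
Lemma eq_integrable_oc (f g : R -> R) (a b : R) :
  (forall s, a < s <= b -> f s = g s) ->
  mu.-integrable `[a, b] (EFin \o g) ->
  mu.-integrable `[a, b] (EFin \o f) /\
  \int[mu]_(s in `[a, b]) f s = \int[mu]_(s in `[a, b]) g s.
Proof.
move=> fg ig.
have ig' : mu.-integrable `]a, b] (EFin \o g).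
  by apply: integrableS ig => //; exact: subset_itv_oc_cc.
have if' : mu.-integrable `]a, b] (EFin \o f).
  by apply: eq_integrable ig' => // s; rewrite inE/= in_itv/= => sab; rewrite fg.
have if1 : mu.-integrable `[a, b] (EFin \o f).
  have /integrableP[mf intf] := if'.
  apply/integrableP; split; first exact/emeasurable_fun_itv_obnd_cbndP.
  rewrite -integral_itv_obnd_cbnd//.
  exact: measurableT_comp mf.
split => //; rewrite -!Rintegral_itv_obnd_cbnd//.
by apply: eq_Rintegral => s; rewrite inE/= in_itv/= => sab; rewrite fg.
Qed.

End intervals.

Section flow.
Context {R : realType} {n : nat}.
Notation V := 'rV[R]_n.
Variables (At : R -> R) (Bt : R -> V).
Hypothesis cAt : continuous At.
Hypothesis cBt : forall i, continuous (fun t => Bt t ord0 i).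

(* e is the propagator from time 0, mb the mean of the process started at 0,
   and delta^2 e^2 q its variance. *)
Lemma exists_flow : exists (e : R -> R) (mb : R -> V) (q : R -> R),
  [/\ e 0 = 1 /\ (forall t : R, 0 < e t),
      forall t : R, is_derive t (1 : R) e (- (2 * At t * e t)),
      mb 0 = 0 /\ (forall (t : R) i, is_derive t (1 : R) (fun r => mb r ord0 i)
                   (- (2 * At t * mb t ord0 i + Bt t ord0 i))),
      q 0 = 0 & forall t : R, is_derive t (1 : R) q ((e t ^+ 2)^-1)].
Proof.
have [F [F0 dF]] := exists_antiderivative cAt.
pose e t := expR (- 2 * F t).
have e_gt0 t : 0 < e t by exact: expR_gt0.
have de (t : R) : is_derive t (1 : R) e (- (2 * At t * e t)).
  apply: is_derive_eq (der_expR (derZ (- 2) (dF t))) _.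
  by rewrite /e; ring.
have ce : continuous e := cont_der de.
have cq : continuous (fun t => (e t ^+ 2)^-1).
  move=> t; apply: cvgV; first by rewrite expf_neq0// gt_eqF.
  exact: contX ce t.
have [q [q0 dq]] := exists_antiderivative cq.
have cB i : continuous (fun t => Bt t ord0 i / e t).
  move=> t; apply: cvgM; first exact: cBt.
  by apply: cvgV; [rewrite gt_eqF|exact: ce].
have /choice[E HE] : forall i, exists E : R -> R, E 0 = 0 /\
    forall t : R, is_derive t (1 : R) E (Bt t ord0 i / e t).
  by move=> i; exact: exists_antiderivative.
exists e, (fun t => \row_i - (e t * E i t)), q; split => //.
- by split => //; rewrite /e F0 mulr0 expR0.
- split; first by apply/rowP => i; rewrite !mxE (HE i).1 mulr0 oppr0.
  move=> t i; rewrite mxE.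
  rewrite (_ : (fun r => _) = fun r => - (e r * E i r)); last by apply/funext => r; rewrite mxE.
  apply: is_derive_eq (derN (derM (de t) ((HE i).2 t))) _.
  have := gt_eqF (e_gt0 t) => et.
  by field; rewrite et.
Qed.

End flow.

Section existence.
Context {R : realType} {n : nat}.
Notation V := 'rV[R]_n.
Variables (delta : R) (At : R -> R) (Bt : R -> V) (e : R -> R) (mb : R -> V) (q : R -> R).
Hypothesis cAt : continuous At.
Hypothesis cBt : forall i, continuous (fun t => Bt t ord0 i).
Hypothesis e0 : e 0 = 1.
Hypothesis e_gt0 : forall t : R, 0 < e t.
Hypothesis de : forall t : R, is_derive t (1 : R) e (- (2 * At t * e t)).
Hypothesis mb0 : mb 0 = 0.
Hypothesis dmb : forall (t : R) i, is_derive t (1 : R) (fun r => mb r ord0 i)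
  (- (2 * At t * mb t ord0 i + Bt t ord0 i)).
Hypothesis q0 : q 0 = 0.
Hypothesis dq : forall t : R, is_derive t (1 : R) q ((e t ^+ 2)^-1).

Definition flow_var (t : R) : R := delta ^+ 2 * (e t ^+ 2 * q t).

Lemma q_gt0 (t : R) : 0 < t -> 0 < q t.
Proof.
move=> t0; have [c _] := @MVT_segment R q _ 0 t (ltW t0) (fun r _ => dq r)
  (continuous_subspaceT (cont_der dq)).
rewrite q0 !subr0 => ->.
by rewrite mulr_gt0// invr_gt0 exprn_gt0.
Qed.

Lemma flow_var_ge0 (t : R) : 0 <= t -> 0 <= flow_var t.
Proof.
rewrite le_eqVlt => /predU1P[<-|t0]; first by rewrite /flow_var q0 !mulr0.
exact: (mulr_ge0 (sqr_ge0 _) (mulr_ge0 (sqr_ge0 _) (ltW (q_gt0 t0)))).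
Qed.

Lemma der_flow_var (t : R) :
  is_derive t (1 : R) flow_var (- (4 * At t * flow_var t) + delta ^+ 2).
Proof.
apply: is_derive_eq (derZ (delta ^+ 2) (derM (der_comp (derX 2 (der_id (e t))) (de t)) (dq t))) _.
rewrite /flow_var; have := gt_eqF (e_gt0 t) => et.
by field; rewrite et.
Qed.

Definition flow_law (y : V) (t : R) : probability V R :=
  gauss_law (e t *: y + mb t) (Num.sqrt (flow_var t)).

Let cV : continuous flow_var := cont_der der_flow_var.

Lemma flow_law_weak_solution (T : R) (A : R -> R) (B : R -> V) (y : V) :
  (forall t : R, 0 < t <= T -> A t = At t /\ B t = Bt t) ->
  weak_solution T delta A B y (flow_law y).
Proof.
move=> ABE phi phi_test t /andP[t0 tT].
pose m (t : R) : V := e t *: y + mb t.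
pose sg (t : R) : R := Num.sqrt (flow_var t).
(* The logarithmic derivative V' / (2 V) of the square root of V = [flow_var], by V' = - 4 At V +
   delta^2. Without noise the second term is 0 and [sg] vanishes identically, so the equations for
   [sg] still hold. *)
pose kappa (t : R) : R := - (2 * At t) + delta ^+ 2 / (2 * flow_var t).
have dm (s : R) i : is_derive s (1 : R) (fun r => m r ord0 i)
    (- (2 * At s * m s ord0 i + Bt s ord0 i)).
  rewrite (_ : (fun r => _) = fun r => y ord0 i * e r + mb r ord0 i); last first.
    by apply/funext => r; rewrite !mxE mulrC.
  apply: is_derive_eq (derD (derZ (y ord0 i) (de s)) (dmb s i)) _.
  by rewrite !mxE; ring.
have csg : continuous sg.
  by move=> s; apply: (@continuous_comp _ _ _ flow_var (@Num.sqrt R)); [exact: cV|exact: sqrt_continuous].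
have V_gt0 (s : R) : delta != 0 -> 0 < s -> 0 < flow_var s.
  move=> d0 s0; have d2 : 0 < delta ^+ 2 by rewrite exprn_even_gt0.
  exact: (mulr_gt0 d2 (mulr_gt0 (exprn_gt0 2 (e_gt0 s)) (q_gt0 s0))).
have dsg (s : R) : 0 < s -> is_derive s (1 : R) sg (kappa s * sg s).
  move=> s0; have [d0|d0] := eqVneq delta 0.
    have sg_0 : sg = cst 0.
      by apply/funext => r; rewrite /sg /flow_var d0 expr0n/= mul0r sqrtr0.
    rewrite sg_0 mulr0; exact: is_derive_cst.
  have V0 := V_gt0 s d0 s0.
  apply: is_derive_eq (der_comp (is_derive1_sqrt V0) (der_flow_var s)) _.
  rewrite -/(sg s) /kappa.
  have sgE : flow_var s = sg s ^+ 2 by rewrite sqr_sqrtr// ltW.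
  have sg0 : sg s != 0 by rewrite gt_eqF// sqrtr_gt0.
  by rewrite sgE; field; rewrite sg0.
have ckappa (s : R) : 0 < s -> {for s, continuous kappa}.
  move=> s0; rewrite /continuous_at; apply: cvgD.
    by apply: cvgN; apply: cvgM; [exact: cvg_cst|exact: cAt].
  have [d0|d0] := eqVneq delta 0.
    by rewrite d0 expr0n/= mul0r; under eq_fun do rewrite mul0r; exact: cvg_cst.
  apply: cvgM; first exact: cvg_cst.
  apply: cvgV; first by rewrite mulf_neq0// gt_eqF// V_gt0.
  by apply: cvgM; [exact: cvg_cst|exact: cV].
have kappaE (s : R) : 0 < s ->
    kappa s * sg s ^+ 2 = - (2 * At s * sg s ^+ 2) + delta ^+ 2 / 2.
  move=> s0; rewrite sqr_sqrtr ?flow_var_ge0 ?ltW// /kappa.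
  have [d0|d0] := eqVneq delta 0.
    by rewrite /flow_var d0 expr0n/=; ring.
  have V0 := gt_eqF (V_gt0 s d0 s0).
  by field; rewrite V0.
have [M phiM] := test_function_support phi_test.
have [_ _ _ _ [c0 _ _ _]] := phi_test.
have int_law (h : V -> R) (r : R) : continuous h -> (exists M, forall x, M < `|x| -> h x = 0) ->
    \int[flow_law y r]_x h x = \int[stdgauss n]_z h (m r + sg r *: z).
  move=> ch [N hN]; have [C hC] := compact_support_bounded ch hN.
  apply: Rintegral_image_law; first exact: continuous_measurable_rV.
  have mh : measurable_fun setT (fun z : V => h (m r + sg r *: z)).
    by apply: continuous_measurable_rV; exact: continuous_comp_affine.
  exact: (bounded_integrable _ mh (fun z => hC _)).
pose gd := gauss_dual delta At Bt m sg phi.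
have cgd : continuous gd by exact: gauss_dual_continuous.
have [N dN] := dual_integrand_support delta At Bt phi_test.
have dualE (s : R) : 0 < s <= t -> dual_term delta A B phi (flow_law y) s = gd s.
  move=> /andP[s0 st]; have [AE BE] := ABE s ltac:(by rewrite s0 (le_trans st tT)).
  rewrite /gd /gauss_dual -int_law; last 2 first.
  - apply: (cont_section (H := dual_integrand delta At Bt phi) (s := s)).
    exact: dual_integrand_continuous.
  - by exists N; exact: dN.
  apply: eq_Rintegral => x _; rewrite /dual_integrand; congr (_ - _ + _).
  by rewrite /grad_value AE BE.
have [intd ->] := eq_integrable_oc dualE (continuous_integrable_itv 0 t cgd).
split => //.
rewrite int_law.
- apply: gauss_weak_identity => //.
  + by rewrite /m e0 mb0 scale1r addr0.
  + by rewrite /sg /flow_var q0 !mulr0 sqrtr0.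
- exact: (cont_section (H := phi) (s := t) c0).
- by exists M => x /(phiM t)[].
Qed.

End existence.

(** * Test functions of product form *)

Section product_functions.
Context {R : realType} {n : nat}.
Notation V := 'rV[R]_n.
Implicit Types (F : 'I_n -> R -> R -> R) (f : R -> R -> R).

Definition prodf F (s : R) (x : V) : R := \prod_k F k s (x ord0 k).

(** Differentiating a product in one coordinate replaces one factor, so derivatives are again sums
    of [prodf] and their regularity reduces to that of single factors. *)
Definition upd F (i : 'I_n) f (k : 'I_n) := if k == i then f else F k.

Lemma prodf_upd F i f s (x : V) :
  prodf (upd F i f) s x = f s (x ord0 i) * \prod_(k | k != i) F k s (x ord0 k).
Proof.
rewrite /prodf (bigD1 i)//= /upd eqxx; congr (_ * _).
by apply: eq_bigr => k /negPf ->.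
Qed.

Lemma prodfD1 F i s (x : V) :
  prodf F s x = F i s (x ord0 i) * \prod_(k | k != i) F k s (x ord0 k).
Proof. by rewrite /prodf (bigD1 i). Qed.

Lemma der_prodf_coord F (i : 'I_n) f s (x : V) :
  is_derive (x ord0 i) (1 : R) (F i s) (f s (x ord0 i)) ->
  is_derive x (unitv i) (prodf F s) (prodf (upd F i f) s x).
Proof.
move=> df; apply: is_derive_of_line.
have -> : (fun r : R => prodf F s (x + r *: unitv i)) =
    fun r => (\prod_(k | k != i) F k s (x ord0 k)) * F i s (x ord0 i + r).
  apply/funext => r; rewrite (prodfD1 F i) mulrC; congr (_ * F i s _); last first.
    by rewrite !mxE !eqxx mulr1.
  by apply: eq_bigr => k /negPf ki; rewrite !mxE ki andbF mulr0 addr0.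
have dsh : is_derive (0 : R) (1 : R) (fun r => F i s (x ord0 i + r)) (f s (x ord0 i) * 1).
  apply: (der_comp (g := fun r => x ord0 i + r)); first by rewrite addr0.
  by have := derD (der_cst (x ord0 i) (0 : R)) (der_id (0 : R)); rewrite add0r.
apply: is_derive_eq (derZ _ dsh) _.
by rewrite prodf_upd mulr1 mulrC.
Qed.

Lemma der_prod (N : nat) (g : 'I_N -> R -> R) (g' : 'I_N -> R) (s : R) :
  (forall i, is_derive s (1 : R) (g i) (g' i)) ->
  is_derive s (1 : R) (fun r => \prod_i g i r)
    (\sum_i \prod_k (if k == i then g' k else g k s)).
Proof.
elim: N => [|N IH] in g g' * => dg.
  rewrite big_ord0; under eq_fun do rewrite big_ord0; exact: der_cst.
under eq_fun do rewrite big_ord_recl.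
apply: is_derive_eq (derM (dg ord0) (IH _ _ (fun i => dg (lift ord0 i)))) _.
rewrite [RHS]big_ord_recl big_ord_recl eqxx/= [LHS]addrC mulrC; congr (_ + _).
rewrite mulr_sumr; apply: eq_bigr => i _; rewrite big_ord_recl/=; congr (_ * _).
Qed.

Lemma der_prodf_time F F' s (x : V) :
  (forall k, is_derive s (1 : R) (fun r => F k r (x ord0 k)) (F' k s (x ord0 k))) ->
  is_derive s (1 : R) (fun r => prodf F r x) (\sum_i prodf (upd F i (F' i)) s x).
Proof.
move=> dF; apply: is_derive_eq (der_prod dF) _.
apply: eq_bigr => i _; rewrite prodf_upd (bigD1 i)//= eqxx; congr (_ * _).
by apply: eq_bigr => k /negPf ->.
Qed.

Lemma cont_prod (T : topologicalType) (I : finType) (G : I -> T -> R) :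
  (forall i, continuous (G i)) -> continuous (fun x => \prod_i G i x).
Proof.
move=> cG; have : forall r : seq I, continuous (fun x => \prod_(i <- r) G i x).
  elim=> [|i r IH].
    by under eq_fun do rewrite big_nil; exact: cont_cst.
  by under eq_fun do rewrite big_cons; exact: contM.
exact.
Qed.

Lemma cont_comp_coord (f : R -> R -> R) (k : 'I_n) :
  continuous (fun p : R * R => f p.1 p.2) ->
  continuous (fun p : R * V => f p.1 (p.2 ord0 k)).
Proof.
move=> cf p; apply: (@continuous_comp _ _ _ (fun p : R * V => (p.1, p.2 ord0 k))
  (fun p : R * R => f p.1 p.2)); last exact: cf.
have c2 := @cont_coord2 R n k p.
exact (cvg_pair (@cvg_fst _ _ (nbhs p.1) (nbhs p.2) _) c2).
Qed.

Lemma prodf_continuous F :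
  (forall k, continuous (fun p : R * R => F k p.1 p.2)) ->
  continuous (fun p : R * V => prodf F p.1 p.2).
Proof. by move=> cF; apply: cont_prod => k; exact: cont_comp_coord. Qed.

Lemma upd_continuous F i f :
  (forall k, continuous (fun p : R * R => F k p.1 p.2)) ->
  continuous (fun p : R * R => f p.1 p.2) ->
  forall k, continuous (fun p : R * R => upd F i f k p.1 p.2).
Proof. by move=> cF cf k; rewrite /upd; case: eqP. Qed.

(** Only n - 1 factors are bounded by K; [1 <= K] allows the exponent n. *)
Lemma prodf_bound F i f s (x : V) (C K : R) :
  `|f s (x ord0 i)| <= C -> 1 <= K -> (forall k, `|F k s (x ord0 k)| <= K) ->
  `|prodf (upd F i f) s x| <= C * K ^+ n.
Proof.
move=> fC K1 FK; rewrite prodf_upd normrM ler_pM// normr_prod.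
apply: (@le_trans _ _ (\prod_(k | k != i) K)).
  by apply: ler_prod => k _; rewrite normr_ge0 FK.
have -> : K ^+ n = \prod_(k < n) K by rewrite prodr_const card_ord.
rewrite [leRHS](bigD1 i)//= ler_peMl// prodr_ge0// => k _.
exact: le_trans ler01 K1.
Qed.

End product_functions.

Section product_test_function.
Context {R : realType} {n : nat}.
Notation V := 'rV[R]_n.
Variables (w ws wx wxx : 'I_n -> R -> R -> R) (M : R).
Hypothesis M_ge0 : 0 <= M.
Hypothesis wM : forall k s (z : R), M < `|z| -> w k s z = 0.
Hypothesis dws : forall k (s z : R), is_derive s (1 : R) (fun r => w k r z) (ws k s z).
Hypothesis dwx : forall k (s z : R), is_derive z (1 : R) (w k s) (wx k s z).
Hypothesis dwxx : forall k (s z : R), is_derive z (1 : R) (wx k s) (wxx k s z).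
Hypothesis cw : forall k, continuous (fun p : R * R => w k p.1 p.2).
Hypothesis cws : forall k, continuous (fun p : R * R => ws k p.1 p.2).
Hypothesis cwx : forall k, continuous (fun p : R * R => wx k p.1 p.2).
Hypothesis cwxx : forall k, continuous (fun p : R * R => wxx k p.1 p.2).

Let D1 s (x : V) : is_derive s (1 : R) (fun r => prodf w r x)
  (\sum_i prodf (upd w i (ws i)) s x).
Proof. by apply: der_prodf_time => k; exact: dws. Qed.

Let Dx s (x : V) i : is_derive x (unitv i) (prodf w s) (prodf (upd w i (wx i)) s x).
Proof. exact: der_prodf_coord. Qed.

Let DxE s i : 'D_(unitv i) (prodf w s) = prodf (upd w i (wx i)) s.
Proof. by apply/funext => x; have [_ <-] := Dx s x i. Qed.

Let DxEp s (x : V) i : 'D_(unitv i) (prodf w s) x = prodf (upd w i (wx i)) s x.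
Proof. by have [_ <-] := Dx s x i. Qed.

(** The factor put at j is the second derivative of factor i when j = i and the first derivative of
    factor j otherwise, so one formula covers pure and mixed derivatives. *)
Let Dxx s (x : V) i j : is_derive x (unitv j) ('D_(unitv i) (prodf w s))
  (prodf (upd (upd w i (wx i)) j (upd wx i (wxx i) j)) s x).
Proof.
rewrite DxE; apply: der_prodf_coord; rewrite /upd.
by case: eqP => [->|_]; [exact: dwxx|exact: dwx].
Qed.

Lemma prodf_test_function : test_function (prodf w).
Proof.
split.
- exists M => s x xM.
  have [k xkM] : exists k, M < `|x ord0 k|.
    apply/not_existsP => H; move: xM; rewrite ltNge => /negP; apply.
    by apply: norm_le_coord => // k; rewrite leNgt; apply/negP; exact: H.
  by rewrite (prodfD1 w k) wM// mul0r.
- by move=> s x; have [] := D1 s x.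
- by move=> s x i; have [] := Dx s x i.
- by move=> s x i j; have [] := Dxx s x i j.
split.
- exact: prodf_continuous.
- rewrite (_ : (fun p => _) = fun p : R * V => \sum_i prodf (upd w i (ws i)) p.1 p.2); last first.
    by apply/funext => p; have [_ <-] := D1 p.1 p.2.
  by apply: cont_sum => i; apply: prodf_continuous; exact: upd_continuous.
- move=> i; under eq_fun do rewrite DxEp.
  by apply: prodf_continuous; exact: upd_continuous.
- move=> i j.
  rewrite (_ : (fun p => _) = fun p : R * V =>
      prodf (upd (upd w i (wx i)) j (upd wx i (wxx i) j)) p.1 p.2); last first.
    by apply/funext => p; have [_ <-] := Dxx p.1 p.2 i j.
  apply: prodf_continuous; apply: upd_continuous; first exact: upd_continuous.
  exact: upd_continuous.
Qed.

(** The drift in coordinate i depends on x_i only and the Laplacian is a sum over coordinates, so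
    the operator acts on one factor at a time. This is what makes products of one-dimensional
    solutions work. *)
Lemma prodf_dual_integrand (delta : R) (At : R -> R) (Bt : R -> V) s (x : V) :
  dual_integrand delta At Bt (prodf w) s x =
  \sum_i prodf (upd w i (fun s z => ws i s z - (2 * At s * z + Bt s ord0 i) * wx i s z +
    delta ^+ 2 / 2 * wxx i s z)) s x.
Proof.
rewrite /dual_integrand /dotv /laplacian; have [_ ->] := D1 s x.
rewrite mulr_sumr -sumrB -big_split/=; apply: eq_bigr => i _.
have [_ ->] := Dxx s x i i; rewrite /grad [X in _ * X]mxE DxEp !mxE.
rewrite !prodf_upd /upd eqxx.
have -> : \prod_(k | k != i) (if k == i then wx i else w k) s (x ord0 k) =
    \prod_(k | k != i) w k s (x ord0 k) by apply: eq_bigr => k /negPf ->.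
by ring.
Qed.

End product_test_function.

(** * Logarithmic cutoffs *)

Section cutoff.
Context {R : realType}.

(** The cutoff is the cube of the positive part of 1 - ln(1 + z^2) / (m + 1). Rescaling a bump to
    size m would leave z c'(z) of order 1, too large for a linear drift; for the logarithm z l'(z)
    is bounded, and the division by m + 1 makes it small. The cube makes the function C^2. *)
Lemma exists_cutoff : exists (c c' c'' : nat -> R -> R) (K : R),
  [/\ 0 <= K,
      forall m (z : R), [/\ is_derive z (1 : R) (c m) (c' m z),
        is_derive z (1 : R) (c' m) (c'' m z) & 0 <= c m z <= 1],
      forall m, continuous (c'' m) /\
        exists2 M, 0 <= M & forall z, M < `|z| -> c m z = 0,
      forall m z, [/\ `|c' m z| <= K / m.+1%:R, `|z * c' m z| <= K / m.+1%:R &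
        `|c'' m z| <= K / m.+1%:R] &
      forall z, c m z @[m --> \oo] --> (1 : R)].
Proof.
pose l (z : R) : R := ln (1 + z ^+ 2).
pose l1 (z : R) : R := 2 * z / (1 + z ^+ 2).
pose l2 (z : R) : R := (2 - 2 * z ^+ 2) / (1 + z ^+ 2) ^+ 2.
have q_gt0 (z : R) : 0 < 1 + z ^+ 2 by have := sqr_ge0 z; lra.
have dq (z : R) : is_derive z (1 : R) (fun z => 1 + z ^+ 2) (2 * z).
  apply: is_derive_eq (derD (der_cst 1 z) (derX 2 (der_id z))) _.
  by rewrite expr1; ring.
have dl (z : R) : is_derive z (1 : R) l (l1 z).
  have := der_comp (g := fun z : R => 1 + z ^+ 2) (is_derive1_ln (q_gt0 z)) (dq z); move/is_derive_eq; apply.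
  by rewrite /l1 mulrC.
have dl1 (z : R) : is_derive z (1 : R) l1 (l2 z).
  have q0 := gt_eqF (q_gt0 z).
  have dV := derV (f := fun z : R => 1 + z ^+ 2) (negbT q0) (dq z).
  apply: is_derive_eq (derM (derZ 2 (der_id z)) dV) _.
  by rewrite /l2; field; rewrite q0.
have l_ge0 z : 0 <= l z by rewrite /l ln_ge0//; have := sqr_ge0 z; lra.
have l1_le z : `|l1 z| <= 1.
  rewrite /l1 normrM normfV (gtr0_norm (q_gt0 z)) ler_pdivrMr// mul1r ler_norml.
  have := sqr_ge0 (z + 1); have := sqr_ge0 (z - 1); rewrite !expr2; nra.
have zl1_le z : `|z * l1 z| <= 2.
  rewrite /l1 mulrA normrM normfV (gtr0_norm (q_gt0 z)) ler_pdivrMr// ler_norml.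
  have := sqr_ge0 z; rewrite !expr2; nra.
have l2_le z : `|l2 z| <= 2.
  rewrite /l2 normrM normfV (gtr0_norm (exprn_gt0 2 (q_gt0 z))) ler_pdivrMr ?exprn_gt0//.
  rewrite ler_norml; have := sqr_ge0 z; set a := z ^+ 2 => a0.
  by rewrite !expr2; nra.
pose p m z : R := pos (1 - l z / m.+1%:R).
have rr0 m : 0 < m.+1%:R :> R by [].
have rr1 m : 1 <= m.+1%:R :> R by rewrite ler1n.
have p01 m z : 0 <= p m z <= 1.
  rewrite /p pos_ge0/= /pos ge_max ler01/= lerBlDr lerDl divr_ge0//.
have din m (z : R) : is_derive z (1 : R) (fun z => 1 - l z / m.+1%:R) (- (l1 z / m.+1%:R)).
  rewrite (_ : (fun z => _) = fun z => 1 - m.+1%:R^-1 * l z); last first.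
    by apply/funext => y; rewrite mulrC.
  apply: is_derive_eq (derB (der_cst 1 z) (derZ _ (dl z))) _.
  by rewrite sub0r mulrC.
pose c m z := p m z ^+ 3.
pose c' m z := - (3 * p m z ^+ 2 * (l1 z / m.+1%:R)).
pose c'' m z := 6 * p m z * (l1 z / m.+1%:R) ^+ 2 - 3 * p m z ^+ 2 * (l2 z / m.+1%:R).
have dc m (z : R) : is_derive z (1 : R) (c m) (c' m z).
  apply: is_derive_eq (der_comp (g := fun z => 1 - l z / m.+1%:R)
    (der_posX 1 (1 - l z / m.+1%:R)) (din m z)) _.
  by rewrite /c' /p; ring.
have dp2 m (z : R) : is_derive z (1 : R) (fun z => p m z ^+ 2) (- (2 * p m z * (l1 z / m.+1%:R))).
  apply: is_derive_eq (der_comp (g := fun z => 1 - l z / m.+1%:R)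
    (der_posX 0 (1 - l z / m.+1%:R)) (din m z)) _.
  by rewrite /p expr1; ring.
have dc' m (z : R) : is_derive z (1 : R) (c' m) (c'' m z).
  rewrite (_ : c' m = fun z => (- (3 / m.+1%:R)) * (p m z ^+ 2 * l1 z)); last first.
    by apply/funext => y; rewrite /c'; ring.
  apply: is_derive_eq (derZ _ (derM (dp2 m z) (dl1 z))) _.
  by rewrite /c''; ring.
have cl1 : continuous l1 := cont_der dl1.
have cl2 : continuous l2.
  apply: contM.
    apply: contB; first exact: cont_cst.
    by apply: contM; [exact: cont_cst|exact: exprn_continuous].
  move=> z; apply: cvgV; first by rewrite expf_neq0// gt_eqF.
  exact: (contX (cont_der dq)).
have cp m : continuous (p m).
  move=> z; apply: (@continuous_comp _ _ _ (fun z => 1 - l z / m.+1%:R) (@pos R)).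
    exact: (cont_der (din m)).
  exact: pos_continuous.
(* With |l'| <= 1, |z l'| <= 2 and |l''| <= 2 the three bounds are 3, 6 and 6 + 3 * 2 = 12; the
   largest serves for all. *)
exists c, c', c'', 12; split => //.
- move=> m z; split; [exact: dc|exact: dc'|].
  by have /andP[p0 p1] := p01 m z; rewrite exprn_ge0//= exprn_ile1.
- move=> m; split.
    have cl1m : continuous (fun z => l1 z / m.+1%:R) by apply: contM => //; exact: cont_cst.
    have cl2m : continuous (fun z => l2 z / m.+1%:R) by apply: contM => //; exact: cont_cst.
    have c6p : continuous (fun z => 6 * p m z) by apply: contM => //; exact: cont_cst.
    have cp2 : continuous (fun z => 3 * p m z ^+ 2).
      by apply: contM; [exact: cont_cst|exact: cont_der (dp2 m)].
    apply: contB; last exact: contM.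
    by apply: contM => //; exact: contM.
  (* Beyond this radius |z| >= 1, so 1 + z^2 >= |z| > exp(m + 1) and the logarithm exceeds m + 1. *)
  exists (expR m.+1%:R); first exact: expR_ge0.
  move=> z zM; rewrite /c /p pos_eq0 ?expr0n// subr_le0 ler_pdivlMr// mul1r.
  rewrite -(expRK m.+1%:R) ler_ln ?posrE ?expR_gt0//.
  have z1 : 1 <= `|z|.
    by have := expR_ge1Dx (m.+1%:R : R); have := rr0 m; lra.
  rewrite -(@real_normK _ z) ?num_real//.
  have : `|z| <= `|z| ^+ 2 by rewrite expr2 ler_peMl.
  by move: zM; lra.
- move=> m z; have /andP[p0 p1] := p01 m z.
  have p2 : 0 <= p m z ^+ 2 <= 1 by rewrite exprn_ge0//= exprn_ile1.
  have /andP[p20 p21] := p2.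
  have ri : 0 < (m.+1%:R)^-1 :> R by rewrite invr_gt0.
  have ri1 : (m.+1%:R)^-1 <= 1 :> R by rewrite invf_le1.
  have bd (P y C : R) : 0 <= P <= 1 -> `|y| <= C -> - C <= P * y <= C.
    move=> /andP[P0 P1] yC; rewrite -ler_norml normrM (ger0_norm P0).
    by rewrite (le_trans _ yC)// ler_piMl.
  have := bd _ _ _ p2 (l1_le z); have := bd _ _ _ p2 (zl1_le z).
  have := bd _ _ _ p2 (l2_le z); have := bd _ _ _ (p01 m z) (l1_le z).
  have := l1_le z; rewrite ler_norml /c' /c''.
  set r := m.+1%:R^-1 in ri ri1 *; set P2 := p m z ^+ 2 in p2 p20 p21 *.
  set y1 := l1 z; set y2 := l2 z; set P := p m z in p0 p1 *.
  move=> /andP[a1 a2] /andP[b1 b2] /andP[c1 c2] /andP[d1 d2] /andP[f1 f2].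
  have e1 : - 1 <= P * y1 * y1 <= 1 by apply/andP; split; nra.
  split.
  + have -> : - (3 * P2 * (y1 * r)) = - (3 * (P2 * y1)) * r by ring.
    by rewrite ler_norml; apply/andP; split; nra.
  + have -> : z * - (3 * P2 * (y1 * r)) = - (3 * (P2 * (z * y1))) * r by ring.
    by rewrite ler_norml; apply/andP; split; nra.
  + have -> : 6 * P * (y1 * r) ^+ 2 - 3 * P2 * (y2 * r) =
        (6 * (P * y1 * y1) * r - 3 * (P2 * y2)) * r by ring.
    move: e1 => /andP[e1 e2].
    have g : - 12 <= 6 * (P * y1 * y1) * r - 3 * (P2 * y2) <= 12.
      by apply/andP; split; nra.
    by move: g => /andP[g1 g2]; rewrite ler_norml; apply/andP; split; nra.
- move=> z.
  have ch : {for 0, continuous (fun y : R => pos (1 - y) ^+ 3)}.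
    apply: (@continuous_comp _ _ _ (fun y : R => 1 - y) (fun y : R => pos y ^+ 3)).
      exact: (der_cont (derB (der_cst 1 0) (der_id 0))).
    exact: posX_continuous.
  have h0 : pos (1 - 0) ^+ 3 = 1 :> R by rewrite subr0 pos_id// expr1n.
  have lz0 : l z / m.+1%:R @[m --> \oo] --> (0 : R).
    rewrite -(mulr0 (l z)); apply: cvgM; first exact: cvg_cst.
    exact: cvg_harmonic.
  rewrite -h0; exact: (cvg_comp _ _ lz0 ch).
Qed.

End cutoff.

(** * Uniqueness of weak solutions *)

Section bounded_convergence.
Context {R : realType}.

Lemma cvg_norm_le (f : nat -> R) (l C : R) :
  (forall m, `|f m| <= C) -> f m @[m --> \oo] --> l -> `|l| <= C.
Proof.
move=> fC fl; have nfl : `|f m| @[m --> \oo] --> `|l| by exact: cvg_norm.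
rewrite -(cvg_lim (@Rhausdorff R) nfl); apply: limr_le.
  by apply/cvg_ex; exists `|l|.
by near=> m; exact: fC.
Unshelve. all: by end_near. Qed.

Lemma bounded_cvg_Rintegral d (T : measurableType d) (P : probability T R)
    (f_ : nat -> T -> R) (f : T -> R) (C : R) :
  (forall m, measurable_fun setT (f_ m)) -> (forall m x, `|f_ m x| <= C) ->
  (forall x, f_ m x @[m --> \oo] --> f x) ->
  \int[P]_x f_ m x @[m --> \oo] --> \int[P]_x f x.
Proof.
move=> mf_ fC cf.
have mf : measurable_fun setT f.
  by apply: (measurable_fun_cvg mf_) => x _; exact: cf.
have fb x : `|f x| <= C := cvg_norm_le (fun m => fC m x) (cf x).
have intf := bounded_integrable P mf fb.
apply: fine_cvg; rewrite fineK; last exact: integrable_fin_num.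
apply: (@dominated_cvg _ _ _ P _ measurableT (fun m x => (f_ m x)%:E) _ (cst C%:E)).
- by move=> m; exact/measurable_EFinP.
- by move=> x _; apply: cvg_EFin; [exact: nearW|exact: cf].
- by [].
- exact: finite_measure_integrable_cst.
- by move=> m x _; rewrite /= lee_fin.
Qed.

Lemma continuous_bounded_itv (f : R -> R) (a b : R) : continuous f ->
  exists2 C, 0 <= C & forall s, a <= s <= b -> `|f s| <= C.
Proof.
move=> cf; have [ab|ba] := lerP a b; last first.
  by exists 0 => // s /andP[s1 s2]; move: ba; rewrite ltNge (le_trans s1).
have cn : continuous (fun s => `|f s|).
  by move=> s; apply: (@continuous_comp _ _ _ f (fun r : R => `|r|)); [exact: cf|exact: norm_continuous].
have [c _ fc] := @EVT_max R (fun s => `|f s|) a b ab (continuous_subspaceT cn).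
by exists `|f c| => // s sab; apply: fc; rewrite in_itv.
Qed.

End bounded_convergence.

(** * Explicit solutions of the backward equation *)

Section backward.
Context {R : realType} {n : nat}.
Notation V := 'rV[R]_n.
Variables (delta : R) (At : R -> R) (Bt : R -> V) (e : R -> R).
Hypothesis cAt : continuous At.
Hypothesis cBt : forall i, continuous (fun t => Bt t ord0 i).
Hypothesis e_gt0 : forall t : R, 0 < e t.
Hypothesis de : forall t : R, is_derive t (1 : R) e (- (2 * At t * e t)).

(* The truncation g keeps the variance positive after time t, where it plays
   no role but the test function must still be defined. *)
Lemma exists_backward_coefficients (t eps : R) : 0 < eps ->
  exists (r : R -> R) (k : 'I_n -> R -> R) (sg kap : R -> R),
  [/\ forall s : R, is_derive s (1 : R) r (2 * At s * r s),
      forall i (s : R), is_derive s (1 : R) (k i) (r s * Bt s ord0 i),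
      (forall s : R, is_derive s (1 : R) sg (kap s * sg s)) /\ continuous kap,
      [/\ r t = 1, forall i, k i t = 0 & sg t = (Num.sqrt eps)^-1] &
      forall s, s <= t -> kap s = delta ^+ 2 / 2 * (r s * sg s) ^+ 2].
Proof.
move=> eps0; pose r (s : R) : R := e t * (e s)^-1.
have dr (s : R) : is_derive s (1 : R) r (2 * At s * r s).
  have es := gt_eqF (e_gt0 s).
  apply: is_derive_eq (derZ (e t) (derV (negbT es) (de s))) _.
  by rewrite /r; field; rewrite es.
have cr : continuous r := cont_der dr.
have /choice[k0 k0E] : forall i, exists k : R -> R, k 0 = 0 /\
    forall s : R, is_derive s (1 : R) k (r s * Bt s ord0 i).
  by move=> i; apply: exists_antiderivative; exact: contM.
have cr2 : continuous (fun s => r s ^+ 2) by exact: contX.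
have [J [_ dJ]] := exists_antiderivative cr2.
(* For s <= t this is eps plus the conditional variance, delta^2 times the integral of r^2 over
   [s, t], of the process at time t given its position at time s. *)
pose I0 (s : R) : R := eps + delta ^+ 2 * (J t - J s).
have dI0 (s : R) : is_derive s (1 : R) I0 (- (delta ^+ 2 * r s ^+ 2)).
  apply: is_derive_eq (derD (der_cst eps s) (derZ (delta ^+ 2) (derB (der_cst (J t) s) (dJ s)))) _.
  by ring.
(* Equal to eps / 2 for v <= 0, to eps / 2 + v^2 / (2 eps) on [0, eps] and to v from eps on: a
   positive C^1 function, the identity on the values that [I0] takes up to time t. *)
pose g (v : R) : R := eps / 2 + (2 * eps)^-1 * (pos v ^+ 2 - pos (v - eps) ^+ 2).
pose g' (v : R) : R := eps^-1 * (pos v - pos (v - eps)).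
have pos_le (v : R) : pos (v - eps) <= pos v.
  by rewrite /pos ge_max le_max lexx/= le_max lerBlDr; apply/orP; right; lra.
have dg (v : R) : is_derive v (1 : R) g (g' v).
  have d1 : is_derive v (1 : R) (fun z => pos (z - eps) ^+ 2) (2 * pos (v - eps) ^+ 1 * (1 - 0)).
    exact: (der_comp (g := fun z => z - eps) (der_posX 0 (v - eps))
      (derB (der_id v) (der_cst eps v))).
  apply: is_derive_eq (derD (der_cst (eps / 2) v) (derZ (2 * eps)^-1 (derB (der_posX 0 v) d1))) _.
  by rewrite /g' !expr1; field; rewrite gt_eqF.
have cg' : continuous g'.
  apply: contM; first exact: cont_cst.
  apply: contB; first exact: pos_continuous.
  move=> v; apply: (@continuous_comp _ _ _ (fun z : R => z - eps) (@pos R)).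
    exact: (der_cont (derB (der_id v) (der_cst eps v))).
  exact: pos_continuous.
have g_gt0 v : 0 < g v.
  have h : 0 <= pos v ^+ 2 - pos (v - eps) ^+ 2.
    by rewrite subr_ge0 lerXn2r// nnegrE pos_ge0.
  have : 0 <= (2 * eps)^-1 * (pos v ^+ 2 - pos (v - eps) ^+ 2).
    by rewrite mulr_ge0// invr_ge0 mulr_ge0// ltW.
  by rewrite /g; lra.
have gE v : eps <= v -> g v = v /\ g' v = 1.
  move=> ev; have v0 : 0 <= v by lra.
  have ve0 : 0 <= v - eps by lra.
  rewrite /g /g' (pos_id v0) (pos_id ve0).
  by split; field; rewrite gt_eqF.
pose Sig (s : R) : R := g (I0 s).
have dSig (s : R) : is_derive s (1 : R) Sig (g' (I0 s) * - (delta ^+ 2 * r s ^+ 2)).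
  exact: (der_comp (g := I0) (dg (I0 s)) (dI0 s)).
pose sg (s : R) : R := (Num.sqrt (Sig s))^-1.
pose kap (s : R) : R := g' (I0 s) * (delta ^+ 2 * r s ^+ 2) / (2 * Sig s).
have Sig0 s : 0 < Sig s by exact: g_gt0.
have dsg (s : R) : is_derive s (1 : R) sg (kap s * sg s).
  have q0 : Num.sqrt (Sig s) != 0 by rewrite gt_eqF// sqrtr_gt0.
  have dq := der_comp (g := Sig) (is_derive1_sqrt (Sig0 s)) (dSig s).
  apply: is_derive_eq (derV (f := fun s => Num.sqrt (Sig s)) q0 dq) _.
  rewrite /kap /sg; have -> : Sig s = Num.sqrt (Sig s) ^+ 2 by rewrite sqr_sqrtr// ltW.
  rewrite sqrtr_sqr ger0_norm ?sqrtr_ge0//.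
  by field; rewrite q0.
have J_nd : {homo J : x y / x <= y}.
  by apply: (der_nondecreasing dJ) => s; exact: sqr_ge0.
exists r, (fun i s => k0 i s - k0 i t), sg, kap; split => //.
- move=> i s; apply: is_derive_eq (derB ((k0E i).2 s) (der_cst (k0 i t) s)) _.
  by rewrite subr0.
- split => //; move=> s; apply: cvgM.
    apply: cvgM.
      by apply: (@continuous_comp _ _ _ I0 g'); [exact: (cont_der dI0)|exact: cg'].
    by apply: cvgM; [exact: cvg_cst|exact: cr2].
  apply: cvgV; first by rewrite mulf_neq0// gt_eqF.
  by apply: cvgM; [exact: cvg_cst|exact: (cont_der dSig)].
- split.
  + by rewrite /r divff// gt_eqF.
  + by move=> i; rewrite subrr.
  + by rewrite /sg /Sig /I0 subrr mulr0 addr0 (gE _ (lexx _)).1.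
move=> s st; have eI : eps <= I0 s.
  by rewrite /I0 lerDl mulr_ge0 ?sqr_ge0// subr_ge0 J_nd.
have SE : Sig s = I0 s := (gE _ eI).1.
have sg2 : sg s ^+ 2 = (I0 s)^-1.
  by rewrite /sg exprVn SE sqr_sqrtr// -SE ltW.
rewrite /kap [(r s * sg s) ^+ 2]exprMn sg2 SE (gE _ eI).2.
have I0n : I0 s != 0 by rewrite gt_eqF// (lt_le_trans eps0).
by field; rewrite I0n.
Qed.

End backward.

Section test_functions.
Context {R : realType} {n : nat}.
Notation V := 'rV[R]_n.
Variables (delta : R) (At : R -> R) (Bt : R -> V).
Variables (Phi : R -> R) (L : R).
Hypothesis cAt : continuous At.
Hypothesis cBt : forall i, continuous (fun t => Bt t ord0 i).
Hypothesis L_gt0 : 0 < L.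
Hypothesis dPhi : forall u : R, is_derive u (1 : R) Phi (expR (- u ^+ 2 / 2)).
Hypothesis Phi_bd : forall u, 0 <= Phi u <= L.
Variables (r : R -> R) (k : 'I_n -> R -> R) (sg kap : R -> R).
Hypothesis dr : forall s : R, is_derive s (1 : R) r (2 * At s * r s).
Hypothesis dk : forall i (s : R), is_derive s (1 : R) (k i) (r s * Bt s ord0 i).
Hypothesis dsg : forall s : R, is_derive s (1 : R) sg (kap s * sg s).
Hypothesis ckap : continuous kap.
Variable b : V.

(** Here [r s * z + k i s] is the mean position at time t of coordinate i started from z at time s,
    and [sg] is the inverse of a standard deviation. So Phi of this argument is the unnormalised
    probability of ending below b_i, after blurring by variance eps. Transport cancels by the
    equations of r and k, diffusion by that of sg since Phi'' = - u Phi'. *)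
Definition backward_arg (i : 'I_n) (s z : R) : R := (b ord0 i - r s * z - k i s) * sg s.

Local Notation u := backward_arg.
Let rho (y : R) : R := expR (- y ^+ 2 / 2).
Let ux (s : R) : R := - (r s * sg s).
Let us (i : 'I_n) (s z : R) : R := - (r s * sg s) * (2 * At s * z + Bt s ord0 i) + kap s * u i s z.

Let du_s i (s z : R) : is_derive s (1 : R) (fun r => u i r z) (us i s z).
Proof.
have dd := derB (derB (der_cst (b ord0 i) s) (derM (dr s) (der_cst z s))) (dk i s).
by apply: is_derive_eq (derM dd (dsg s)) _; rewrite /us /u; ring.
Qed.

Let du_x i (s z : R) : is_derive z (1 : R) (u i s) (ux s).
Proof.
have dd := derB (derB (der_cst (b ord0 i) z) (derZ (r s) (der_id z))) (der_cst (k i s) z).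
by apply: is_derive_eq (derM dd (der_cst (sg s) z)) _; rewrite /ux; ring.
Qed.

Let drho (y : R) : is_derive y (1 : R) rho (- (y * rho y)).
Proof. exact: der_gauss. Qed.

Variables (c c' c'' : R -> R) (K M : R).
Hypothesis dc : forall z : R, is_derive z (1 : R) c (c' z).
Hypothesis dc' : forall z : R, is_derive z (1 : R) c' (c'' z).
Hypothesis cc'' : continuous c''.
Hypothesis c_bd : forall z, 0 <= c z <= 1.
Hypothesis M_ge0 : 0 <= M.
Hypothesis cM : forall z, M < `|z| -> c z = 0.
Hypothesis c'_bd : forall z, `|c' z| <= K.
Hypothesis zc'_bd : forall z, `|z * c' z| <= K.
Hypothesis c''_bd : forall z, `|c'' z| <= K.

Definition cut_solution (i : 'I_n) (s z : R) : R := c z * Phi (u i s z).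

Local Notation w := cut_solution.
Let ws i s z := c z * (rho (u i s z) * us i s z).
Let wx i s z := c' z * Phi (u i s z) + c z * (rho (u i s z) * ux s).
Let wxx i s z := c'' z * Phi (u i s z) + 2 * (c' z * (rho (u i s z) * ux s)) -
  c z * (u i s z * rho (u i s z) * ux s ^+ 2).

Let dws i (s z : R) : is_derive s (1 : R) (fun r => w i r z) (ws i s z).
Proof. exact: (derZ (c z) (der_comp (g := fun r => u i r z) (dPhi _) (du_s i s z))). Qed.

Let dPu i (s z : R) : is_derive z (1 : R) (fun z => Phi (u i s z)) (rho (u i s z) * ux s).
Proof. exact: (der_comp (g := u i s) (dPhi _) (du_x i s z)). Qed.

Let dwx i (s z : R) : is_derive z (1 : R) (w i s) (wx i s z).
Proof.
by apply: is_derive_eq (derM (dc z) (dPu i s z)) _; rewrite /wx; ring.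
Qed.

Let dwxx i (s z : R) : is_derive z (1 : R) (wx i s) (wxx i s z).
Proof.
have dr2 := derM (der_comp (g := u i s) (drho _) (du_x i s z)) (der_cst (ux s) z).
apply: is_derive_eq (derD (derM (dc' z) (dPu i s z)) (derM (dc z) dr2)) _.
by rewrite /wxx; ring.
Qed.

Notation P2 f := (fun p : R * R => f p.1 p.2).

Let cont1 (f : R -> R) : continuous f -> continuous (fun p : R * R => f p.1).
Proof. by move=> cf p; apply: (@continuous_comp _ _ _ fst f); [exact: cvg_fst|exact: cf]. Qed.

Let cont2 (f : R -> R) : continuous f -> continuous (fun p : R * R => f p.2).
Proof. by move=> cf p; apply: (@continuous_comp _ _ _ snd f); [exact: cvg_snd|exact: cf]. Qed.

Let cid : continuous (fun z : R => z).
Proof. by move=> z; exact: cvg_id. Qed.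

Let cu i : continuous (P2 (u i)).
Proof.
apply: contM; last exact: (cont1 (cont_der dsg)).
apply: contB; last exact: (cont1 (cont_der (dk i))).
apply: contB; first exact: cont_cst.
by apply: contM; [exact: (cont1 (cont_der dr))|exact: (cont2 cid)].
Qed.

Let cPu i : continuous (fun p : R * R => Phi (u i p.1 p.2)).
Proof. move=> p; apply: (@continuous_comp _ _ _ (P2 (u i)) Phi); [exact: cu|exact: (cont_der dPhi)]. Qed.

Let crho i : continuous (fun p : R * R => rho (u i p.1 p.2)).
Proof. move=> p; apply: (@continuous_comp _ _ _ (P2 (u i)) rho); [exact: cu|exact: (cont_der drho)]. Qed.

Let cux : continuous (fun p : R * R => ux p.1).
Proof.
apply: cont1 => s; apply: cvgN.
by apply: cvgM; [exact: (cont_der dr)|exact: (cont_der dsg)].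
Qed.

Let cus i : continuous (P2 (us i)).
Proof.
apply: contD; last by apply: contM; [exact: cont1|exact: cu].
apply: contM; first exact: cux.
apply: contD; last exact: (cont1 (@cBt i)).
apply: contM; last exact: (cont2 cid).
by apply: contM; [exact: cont_cst|exact: cont1].
Qed.

Let cc : continuous (fun p : R * R => c p.2).
Proof. exact: (cont2 (cont_der dc)). Qed.

Let cc' : continuous (fun p : R * R => c' p.2).
Proof. exact: (cont2 (cont_der dc')). Qed.

Let cw i : continuous (P2 (w i)).
Proof. by apply: contM => //; exact: cPu. Qed.

Let cws i : continuous (P2 (ws i)).
Proof. by apply: contM => //; apply: contM; [exact: crho|exact: cus]. Qed.

Let cwx i : continuous (P2 (wx i)).
Proof.
apply: contD; first by apply: contM => //; exact: cPu.
by apply: contM => //; apply: contM => //; exact: crho.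
Qed.

Let cwxx i : continuous (P2 (wxx i)).
Proof.
apply: contB; last first.
  apply: contM => //; apply: contM.
    by apply: contM; [exact: cu|exact: crho].
  exact: contX.
apply: contD; first by apply: contM; [exact: cont2|exact: cPu].
apply: contM; first exact: cont_cst.
by apply: contM => //; apply: contM => //; exact: crho.
Qed.

Let wM i (s z : R) : M < `|z| -> w i s z = 0.
Proof. by move=> zM; rewrite /w cM// mul0r. Qed.

Lemma cut_solution_test : test_function (prodf w).
Proof. exact: (prodf_test_function M_ge0 wM dws dwx dwxx cw cws cwx cwxx). Qed.

Lemma cut_solution_bound i s z : 0 <= w i s z <= L.
Proof.
have /andP[c0 c1] := c_bd z; have /andP[P0 P1] := Phi_bd (u i s z).
rewrite mulr_ge0//=; apply: le_trans P1; exact: ler_piMl.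
Qed.

(** As Phi of [backward_arg] solves the backward equation, the terms with an undifferentiated cutoff
    cancel in each factor. What remains carries c', z c' or c'', whence a bound linear in K. *)
Lemma cut_solution_dual_bound (a beta gam s : R) (x : V) :
  `|At s| <= a -> (forall i, `|Bt s ord0 i| <= beta) -> `|r s * sg s| <= gam ->
  kap s = delta ^+ 2 / 2 * (r s * sg s) ^+ 2 ->
  `|dual_integrand delta At Bt (prodf w) s x| <=
  n%:R * ((L * (2 * a + beta + delta ^+ 2 / 2) + delta ^+ 2 * gam) * K * (L + 1) ^+ n).
Proof.
move=> Aa Bb rg kapE.
rewrite (prodf_dual_integrand dws dwx dwxx).
apply: le_trans (ler_norm_sum _ _ _) _.
set C := (X in n%:R * X).
have -> : n%:R * C = \sum_(i < n) C by rewrite sumr_const card_ord mulr_natl.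
apply: ler_sum => i _; apply: prodf_bound; last 2 first.
- by have := L_gt0; lra.
- move=> j; have /andP[w0 w1] := cut_solution_bound j s (x ord0 j).
  by rewrite ger0_norm// (le_trans w1)// lerDl.
set z := x ord0 i.
have -> : ws i s z - (2 * At s * z + Bt s ord0 i) * wx i s z + delta ^+ 2 / 2 * wxx i s z =
    Phi (u i s z) * (- (2 * (At s * (z * c' z))) - Bt s ord0 i * c' z + delta ^+ 2 / 2 * c'' z)
    + delta ^+ 2 * (c' z * (rho (u i s z) * ux s)).
  by rewrite /ws /wx /wxx /us kapE /ux; field.
have /andP[P0 P1] := Phi_bd (u i s z).
have K0 : 0 <= K := le_trans (normr_ge0 _) (c'_bd 0).
have d20 : 0 <= delta ^+ 2 by exact: sqr_ge0.
have rho_bd y : `|rho y| <= 1.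
  rewrite ger0_norm ?expR_ge0// -expR0 ler_expR; have := sqr_ge0 y; rewrite mulNr; lra.
rewrite [leRHS]mulrDl; apply: le_trans (ler_normD _ _) _; apply: lerD.
  rewrite normrM (ger0_norm P0) -[leRHS]mulrA; apply: ler_pM => //.
  rewrite (mulrDl (2 * a + beta)) (mulrDl (2 * a)).
  apply: le_trans (ler_normD _ _) _; apply: lerD.
    apply: le_trans (ler_normB _ _) _; rewrite normrN; apply: lerD.
      rewrite normrM ger0_norm// -[leRHS]mulrA ler_wpM2l//.
      by rewrite normrM; apply: ler_pM.
    by rewrite normrM; apply: ler_pM.
  by rewrite normrM ger0_norm ?divr_ge0//; apply: ler_wpM2l; rewrite ?divr_ge0.
rewrite normrM (ger0_norm d20) -[leRHS]mulrA; apply: ler_wpM2l => //.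
rewrite normrM [leRHS]mulrC; apply: ler_pM => //.
rewrite normrM -[leRHS]mul1r; apply: ler_pM => //.
by rewrite normrN.
Qed.

End test_functions.

Section bounds.
Context {R : realType}.
Notation mu := (@lebesgue_measure R).

Lemma cvg_unique_seq (f : nat -> R) (a b : R) :
  f m @[m --> \oo] --> a -> f m @[m --> \oo] --> b -> a = b.
Proof.
by move=> fa fb; rewrite -(cvg_lim (@Rhausdorff R) fa) -(cvg_lim (@Rhausdorff R) fb).
Qed.

Lemma cvg_prod_seq (I : finType) (f : nat -> I -> R) (l : I -> R) :
  (forall i, f m i @[m --> \oo] --> l i) ->
  \prod_i f m i @[m --> \oo] --> \prod_i l i.
Proof.
move=> fl; have : forall r : seq I,
    \prod_(i <- r) f m i @[m --> \oo] --> \prod_(i <- r) l i.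
  elim=> [|i r IH].
    by rewrite big_nil; under eq_fun do rewrite big_nil; exact: cvg_cst.
  by rewrite big_cons; under eq_fun do rewrite big_cons; exact: cvgM.
exact.
Qed.

Lemma normr_prod_le (I : finType) (f : I -> R) (L : R) :
  (forall i, `|f i| <= L) -> `|\prod_i f i| <= L ^+ #|I|.
Proof.
move=> fL; rewrite normr_prod -prodr_const; apply: ler_prod => i _.
by rewrite normr_ge0 fL.
Qed.

Lemma normr_Rintegral_prob d (T : measurableType d) (P : probability T R) (f : T -> R) (C : R) :
  measurable_fun setT f -> (forall x, `|f x| <= C) -> `|\int[P]_x f x| <= C.
Proof.
move=> mf fC; have intf := bounded_integrable P mf fC.
apply: le_trans (le_normr_Rintegral measurableT intf) _.
have intC : P.-integrable setT (EFin \o (fun _ : T => C)).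
  exact: finite_measure_integrable_cst.
apply: (@le_trans _ _ (\int[P]_x C)).
  by apply: le_Rintegral => //; exact: (integrable_norm intf).
by rewrite Rintegral_cst//= probability_setT mulr1.
Qed.

Lemma normr_Rintegral_itv (f : R -> R) (t C : R) : 0 <= t ->
  mu.-integrable `[0, t] (EFin \o f) ->
  (forall s, 0 <= s <= t -> `|f s| <= C) ->
  `|\int[mu]_(s in `[0, t]) f s| <= C * t.
Proof.
move=> t0 intf fC.
apply: le_trans (le_normr_Rintegral _ intf) _ => //.
have intC : mu.-integrable `[0, t] (EFin \o (fun _ : R => C)).
  by apply: continuous_integrable_itv; move=> x; exact: cvg_cst.
apply: (@le_trans _ _ (\int[mu]_(s in `[0, t]) C)).
  have fC' (s : R) : [set` `[0, t]] s -> `|f s| <= C by rewrite /= in_itv/=; exact: fC.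
  by apply: le_Rintegral => //; exact: (integrable_norm intf).
have dC (s : R) : is_derive s (1 : R) (fun z => C * z) C.
  by apply: is_derive_eq (derZ C (der_id s)) _; rewrite mulr1.
by rewrite (Rintegral_antiderivative t0 (@cont_cst _ _ C) (mulr0 C) dC).
Qed.

End bounds.

Section uniqueness.
Context {R : realType} {n : nat}.
Notation V := 'rV[R]_n.
Notation leb := (@lebesgue_measure R).
Variables (delta : R) (At : R -> R) (Bt : R -> V) (e : R -> R).
Hypothesis cAt : continuous At.
Hypothesis cBt : forall i, continuous (fun t => Bt t ord0 i).
Hypothesis e_gt0 : forall t : R, 0 < e t.
Hypothesis de : forall t : R, is_derive t (1 : R) e (- (2 * At t * e t)).
Variables (T : R) (A : R -> R) (B : R -> V) (y : V).
Hypothesis ABE : forall t : R, 0 < t <= T -> A t = At t /\ B t = Bt t.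
Variables (Phi : R -> R) (L : R).
Hypothesis L_gt0 : 0 < L.
Hypothesis dPhi : forall u : R, is_derive u (1 : R) Phi (expR (- u ^+ 2 / 2)).
Hypothesis Phi_bd : forall u, 0 <= Phi u <= L.

Lemma dual_term_bound (mu : R -> probability V R) (phi : R -> V -> R) (t C : R) :
  0 <= t <= T -> test_function phi ->
  leb.-integrable `[0, t] (fun s => (dual_term delta A B phi mu s)%:E) ->
  (forall s x, 0 <= s <= t -> `|dual_integrand delta At Bt phi s x| <= C) ->
  `|\int[leb]_(s in `[0, t]) dual_term delta A B phi mu s| <= C * t.
Proof.
move=> /andP[t0 tT] phi_test intd dC.
pose g s := \int[mu s]_x dual_integrand delta At Bt phi s x.
have gE s : 0 < s <= t -> g s = dual_term delta A B phi mu s.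
  move=> /andP[s0 st]; have [AE BE] := ABE (t := s) ltac:(by rewrite s0 (le_trans st tT)).
  by apply: eq_Rintegral => x _; rewrite /dual_integrand /grad_value AE BE.
have [intg <-] := eq_integrable_oc gE intd.
apply: normr_Rintegral_itv => // s st; apply: normr_Rintegral_prob => [|x]; last exact: dC.
apply: continuous_measurable_rV.
apply: (cont_section (H := dual_integrand delta At Bt phi) (s := s)).
exact: dual_integrand_continuous.
Qed.

(** The constant is the backward solution at (0, y), obtained by testing with cut-off copies and
    removing the cutoff. It is chosen before the weak solution, so two solutions can be compared
    without evaluating it. *)
Lemma weak_solution_smoothed (t eps : R) (b : V) : 0 <= t <= T -> 0 < eps ->
  exists C, forall mu : R -> probability V R, weak_solution T delta A B y mu ->
    \int[mu t]_x \prod_i Phi ((b ord0 i - x ord0 i) / Num.sqrt eps) = C.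
Proof.
move=> t0T eps0; have /andP[t0 tT] := t0T.
have [r [k [sg [kap [dr dk [dsg ckap] [rt kt sgt] kapE]]]]] :=
  exists_backward_coefficients delta cBt e_gt0 de t eps0.
have [c [c' [c'' [K [K0 dc cc'' c_bd c_cvg]]]]] := @exists_cutoff R.
pose U (s : R) (x : V) := \prod_i Phi (backward_arg r k sg b i s (x ord0 i)).
exists (U 0 y) => mu mu_sol.
pose phi (m : nat) : R -> V -> R := prodf (cut_solution Phi r k sg b (c m)).
have [a a0 Aa] := continuous_bounded_itv 0 t cAt.
have cBs : continuous (fun s => \sum_i `|Bt s ord0 i|).
  apply: cont_sum => i s.
  by apply: (@continuous_comp _ _ _ (fun t => Bt t ord0 i) (fun z : R => `|z|));
    [exact: cBt|exact: norm_continuous].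
have [beta beta0 Bb] := continuous_bounded_itv 0 t cBs.
have {}Bb s i : 0 <= s <= t -> `|Bt s ord0 i| <= beta.
  have S0 : 0 <= \sum_j `|Bt s ord0 j| by apply: sumr_ge0.
  move=> /Bb; apply: le_trans; rewrite (ger0_norm S0) (bigD1 i)//= lerDl.
  exact: sumr_ge0.
have crs : continuous (fun s => r s * sg s) by apply: contM; [exact: cont_der dr|exact: cont_der dsg].
have [gam gam0 rg] := continuous_bounded_itv 0 t crs.
(* The bound of [cut_solution_dual_bound] with constant K, times t. The m-th cutoff has K / (m + 1)
   in place of K, so the error is D / (m + 1). *)
pose D := n%:R * ((L * (2 * a + beta + delta ^+ 2 / 2) + delta ^+ 2 * gam) * K * (L + 1) ^+ n) * t.
have phi_test m : test_function (phi m).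
  have [cc [M M0 cM]] := cc'' m.
  apply: (@cut_solution_test _ _ At Bt Phi cAt cBt dPhi r k sg kap dr dk dsg ckap b
    (c m) (c' m) (c'' m) M _ _ cc M0 cM) => z; by have [] := dc m z.
have cm01 m z : 0 <= c m z <= 1 by have [] := dc m z.
have diff m : `|\int[mu t]_x phi m t x - phi m 0 y| <= D * m.+1%:R^-1.
  have [intd ->] := mu_sol (phi m) (phi_test m) t t0T.
  rewrite [X in X - _]addrC addrK.
  have DE : D * m.+1%:R^-1 = n%:R * ((L * (2 * a + beta + delta ^+ 2 / 2) + delta ^+ 2 * gam) *
     (K / m.+1%:R) * (L + 1) ^+ n) * t by rewrite /D; ring.
  rewrite DE; apply: dual_term_bound => // s x s0t; have /andP[s0 st] := s0t.
  have [cc [M M0 cM]] := cc'' m.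
  apply: (@cut_solution_dual_bound _ _ delta At Bt Phi L L_gt0 dPhi Phi_bd r k sg kap dr dk dsg b
    (c m) (c' m) (c'' m) (K / m.+1%:R)).
  - by move=> z; have [] := dc m z.
  - by move=> z; have [] := dc m z.
  - exact: cm01.
  - by move=> z; have [] := c_bd m z.
  - by move=> z; have [] := c_bd m z.
  - by move=> z; have [] := c_bd m z.
  - exact: Aa.
  - by move=> i; exact: Bb.
  - exact: rg.
  - exact: kapE.
have phi_cvg s x : phi m s x @[m --> \oo] --> U s x.
  apply: cvg_prod_seq => i; rewrite -[X in _ --> X]mul1r.
  by apply: cvgM; [exact: c_cvg|exact: cvg_cst].
have int_cvg : \int[mu t]_x phi m t x @[m --> \oo] --> \int[mu t]_x U t x.
  apply: (@bounded_cvg_Rintegral _ _ _ (mu t) (fun m => phi m t) (U t) (L ^+ #|'I_n|)).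
  - move=> m; have [_ _ _ _ [c0 _ _ _]] := phi_test m.
    by apply: continuous_measurable_rV; exact: (cont_section (H := phi m) (s := t) c0).
  - move=> m x; apply: normr_prod_le => i.
    have /andP[w0 w1] := cut_solution_bound Phi_bd r k sg b (cm01 m) i t (x ord0 i).
    by rewrite ger0_norm.
  - exact: phi_cvg.
have diff_cvg : (\int[mu t]_x phi m t x - phi m 0 y) @[m --> \oo] --> \int[mu t]_x U t x - U 0 y.
  by apply: cvgB; [exact: int_cvg|exact: phi_cvg].
have diff0 : (\int[mu t]_x phi m t x - phi m 0 y) @[m --> \oo] --> (0 : R).
  apply: norm_cvg0.
  have ub : D * m.+1%:R^-1 @[m --> \oo] --> (0 : R).
    by rewrite -(mulr0 D); apply: cvgM; [exact: cvg_cst|exact: cvg_harmonic].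
  apply: (squeeze_cvgr _ (cvg_cst 0) ub).
  by near=> m; rewrite normr_ge0 diff.
have := cvg_unique_seq diff_cvg diff0; move/subr0_eq => <-.
apply: eq_Rintegral => x _; apply: eq_bigr => i _; congr Phi.
by rewrite /backward_arg rt kt sgt mul1r subr0.
Unshelve. all: by end_near. Qed.

Hypothesis Phi_ninfty : Phi x @[x --> -oo] --> 0.
Hypothesis Phi_pinfty : Phi x @[x --> +oo] --> L.

Let step (z : R) : R := if (0 <= z)%R then L else 0.

(** The shift h = 1 / (m + 1) dominates the width h^2, the square root of eps = h^4. At z = 0 the
    argument is 1 / h and tends to +oo, so the limit is the step of a closed half-line, without a
    middle value at the jump. *)
Let smooth_cvg (z : R) :
  Phi ((z + m.+1%:R^-1) / Num.sqrt ((m.+1%:R^-1) ^+ 4)) @[m --> \oo] --> step z.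
Proof.
have argE m : (z + m.+1%:R^-1) / Num.sqrt ((m.+1%:R^-1) ^+ 4) =
    m.+1%:R * (z * m.+1%:R + 1) :> R.
  have -> : (m.+1%:R^-1 : R) ^+ 4 = ((m.+1%:R^-1) ^+ 2) ^+ 2 by rewrite -exprM.
  rewrite sqrtr_sqr ger0_norm ?exprn_ge0 ?invr_ge0//.
  by field; rewrite addrC natr1 pnatr_eq0.
under eq_fun do rewrite argE.
rewrite /step; case: lerP => z0.
  apply: (cvg_comp _ _ _ Phi_pinfty); apply/cvgryPge => a.
  near=> m; have m1 : 1 <= m.+1%:R :> R by rewrite ler1n.
  have am : a <= m%:R by near: m; exact: nbhs_infty_ger.
  have : 0 <= z * m.+1%:R by rewrite mulr_ge0.
  have : m%:R <= m.+1%:R :> R by rewrite ler_nat.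
  by nra.
apply: (cvg_comp _ _ _ Phi_ninfty); apply/cvgrNyPle => a.
near=> m; have m1 : 1 <= m.+1%:R :> R by rewrite ler1n.
have am : (1 + `|a|) / (- z) <= m%:R by near: m; exact: nbhs_infty_ger.
move: am; rewrite ler_pdivrMr ?oppr_gt0// => am.
have mm : m%:R <= m.+1%:R :> R by rewrite ler_nat.
have aa : - `|a| <= a by rewrite lerNl -normrN ler_norm.
have a0 := normr_ge0 a.
have : z * m.+1%:R + 1 <= - `|a| by nra.
by nra.
Unshelve. all: by end_near. Qed.

Let orthant_integral (P : probability V R) (b : V) :
  \int[P]_x \prod_i step (b ord0 i - x ord0 i) =
  L ^+ n * fine (P [set x : V | forall i, x ord0 i <= b ord0 i]).
Proof.
set S : set V := (X in P X); have mS : measurable S := measurable_orthant b.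
have -> : \int[P]_x \prod_i step (b ord0 i - x ord0 i) = \int[P]_x (L ^+ n * \1_S x).
  apply: eq_Rintegral => x _; rewrite indicE; case: (boolP (x \in S)) => xS.
    rewrite mulr1 -[in RHS](card_ord n) -prodr_const; apply: eq_bigr => i _.
    by have /set_mem/(_ i) := xS; rewrite /step subr_ge0 => ->.
  have /existsNP[i xi] : ~ S x by move=> /mem_set xS'; move: xS; rewrite xS'.
  rewrite mulr0 (bigD1 i)//= /step subr_ge0.
  by move/negP/negPf : xi => ->; rewrite mul0r.
rewrite RintegralZl//; last first.
  have mi : measurable_fun setT (\1_S : V -> R) by exact: measurable_indic.
  apply: (@bounded_integrable _ _ _ P _ 1 mi) => x.
  by rewrite indicE; case: (_ \in _); rewrite ?normr1 ?normr0.
by congr (_ * fine _); rewrite integral_indic// setIT.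
Qed.

Lemma weak_solution_unique (mu nu : R -> probability V R) :
  weak_solution T delta A B y mu -> weak_solution T delta A B y nu ->
  forall t, 0 <= t <= T -> forall S, measurable S -> mu t S = nu t S.
Proof.
move=> mu_sol nu_sol t t0T; apply: orthant_measure_unique => b.
pose h (m : nat) : R := m.+1%:R^-1.
have h0 m : 0 < h m by rewrite invr_gt0.
pose F m (x : V) := \prod_i Phi ((b ord0 i - x ord0 i + h m) / Num.sqrt (h m ^+ 4)).
have cvgF (P : probability V R) : \int[P]_x F m x @[m --> \oo] -->
    L ^+ n * fine (P [set x : V | forall i, x ord0 i <= b ord0 i]).
  rewrite -orthant_integral.
  apply: (@bounded_cvg_Rintegral _ _ _ P F _ (L ^+ #|'I_n|)).
  - move=> m; apply: continuous_measurable_rV; apply: cont_prod => i z.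
    apply: (@continuous_comp _ _ _ (fun x : V => x ord0 i)
      (fun r : R => Phi ((b ord0 i - r + h m) / Num.sqrt (h m ^+ 4)))).
      exact: (@coord_continuous R 1 n ord0 i).
    have d1 := derM (derD (derB (der_cst (b ord0 i) (z ord0 i)) (der_id (z ord0 i)))
      (der_cst (h m) (z ord0 i))) (der_cst (Num.sqrt (h m ^+ 4))^-1 (z ord0 i)).
    exact: (der_cont (der_comp (g := fun r : R => (b ord0 i - r + h m) / Num.sqrt (h m ^+ 4)) (dPhi _) d1)).
  - move=> m x; apply: normr_prod_le => i.
    by have /andP[P0 P1] := Phi_bd ((b ord0 i - x ord0 i + h m) / Num.sqrt (h m ^+ 4)); rewrite ger0_norm.
  - by move=> x; apply: cvg_prod_seq => i; exact: smooth_cvg.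
have FE m : \int[mu t]_x F m x = \int[nu t]_x F m x.
  (* The shift is absorbed into the corner of the orthant, so that [weak_solution_smoothed]
     applies. *)
  pose b' : V := \row_i (b ord0 i + h m).
  have [C CE] := weak_solution_smoothed b' t0T (exprn_gt0 4 (h0 m)).
  have FE (P : probability V R) : \int[P]_x F m x =
      \int[P]_x \prod_i Phi ((b' ord0 i - x ord0 i) / Num.sqrt (h m ^+ 4)).
    apply: eq_Rintegral => x _; apply: eq_bigr => i _.
    by rewrite mxE addrAC.
  by rewrite !FE !CE.
have F12 : (fun m => \int[mu t]_x F m x) = (fun m => \int[nu t]_x F m x).
  by apply/funext => m; exact: FE.
have c1 := cvgF (mu t); rewrite F12 in c1.
have /mulfI E := cvg_unique_seq (cvgF (nu t)) c1.
have Ln : L ^+ n != 0 by rewrite expf_neq0// gt_eqF.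
have fE := esym (E Ln).
have mS := measurable_orthant b.
by rewrite -[LHS]fineK ?fin_num_measure// fE fineK// fin_num_measure.
Qed.

End uniqueness.

(** * Moments of the controlled process *)

Section linear_path.
Context {R : realType}.
Notation leb := (@lebesgue_measure R).
Variables (delta : R) (At Bt e mb : R -> R).
Hypothesis cAt : continuous At.
Hypothesis cBt : continuous Bt.
Hypothesis e_gt0 : forall t : R, 0 < e t.
Hypothesis de : forall t : R, is_derive t (1 : R) e (- (2 * At t * e t)).
Hypothesis mb0 : mb 0 = 0.
Hypothesis dmb : forall t : R, is_derive t (1 : R) mb (- (2 * At t * mb t + Bt t)).
Variables (T : R) (A B x om : R -> R).
Hypothesis T_gt0 : 0 < T.
Hypothesis ABE : forall t : R, 0 < t <= T -> A t = At t /\ B t = Bt t.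
Hypothesis com : continuous om.
Hypothesis intx : leb.-integrable `[0, T] (EFin \o (fun s => - (2 * A s * x s + B s))).
Hypothesis xE : forall t, 0 <= t <= T ->
  x t = \int[leb]_(s in `[0, t]) - (2 * A s * x s + B s) + delta * om t.

(* Variation of constants, integrated by parts so that no stochastic integral
   appears. *)
Lemma linear_path (t : R) : 0 <= t <= T ->
  x t = mb t + delta * (om t - e t * \int[leb]_(s in `[0, t]) (2 * At s / e s * om s)).
Proof.
move=> t0T.
pose h (s : R) : R := \int[leb]_(r in `[0, s]) - (2 * A r * x r + B r).
have ch : {within `[0, T], continuous h}.
  exact: (parameterized_integral_continuous (ltW T_gt0) intx).
have chc := continuous_clamp (ltW T_gt0) ch.
(* The drift rewritten through its own integral h, which is continuous, and through [At] and [Bt].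
   It agrees with the given drift on ]0, T] and is continuous everywhere, so h has a genuine
   derivative. *)
pose al (s : R) : R := - (2 * At s * (h (clamp 0 T s) + delta * om s) + Bt s).
have cal : continuous al.
  move=> s; apply: cvgN; move: s; apply: contD => //.
  apply: contM; first by apply: contM => //; exact: cont_cst.
  by apply: contD => //; apply: contM => //; exact: cont_cst.
have [H [H0 dH]] := exists_antiderivative cal.
have hH (s : R) : 0 <= s <= T -> h s = H s.
  move=> /andP[s0 sT].
  have alE (r : R) : 0 < r <= s -> - (2 * A r * x r + B r) = al r.
    move=> /andP[r0 rs]; have rT := le_trans rs sT.
    have [AE BE] := ABE (t := r) ltac:(by rewrite r0 rT).
    have r0T : 0 <= r <= T by rewrite ltW.
    by rewrite /al (clamp_id r0T) -AE -BE -/(h r) -xE.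
  have [_] := eq_integrable_oc alE (continuous_integrable_itv 0 s cal).
  by rewrite /h => ->; exact: Rintegral_antiderivative.
have cg : continuous (fun s => 2 * At s / e s * om s).
  apply: contM => //; apply: contM; first by apply: contM => //; exact: cont_cst.
  by move=> s; apply: cvgV; [rewrite gt_eqF|exact: (cont_der de)].
have [G [G0 dG]] := exists_antiderivative cg.
have /andP[t0 tT] := t0T.
rewrite (Rintegral_antiderivative t0 cg G0 dG).
(* H - mb solves a linear equation driven by delta om; after division by e its derivative is - delta
   times that of G, so Q is constant on [0, t]. *)
pose Q (s : R) : R := (H s - mb s) * (e s)^-1 + delta * G s.
have dQ (s : R) : is_derive s (1 : R) Q ((al s + (2 * At s * mb s + Bt s) + 2 * At s * (H s - mb s)) / e s
    + delta * (2 * At s / e s * om s)).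
  have es := gt_eqF (e_gt0 s).
  apply: is_derive_eq (derD (derM (derB (dH s) (dmb s)) (derV (negbT es) (de s))) (derZ delta (dG s))) _.
  by field; rewrite es.
have dQ0 (s : R) : 0 < s < t -> is_derive s (1 : R) Q 0.
  move=> /andP[s0 st]; have es := gt_eqF (e_gt0 s).
  apply: is_derive_eq (dQ s) _.
  have s0T : 0 <= s <= T by rewrite ltW//= (le_trans (ltW st)).
  by rewrite /al (clamp_id s0T) (hH s s0T); field; rewrite es.
have := Rintegral_derivative t0 (@cont_cst _ _ (0 : R)) (continuous_subspaceT (cont_der dQ)) dQ0.
rewrite {1}/Rintegral integral0/= /Q H0 mb0 G0 subrr mul0r mulr0 addr0 subr0.
move=> /esym QE.
rewrite xE// -/(h t) (hH t t0T).
have et := gt_eqF (e_gt0 t).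
have -> : H t = mb t - delta * e t * G t.
  apply/eqP; rewrite -subr_eq0; apply/eqP.
  transitivity (e t * ((H t - mb t) / e t + delta * G t)); first by field; rewrite et.
  by rewrite QE mulr0.
by ring.
Qed.

End linear_path.

(** * Exchanging expectations with time integrals *)

Section random_integral.
Context {R : realType} d {Omega : measurableType d}.
Variable P : probability Omega R.
Notation leb := (@lebesgue_measure R).
Notation RT := (measurableTypeR R).
Variables (H : R -> Omega -> R) (g : R -> R) (t C : R).
Hypothesis mH : forall s, measurable_fun setT (H s).
Hypothesis cH : forall w, continuous (fun s => H s w).
Hypothesis cg : continuous g.
Hypothesis t_ge0 : 0 <= t.
Hypothesis HC : forall s, 0 <= s <= t -> (\int[P]_w (H s w ^+ 2)%:E <= C%:E)%E.

(** With time rounded to a grid the process is jointly measurable, and continuity of every path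
    gives convergence as the mesh shrinks. *)
Lemma measurable_process : measurable_fun setT (fun p : RT * Omega => H p.1 p.2).
Proof.
pose Hk (k : nat) (p : RT * Omega) := H ((Num.floor (p.1 * k.+1%:R))%:~R / k.+1%:R) p.2.
apply: (@measurable_fun_cvg _ _ _ _ Hk) => [k|[x w] _].
  apply: (@measurable_fun_countable _ _ _ _ _ (fun p : RT * Omega => Num.floor (p.1 * k.+1%:R))
    (fun z p => H (z%:~R / k.+1%:R) p.2)).
    move=> z; apply: measurable_floor_eq.
    by apply: measurable_funM => //; exact: measurable_fst.
  by move=> z; exact: measurableT_comp (mH _) measurable_snd.
have hc : H s w @[s --> (x : R)] --> H (x : R) w := @cH w (x : R).
exact: (cvg_comp _ _ (@floor_cvg R x) hc).
Qed.

Definition random_integral (w : Omega) : R := \int[leb]_(s in `[0, t]) (g s * H s w).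

Variable Y : Omega -> R.
Hypothesis mY : measurable_fun setT Y.
Hypothesis Y2 : (\int[P]_w (Y w ^+ 2)%:E < +oo)%E.

Lemma integrable_mulH s : 0 <= s <= t -> P.-integrable setT (EFin \o (fun w => Y w * H s w)).
Proof.
move=> st.
have m2 (Z : Omega -> R) : measurable_fun setT Z -> measurable_fun setT (fun w => (Z w ^+ 2)%:E).
  by move=> mZ; apply/measurable_EFinP; exact: measurable_funX.
have i2 (Z : Omega -> R) : measurable_fun setT Z -> (\int[P]_w (Z w ^+ 2)%:E < +oo)%E ->
    P.-integrable setT (fun w => (Z w ^+ 2)%:E).
  move=> mZ Z2; apply/integrableP; split; first exact: m2.
  by under eq_integral do rewrite gee0_abs ?lee_fin ?sqr_ge0//.
have iY := i2 Y mY Y2.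
have iH := i2 (H s) (mH s) (le_lt_trans (HC st) (ltry _)).
apply: (@le_integrable _ _ _ P setT measurableT _ (fun w => (Y w ^+ 2)%:E + (H s w ^+ 2)%:E)%E).
- by apply/measurable_EFinP; exact: measurable_funM.
- move=> w _; rewrite -EFinD /= lee_fin [leRHS]ger0_norm ?addr_ge0 ?sqr_ge0// ler_norml.
  have := sqr_ge0 (Y w + H s w); have := sqr_ge0 (Y w - H s w); rewrite !expr2.
  have := sqr_ge0 (Y w); have := sqr_ge0 (H s w); rewrite !expr2.
  by move=> h1 h2 h3 h4; apply/andP; split; nra.
- exact: integrableD.
Qed.

Let f (p : RT * Omega) : \bar R := ((\1_(`[0, t]) p.1 : R) * (g p.1 * (Y p.2 * H p.1 p.2)))%:E.

Let mf : measurable_fun setT f.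
Proof.
apply/measurable_EFinP; apply: measurable_funM.
  exact: (measurableT_comp (measurable_indic (measurable_itv _)) measurable_fst).
apply: measurable_funM.
  exact: (measurableT_comp (continuous_measurable_fun cg) measurable_fst).
by apply: measurable_funM; [exact: measurableT_comp mY measurable_snd|exact: measurable_process].
Qed.

Let intf : (leb \x P)%E.-integrable setT f.
Proof.
apply/(integrable12ltyP leb P mf).
have [G G0 gG] := continuous_bounded_itv 0 t cg.
pose CY := (\int[P]_w (Y w ^+ 2)%:E)%E.
have CY0 : (0 <= CY)%E by apply: integral_ge0 => w _; rewrite lee_fin sqr_ge0.
have CYf : CY \is a fin_num by rewrite ge0_fin_numE.
have C0 : 0 <= C.
  have := HC (s := 0); rewrite lexx t_ge0 => /(_ isT); rewrite -lee_fin; apply: le_trans.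
  by apply: integral_ge0 => w _; rewrite lee_fin sqr_ge0.
pose K := G * (fine CY + C).
have K0 : 0 <= K by rewrite mulr_ge0// addr_ge0// fine_ge0.
have mfs s : measurable_fun setT (fun w => f (s, w)).
  have mYH : measurable_fun setT (fun w => Y w * H s w) by exact: measurable_funM.
  rewrite /f/=; apply/measurable_EFinP.
  by under eq_fun do rewrite mulrA; exact: measurable_funM.
have fK s : (\int[P]_w `|f (s, w)| <= (K * \1_(`[0, t]) s)%:E)%E.
  rewrite indicE; case: (boolP (s \in _)) => st; last first.
    rewrite mulr0 integral0_eq// => w _.
    by rewrite /f /= indicE (negPf st) mul0r normr0.
  move: (st); rewrite inE/= in_itv/= mulr1 => s0t.
  have mY2 : measurable_fun setT (fun w => (Y w ^+ 2)%:E : \bar R).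
    by apply/measurable_EFinP; exact: measurable_funX.
  have mH2 : measurable_fun setT (fun w => (H s w ^+ 2)%:E : \bar R).
    by apply/measurable_EFinP; exact: measurable_funX.
  apply: (@le_trans _ _ (\int[P]_w (G%:E * ((Y w ^+ 2)%:E + (H s w ^+ 2)%:E)))%E).
    apply: ge0_le_integral => //.
    - exact: (measurableT_comp (@abse_measurable R setT) (mfs s)).
    - by apply: emeasurable_funM => //; exact: emeasurable_funD.
    move=> w _; rewrite /f/= indicE st mul1r -EFinD -EFinM lee_fin normrM ler_pM//; first exact: gG.
    rewrite ler_norml.
    have := sqr_ge0 (Y w + H s w); have := sqr_ge0 (Y w - H s w); rewrite !expr2.
    have := sqr_ge0 (Y w); have := sqr_ge0 (H s w); rewrite !expr2.
    by move=> h1 h2 h3 h4; apply/andP; split; nra.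
  rewrite ge0_integralZl//; last 2 first.
  - exact: emeasurable_funD.
  - by move=> w _; rewrite adde_ge0// lee_fin sqr_ge0.
  rewrite ge0_integralD//; last 2 first.
  - by move=> w _; rewrite lee_fin sqr_ge0.
  - by move=> w _; rewrite lee_fin sqr_ge0.
  rewrite EFinM EFinD fineK//; apply: lee_wpmul2l; first by rewrite lee_fin.
  by apply: leeD2l; exact: HC.
apply: (@le_lt_trans _ _ (\int[leb]_s (K * \1_(`[0, t]) s)%:E)%E).
  apply: ge0_le_integral => //.
  - by move=> s _; apply: integral_ge0.
  - apply: (measurable_fun_fubini_tonelli_F (m2 := P) (abse \o f)); last by move=> p; exact: abse_ge0.
    exact: measurableT_comp.
  - by apply/measurable_EFinP; apply: measurable_funM => //; exact: measurable_indic.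
under eq_integral do rewrite EFinM.
rewrite ge0_integralZl//; last first.
  by apply/measurable_EFinP; exact: measurable_indic.
have tfin : (leb `[0%R, t]%classic < +oo)%E.
  by rewrite lebesgue_measure_itv/= lte_fin; case: ifPn => _; rewrite ?ltry// -EFinD ltry.
rewrite integral_indic// setIT; apply: lte_mul_pinfty => //.
Qed.

(** One application of Fubini, used with [Y] equal to 1, to the process at a fixed time and to the
    random integral itself; these yield its mean, its covariance with the noise and its second
    moment. The product measure is tamed by |Y H| <= Y^2 + H^2. *)
Lemma random_integral_mul :
  P.-integrable setT (EFin \o (fun w => Y w * random_integral w)) /\
  \int[P]_w (Y w * random_integral w) =
  \int[leb]_(s in `[0, t]) (g s * \int[P]_w (Y w * H s w)).
Proof.
have GE w : fubini_G leb f w = (Y w * random_integral w)%:E.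
  have cgH : continuous (fun s => g s * H s w) by exact: contM.
  have igH := continuous_integrable_itv 0 t cgH.
  rewrite /fubini_G /f/= /random_integral.
  transitivity (\int[leb]_(s in `[0%R, t]%classic) (Y w * (g s * H s w))%:E)%E.
    rewrite [RHS]integral_mkcond; apply: eq_integral => s _.
    rewrite patchE indicE; case: ifPn => _; rewrite ?mul1r ?mul0r//.
    by rewrite mulrCA.
  rewrite -RintegralZl// /Rintegral fineK//; apply: integrable_fin_num => //.
  rewrite (_ : (fun s => _) = fun s => ((Y w)%:E * (g s * H s w)%:E)%E); last first.
    by apply/funext => s; rewrite EFinM.
  exact: integrableZl.
have iG : P.-integrable setT (fubini_G leb f).
  apply/integrableP; split; first exact: (measurable_fubini_G intf).
  apply: le_lt_trans ((integrable21ltyP leb P mf).1 intf).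
  apply: ge0_le_integral => //.
  - exact: measurableT_comp (measurable_fubini_G intf).
  - apply: (measurable_fun_fubini_tonelli_G (abse \o f)); last by move=> p; exact: abse_ge0.
    exact: measurableT_comp.
  - by move=> w _; apply: le_abse_integral => //; exact: measurableT_comp mf (measurable_pair2 _).
have GEf : fubini_G leb f = EFin \o (fun w => Y w * random_integral w).
  by apply/funext => w; exact: GE.
rewrite GEf in iG; split => //.
transitivity (fine (\int[P]_w fubini_G leb f w)); first by rewrite GEf.
rewrite (integral21_prod_meas1 intf) -(integral12_prod_meas1 intf).
congr fine; rewrite [RHS]integral_mkcond; apply: eq_integral => s _.
rewrite patchE /fubini_F /f /= indicE; case: ifPn => st; last first.
  by rewrite integral0_eq// => w _; rewrite mul0r.
under eq_integral do rewrite mul1r EFinM.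
move: st; rewrite inE/= in_itv/= => /integrable_mulH iYH.
rewrite integralZl// EFinM; congr (_ * _)%E.
by rewrite fineK//; exact: integrable_fin_num.
Qed.

End random_integral.

Section square.
Context {R : realType}.
Notation leb := (@lebesgue_measure R).

(** Cauchy-Schwarz against the constant 1: the integral of (f - c)^2 is nonnegative for c the
    average of f. *)
Lemma sqr_Rintegral_le (f : R -> R) (t : R) : 0 <= t -> continuous f ->
  (\int[leb]_(s in `[0, t]) f s) ^+ 2 <= t * \int[leb]_(s in `[0, t]) f s ^+ 2.
Proof.
move=> t0 cf.
have cf2 : continuous (fun s => f s ^+ 2) by exact: contX.
have [F1 [F10 dF1]] := exists_antiderivative cf.
have [F2 [F20 dF2]] := exists_antiderivative cf2.
rewrite (Rintegral_antiderivative t0 cf F10 dF1) (Rintegral_antiderivative t0 cf2 F20 dF2).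
move: t0; rewrite le_eqVlt => /predU1P[<-|t0]; first by rewrite F10 expr0n/= mul0r.
pose c := F1 t / t.
have dF (s : R) : is_derive s (1 : R) (fun s => F2 s - 2 * c * F1 s + c ^+ 2 * s) ((f s - c) ^+ 2).
  apply: is_derive_eq (derD (derB (dF2 s) (derZ (2 * c) (dF1 s))) (derZ (c ^+ 2) (der_id s))) _.
  by ring.
have cfc : continuous (fun s => (f s - c) ^+ 2).
  by apply: contX; apply: contB => //; exact: cont_cst.
have : 0 <= \int[leb]_(s in `[0, t]) (f s - c) ^+ 2.
  by apply: Rintegral_ge0 => s _; exact: sqr_ge0.
rewrite (Rintegral_antiderivative (ltW t0) cfc _ dF); last by rewrite F10 F20; ring.
rewrite -(pmulr_rge0 _ t0) /c => h.
rewrite -subr_ge0; apply: le_trans h _.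
rewrite le_eqVlt; apply/orP; left; apply/eqP.
by field; rewrite gt_eqF.
Qed.

End square.

Section square_integrable.
Context {R : realType} d {Omega : measurableType d}.
Variables (P : probability Omega R) (Y : Omega -> R).
Hypothesis mY : measurable_fun setT Y.
Hypothesis Y2 : (\int[P]_w (Y w ^+ 2)%:E < +oo)%E.

Lemma integrable_sqr : P.-integrable setT (EFin \o (fun w => Y w ^+ 2)).
Proof.
apply/integrableP; split.
  by apply/measurable_EFinP; exact: measurable_funX.
by under eq_integral do rewrite /= ger0_norm ?sqr_ge0//.
Qed.

Lemma integrable_of_sqr : P.-integrable setT (EFin \o Y).
Proof.
have i1 : P.-integrable setT (EFin \o (fun _ : Omega => 1 : R)).
  exact: finite_measure_integrable_cst.
have i2 := integrableD measurableT i1 integrable_sqr.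
apply: (@le_integrable _ _ _ P setT measurableT _ _ _ _ i2); first exact/measurable_EFinP.
move=> w _; change (`|Y w|%:E <= `|1 + Y w ^+ 2|%:E)%E.
rewrite lee_fin [leRHS]ger0_norm ?addr_ge0 ?sqr_ge0// ler_norml.
have := sqr_ge0 (Y w - 1); have := sqr_ge0 (Y w + 1); rewrite !expr2.
by have := sqr_ge0 (Y w); rewrite expr2 => h1 h2 h3; apply/andP; split; nra.
Qed.

End square_integrable.

Section random_integral_sqr.
Context {R : realType} d {Omega : measurableType d}.
Variable P : probability Omega R.
Notation leb := (@lebesgue_measure R).
Notation RT := (measurableTypeR R).
Variables (H : R -> Omega -> R) (g : R -> R) (t C : R).
Hypothesis mH : forall s, measurable_fun setT (H s).
Hypothesis cH : forall w, continuous (fun s => H s w).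
Hypothesis cg : continuous g.
Hypothesis t_ge0 : 0 <= t.
Hypothesis HC : forall s, 0 <= s <= t -> (\int[P]_w (H s w ^+ 2)%:E <= C%:E)%E.

Let int1 : (\int[P]_w ((fun _ : Omega => 1 : R) w ^+ 2)%:E < +oo)%E.
Proof.
under eq_integral do rewrite expr1n.
have i1 : P.-integrable setT (EFin \o (fun _ : Omega => 1 : R)).
  exact: finite_measure_integrable_cst.
by have /fin_numPlt/andP[] := integrable_fin_num measurableT i1.
Qed.

Lemma measurable_random_integral : measurable_fun setT (random_integral H g t).
Proof.
have [+ _] := random_integral_mul mH cH cg t_ge0 HC (@measurable_cst _ _ _ _ _ (1 : R)) int1.
move=> /(measurable_int P)/measurable_EFinP.
by under eq_fun do rewrite mul1r.
Qed.

Lemma random_integral_mean :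
  \int[P]_w random_integral H g t w =
  \int[leb]_(s in `[0, t]) (g s * \int[P]_w H s w).
Proof.
have [_] := random_integral_mul mH cH cg t_ge0 HC (@measurable_cst _ _ _ _ _ (1 : R)) int1.
under [in RHS]eq_Rintegral do under eq_Rintegral do rewrite mul1r.
by under eq_Rintegral do rewrite mul1r.
Qed.

Let f (p : RT * Omega) : \bar R := ((\1_(`[0, t]) p.1 : R) * (g p.1 * H p.1 p.2) ^+ 2)%:E.

Let mf : measurable_fun setT f.
Proof.
apply/measurable_EFinP; apply: measurable_funM.
  exact: (measurableT_comp (measurable_indic (measurable_itv _)) measurable_fst).
apply: measurable_funX; apply: measurable_funM; last exact: measurable_process.
exact: (measurableT_comp (continuous_measurable_fun cg) measurable_fst).
Qed.

(** Cauchy-Schwarz along each path, then Tonelli. It lets the random integral itself serve as the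
    factor [Y] of [random_integral_mul]. *)
Lemma random_integral_sqr : (\int[P]_w (random_integral H g t w ^+ 2)%:E < +oo)%E.
Proof.
have [G G0 gG] := continuous_bounded_itv 0 t cg.
have f0 p : (0 <= f p)%E by rewrite lee_fin mulr_ge0 ?sqr_ge0.
have C0 : 0 <= C.
  have := HC (s := 0); rewrite lexx t_ge0 => /(_ isT); rewrite -lee_fin; apply: le_trans.
  by apply: integral_ge0 => w _; rewrite lee_fin sqr_ge0.
have mG : measurable_fun setT (fubini_G leb f) by exact: measurable_fun_fubini_tonelli_G.
have GE w : fubini_G leb f w = (\int[leb]_(s in `[0, t]) (g s * H s w) ^+ 2)%:E.
  have cgH : continuous (fun s => (g s * H s w) ^+ 2) by apply: contX; exact: contM.
  rewrite /Rintegral fineK; last first.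
    by apply: integrable_fin_num => //; exact: continuous_integrable_itv.
  rewrite /fubini_G /f/= [RHS]integral_mkcond; apply: eq_integral => s _.
  by rewrite patchE indicE; case: ifPn => _; rewrite ?mul1r ?mul0r.
pose K := G ^+ 2 * C.
have K0 : 0 <= K by rewrite mulr_ge0// sqr_ge0.
apply: (@le_lt_trans _ _ (\int[P]_w (t%:E * fubini_G leb f w))%E).
  apply: ge0_le_integral => //.
  - by move=> w _; rewrite lee_fin sqr_ge0.
  - by apply/measurable_EFinP; apply: measurable_funX; exact: measurable_random_integral.
  - by apply: emeasurable_funM.
  - move=> w _; rewrite GE -EFinM lee_fin; apply: sqr_Rintegral_le => //.
    by apply: contM.
rewrite ge0_integralZl//; last by move=> w _; apply: integral_ge0.
apply: lte_mul_pinfty => //.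
have -> : (\int[P]_w fubini_G leb f w = \int[leb]_s fubini_F P f s)%E.
  exact: (esym (fubini_tonelli f mf f0)).
have mH2 s : measurable_fun setT (fun w => (H s w ^+ 2)%:E : \bar R).
  by apply/measurable_EFinP; exact: measurable_funX.
have fK s : (fubini_F P f s <= (K * \1_(`[0, t]) s)%:E)%E.
  rewrite /fubini_F /f /= indicE; case: (boolP (s \in _)) => st; last first.
    by rewrite mulr0 integral0_eq// => w _; rewrite mul0r.
  move: (st); rewrite inE/= in_itv/= mulr1 => s0t.
  under eq_integral do rewrite mul1r exprMn EFinM.
  rewrite ge0_integralZl//; last 2 first.
  - by move=> w _; rewrite lee_fin sqr_ge0.
  - by rewrite lee_fin sqr_ge0.
  rewrite /K [leRHS]EFinM; apply: lee_pmul; rewrite ?lee_fin ?sqr_ge0//.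
  - by apply: integral_ge0 => w _; rewrite lee_fin sqr_ge0.
  - rewrite -[leLHS]real_normK ?num_real// lerXn2r ?nnegrE ?gG//.
  - exact: HC.
have m1 : measurable_fun setT (fun s : RT => (\1_(`[0, t]) s)%:E : \bar R).
  by apply/measurable_EFinP; exact: measurable_indic.
apply: (@le_lt_trans _ _ (\int[leb]_s (K%:E * (\1_(`[0, t]) s)%:E))%E).
  apply: ge0_le_integral => //.
  - by move=> s _; apply: integral_ge0.
  - exact: measurable_fun_fubini_tonelli_F.
  - exact: emeasurable_funM.
rewrite ge0_integralZl//.
have tfin : (leb `[0%R, t]%classic < +oo)%E.
  by rewrite lebesgue_measure_itv/= lte_fin; case: ifPn => _; rewrite ?ltry// -EFinD ltry.
by rewrite integral_indic// setIT; apply: lte_mul_pinfty.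
Qed.

End random_integral_sqr.

Section kernel_integrals.
Context {R : realType}.
Notation leb := (@lebesgue_measure R).
Variables (E g L q : R -> R) (t : R).
Hypothesis t_ge0 : 0 <= t.
Hypothesis cg : continuous g.
Hypothesis dE : forall s : R, is_derive s (1 : R) E (g s).
Hypothesis L0 : L 0 = 0.
Hypothesis dL : forall s : R, is_derive s (1 : R) L (E s).
Hypothesis q0 : q 0 = 0.
Hypothesis dq : forall s : R, is_derive s (1 : R) q (E s ^+ 2).

Let cid : continuous (fun s : R => s).
Proof. by move=> s; exact: cvg_id. Qed.

(** With E = 1 / e this is the covariance of the noise at time s with the random integral. The
    minimum is resolved at r = s: before it r E - L is a primitive of r g, after it s E is one of s
    g. *)
Lemma integral_kernel_min (s : R) : 0 <= s <= t ->
  \int[leb]_(r in `[0, t]) (g r * Num.min s r) = s * E t - L s.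
Proof.
move=> /andP[s0 st].
have cmin : continuous (fun r => g r * Num.min s r).
  apply: contM => //.
  rewrite (_ : Num.min s = fun r => r - pos (r - s)); last first.
    by apply/funext => r; rewrite /pos; case: (lerP s r); case: (lerP 0 (r - s)); lra.
  apply: contB => // r; apply: (@continuous_comp _ _ _ (fun r => r - s) (@pos R)).
    exact: (der_cont (derB (der_id r) (der_cst s r))).
  exact: pos_continuous.
have [F [F0 dF]] := exists_antiderivative cmin.
rewrite (Rintegral_antiderivative t_ge0 cmin F0 dF).
have c0 : continuous (fun _ : R => 0 : R) by exact: cont_cst.
have int0 (a b : R) : \int[leb]_(r in `[a, b]) 0 = 0 :> R.
  by rewrite /Rintegral integral0.
have dA (r : R) : is_derive r (1 : R) (fun r => F r - (r * E r - L r)) (g r * Num.min s r - r * g r).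
  apply: is_derive_eq (derB (dF r) (derB (derM (der_id r) (dE r)) (dL r))) _.
  by ring.
have dA0 (r : R) : 0 < r < s -> is_derive r (1 : R) (fun r => F r - (r * E r - L r)) 0.
  move=> /andP[r0 rs]; apply: is_derive_eq (dA r) _.
  by rewrite (min_idPr (ltW rs)); ring.
have dB (r : R) : is_derive r (1 : R) (fun r => F r - s * E r) (g r * Num.min s r - s * g r).
  exact: (derB (dF r) (derZ s (dE r))).
have dB0 (r : R) : s < r < t -> is_derive r (1 : R) (fun r => F r - s * E r) 0.
  move=> /andP[sr rt]; apply: is_derive_eq (dB r) _.
  by rewrite (min_idPl (ltW sr)); ring.
have := Rintegral_derivative s0 c0 (continuous_subspaceT (cont_der dA)) dA0.
have := Rintegral_derivative st c0 (continuous_subspaceT (cont_der dB)) dB0.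
rewrite !int0 F0 L0; lra.
Qed.

(** The second moment of the random integral, by another integration by parts. *)
Lemma integral_kernel_kernel :
  \int[leb]_(s in `[0, t]) (g s * (s * E t - L s)) =
  t * E t ^+ 2 - 2 * E t * L t + q t.
Proof.
have cf : continuous (fun s => g s * (s * E t - L s)).
  apply: contM => //; apply: contB; last exact: cont_der dL.
  by apply: contM => //; exact: cont_cst.
pose Q s := E t * (s * E s - L s) - (E s * L s - q s).
have dQ (s : R) : is_derive s (1 : R) Q (g s * (s * E t - L s)).
  apply: is_derive_eq (derB (derZ (E t) (derB (derM (der_id s) (dE s)) (dL s)))
    (derB (derM (dE s) (dL s)) (dq s))) _.
  by ring.
have Q0 : Q 0 = 0 by rewrite /Q L0 q0; ring.
by rewrite (Rintegral_antiderivative t_ge0 cf Q0 dQ) /Q; ring.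
Qed.

End kernel_integrals.

Section process_moments.
Context {R : realType} d {Omega : measurableType d}.
Variable P : probability Omega R.
Notation leb := (@lebesgue_measure R).
Variables (H : R -> Omega -> R) (T : R).
Hypothesis mH : forall s, measurable_fun setT (H s).
Hypothesis cH : forall w, continuous (fun s => H s w).
Hypothesis H1 : forall s, 0 <= s <= T ->
  P.-integrable setT (EFin \o H s) /\ \int[P]_w H s w = 0.
Hypothesis H2 : forall s, 0 <= s <= T -> (\int[P]_w (H s w ^+ 2)%:E = s%:E)%E.
Hypothesis H12 : forall s r, 0 <= s <= T -> 0 <= r <= T ->
  \int[P]_w (H s w * H r w) = Num.min s r.
Variables (At e q : R -> R).
Hypothesis cAt : continuous At.
Hypothesis e_gt0 : forall t : R, 0 < e t.
Hypothesis de : forall t : R, is_derive t (1 : R) e (- (2 * At t * e t)).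
Hypothesis q0 : q 0 = 0.
Hypothesis dq : forall t : R, is_derive t (1 : R) q ((e t ^+ 2)^-1).
Variable t : R.
Hypothesis t0T : 0 <= t <= T.

Definition noise_part (w : Omega) : R :=
  H t w - e t * random_integral H (fun s => 2 * At s / e s) t w.

Let g s := 2 * At s / e s.
Let J := random_integral H g t.

Let cg : continuous g.
Proof.
apply: contM; first by apply: contM => //; exact: cont_cst.
by move=> s; apply: cvgV; [rewrite gt_eqF|exact: (cont_der de)].
Qed.

Let t_ge0 : 0 <= t. Proof. by have /andP[] := t0T. Qed.

Let st_T s : 0 <= s <= t -> 0 <= s <= T.
Proof. by have /andP[_ tT] := t0T; move=> /andP[-> /le_trans->]. Qed.

Let HC s : 0 <= s <= t -> (\int[P]_w (H s w ^+ 2)%:E <= t%:E)%E.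
Proof. by move=> st; rewrite H2 ?st_T// lee_fin; case/andP: st. Qed.

Let H2fin s : 0 <= s <= t -> (\int[P]_w (H s w ^+ 2)%:E < +oo)%E.
Proof. by move=> st; rewrite H2 ?st_T// ltry. Qed.

Let mJ : measurable_fun setT J.
Proof. exact: (measurable_random_integral mH cH cg t_ge0 HC). Qed.

Let J2 : (\int[P]_w (J w ^+ 2)%:E < +oo)%E.
Proof. exact: (random_integral_sqr mH cH cg t_ge0 HC). Qed.

Lemma measurable_noise_part : measurable_fun setT noise_part.
Proof. by apply: measurable_funB => //; apply: measurable_funM. Qed.

Lemma noise_part_mean :
  P.-integrable setT (EFin \o noise_part) /\ \int[P]_w noise_part w = 0.
Proof.
have [iHt Ht0] := H1 t0T.
have iJ := integrable_of_sqr mJ J2.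
have ieJ := integrable_scale (e t) iJ.
split; first exact: integrable_sub.
rewrite RintegralB// Ht0 RintegralZl// (random_integral_mean mH cH cg t_ge0 HC).
have -> : \int[leb]_(s in `[0, t]) (g s * \int[P]_w H s w) = 0.
  rewrite /Rintegral integral0_eq// => s /=; rewrite in_itv/= => /st_T/H1[_].
  by rewrite /Rintegral => ->; rewrite mulr0.
by rewrite mulr0 subr0.
Qed.

(** Expanding the square leaves the terms just computed; as e E = 1 at time t, everything in t and L
    cancels. The result is what the Ito isometry would give, the integral over [0, t] of (e t / e
    s)^2. *)
Lemma noise_part_sqr :
  P.-integrable setT (EFin \o (fun w => noise_part w ^+ 2)) /\
  \int[P]_w noise_part w ^+ 2 = e t ^+ 2 * q t.
Proof.
pose E s := (e s)^-1.
have dE (s : R) : is_derive s (1 : R) E (g s).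
  have es := gt_eqF (e_gt0 s).
  by apply: is_derive_eq (derV (negbT es) (de s)) _; rewrite /g; field; rewrite es.
have [L [L0 dL]] := exists_antiderivative (cont_der dE).
have dqE (s : R) : is_derive s (1 : R) q (E s ^+ 2) by rewrite /E exprVn.
have tt : 0 <= t <= t by rewrite t_ge0 lexx.
have [iHtJ HtJ] := random_integral_mul mH cH cg t_ge0 HC (mH t) (H2fin tt).
have [iJJ JJ] := random_integral_mul mH cH cg t_ge0 HC mJ J2.
have HsJ s : 0 <= s <= t -> \int[P]_w (H s w * J w) = s * E t - L s.
  move=> st; have [_ ->] := random_integral_mul mH cH cg t_ge0 HC (mH s) (H2fin st).
  rewrite -(integral_kernel_min t_ge0 cg dE L0 dL st); apply: eq_Rintegral => r.
  by rewrite inE/= in_itv/= => rt; rewrite H12 ?st_T.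
have JJE : \int[P]_w (J w * J w) = t * E t ^+ 2 - 2 * E t * L t + q t.
  rewrite JJ -(integral_kernel_kernel t_ge0 cg dE L0 dL q0 dqE); apply: eq_Rintegral => s.
  rewrite inE/= in_itv/= => st; rewrite -HsJ//; congr (_ * _).
  by apply: eq_Rintegral => w _; rewrite mulrC.
have iHt2 := integrable_sqr (mH t) (H2fin tt).
have Ht2 : \int[P]_w H t w ^+ 2 = t by rewrite /Rintegral H2 ?st_T.
have iA := integrable_scale (2 * e t) iHtJ.
have iB := integrable_scale (e t ^+ 2) iJJ.
have iHA := integrable_sub iHt2 iA.
have NE w : noise_part w ^+ 2 = H t w ^+ 2 - 2 * e t * (H t w * J w) + e t ^+ 2 * (J w * J w).
  by rewrite /noise_part -/g -/J; ring.
split.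
  by under eq_fun do rewrite /= NE; exact: integrable_add iHA iB.
under eq_Rintegral do rewrite NE.
rewrite RintegralD// RintegralB// !RintegralZl// Ht2 HsJ// JJE.
have et := gt_eqF (e_gt0 t).
by rewrite /E; field; rewrite et.
Qed.

End process_moments.

(** * First and second moments of Brownian motion *)

Section brownian_moments.
Context {R : realType} {n : nat} d {Omega : measurableType d}.
Variables (P : probability Omega R) (W : R -> Omega -> 'rV[R]_n).
Hypothesis W_bm : brownian_motion P W.
Variable i : 'I_n.
Notation RT := (measurableTypeR R).

Let measurable_W s : 0 <= s -> measurable_fun setT (fun w => W s w ord0 i).
Proof. by move=> s0; have [/(_ s s0) + _ _] := W_bm; move/measurable_fun_rVP; exact. Qed.

Let incr (s r : R) (w : Omega) : R := W r w ord0 i - W s w ord0 i.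

Let measurable_incr s r : 0 <= s -> 0 <= r -> measurable_fun setT (incr s r).
Proof. by move=> s0 r0; apply: measurable_funB; exact: measurable_W. Qed.

Lemma increment_law (s r : R) (U : set R) : 0 <= s < r -> measurable U ->
  P (incr s r @^-1` U) = normal_prob 0 (Num.sqrt (r - s)) U.
Proof.
move=> /andP[s0 sr] mU; have [_ _ law] := W_bm.
(* A single time step from s to r, with all coordinates other than i left unconstrained. *)
pose t (j : nat) : R := if j == 0%N then s else r.
pose V (j : nat) (k : 'I_n) : set R := if k == i then U else setT.
have mV j k : measurable (V j k) by rewrite /V; case: ifP.
have tlt j : (j < 1)%N -> t j < t j.+1 by case: j.
have := law 1%N t s0 tlt V mV.
rewrite big_ord1 (bigD1 i)//= /V eqxx big1 => [|k ki]; last first.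
  by rewrite (negPf ki); exact: probability_setT.
rewrite mule1 => <-; congr (P _); apply/seteqP; split => w /=.
  by move=> Uw [|//] k _; case: eqP => [->|].
by move=> /(_ 0%N i isT); rewrite eqxx.
Qed.

Lemma increment_sqr (s r : R) : 0 <= s < r ->
  (\int[P]_w (incr s r w ^+ 2)%:E = (r - s)%:E)%E.
Proof.
move=> sr; have /andP[s0 s_r] := sr.
have r0 : 0 <= r by exact: le_trans (ltW s_r).
have mi : measurable_fun setT (incr s r : Omega -> RT) := measurable_incr s0 r0.
have lawE A : measurable A -> A `<=` setT -> normal_prob 0 (Num.sqrt (r - s)) A = image_law P mi A.
  by move=> mA _; rewrite -increment_law.
have sq0 : 0 < Num.sqrt (r - s) by rewrite sqrtr_gt0 subr_gt0.
rewrite -[in RHS](@sqr_sqrtr _ (r - s)) ?subr_ge0 ?(ltW s_r)// -integral_sqr_normal_prob//.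
rewrite [RHS](eq_measure_integral _ lawE) [RHS]ge0_integral_image_law//.
  by apply/measurable_EFinP; exact: measurable_funX.
by move=> x; rewrite lee_fin sqr_ge0.
Qed.

Lemma increment_mean (s r : R) : 0 <= s < r -> \int[P]_w incr s r w = 0.
Proof.
move=> sr; have /andP[s0 s_r] := sr.
have r0 : 0 <= r by exact: le_trans (ltW s_r).
have mi : measurable_fun setT (incr s r : Omega -> RT) := measurable_incr s0 r0.
have lawE A : measurable A -> A `<=` setT -> normal_prob 0 (Num.sqrt (r - s)) A = image_law P mi A.
  by move=> mA _; rewrite -increment_law.
have ii : P.-integrable setT (EFin \o incr s r).
  by apply: integrable_of_sqr => //; rewrite increment_sqr// ltry.
have sq0 : 0 < Num.sqrt (r - s) by rewrite sqrtr_gt0 subr_gt0.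
have [_ E] := integral_id_normal_prob sq0.
move: E; rewrite (eq_measure_integral _ lawE) integral_distribution//.
by rewrite /Rintegral => ->.
Qed.

(* Continuity of every path, not almost every one, is what makes the process
   jointly measurable, hence amenable to Fubini. *)
Lemma brownian_modification (T : R) : 0 <= T -> exists H : R -> Omega -> R,
  [/\ forall s, measurable_fun setT (H s),
      forall w, continuous (fun s => H s w),
      {ae P, forall w, forall s, 0 <= s <= T -> H s w = W s w ord0 i},
      (forall s, 0 <= s <= T ->
        [/\ P.-integrable setT (EFin \o H s), \int[P]_w H s w = 0 &
            (\int[P]_w (H s w ^+ 2)%:E = s%:E)%E]) &
      forall s r, 0 <= s <= T -> 0 <= r <= T ->
        \int[P]_w (H s w * H r w) = Num.min s r].
Proof.
move=> T0; have [_ [N [mN N0 goodN]] _] := W_bm.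
have {}goodN w : ~ N w -> W 0 w = 0 /\ {within `[0, +oo[, continuous (fun t => W t w)}.
  by move=> Nw; apply: contrapT => h; apply: Nw; exact: goodN.
(* Killed on the exceptional null set, so that every path is continuous, and frozen outside [0, T],
   because continuity of [W] is given for nonnegative times only. *)
pose H (s : R) (w : Omega) : R := \1_(~` N) w * W (clamp 0 T s) w ord0 i.
have HE s w : 0 <= s <= T -> ~ N w -> H s w = W s w ord0 i.
  by move=> sT Nw; rewrite /H (clamp_id sT) indicE mem_set// mul1r.
have HN s w : N w -> H s w = 0.
  by move=> Nw; rewrite /H indicE memNset ?mul0r//=; exact.
have H0 w : H 0 w = 0.
  have [Nw|Nw] := pselect (N w); first exact: HN.
  by rewrite HE ?lexx// (goodN w Nw).1 mxE.
have mH s : measurable_fun setT (H s).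
  apply: measurable_funM; first exact/measurable_indic/measurableC.
  by apply: measurable_W; have /andP[] := clamp_in s T0.
have cH w : continuous (fun s => H s w).
  have [Nw|Nw] := pselect (N w).
    rewrite (_ : (fun s => _) = fun=> 0); first exact: cont_cst.
    by apply/funext => s; exact: HN.
  have [_ cW] := goodN w Nw.
  have cWi : {within `[0, T], continuous (fun t => W t w ord0 i)}.
    have cWT : {within `[0, T], continuous (fun t => W t w)}.
      apply: continuous_subspaceW cW => s /=; rewrite !in_itv/= andbT.
      by move=> /andP[].
    move=> s; apply: (@continuous_comp (subspace `[0, T]) 'rV[R]_n R (fun t => W t w)
      (fun x : 'rV[R]_n => x ord0 i) s).
      exact: cWT.
    exact: (@coord_continuous R 1 n ord0 i).
  have cc := continuous_clamp T0 cWi.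
  by apply: contM; [exact: cont_cst|exact: cc].
have incrE s r : 0 <= s < r -> r <= T ->
    ae_eq P setT (fun w => H r w - H s w) (incr s r).
  move=> /andP[s0 sr] rT; exists N; split => // w /= h.
  apply: contrapT => Nw; apply: h => _; rewrite /incr !HE//.
    by rewrite s0 (le_trans (ltW sr)).
  by rewrite (le_trans s0 (ltW sr)).
have mD s r : measurable_fun setT (fun w => H r w - H s w) by exact: measurable_funB.
have D2 s r : 0 <= s < r -> r <= T -> (\int[P]_w ((H r w - H s w) ^+ 2)%:E = (r - s)%:E)%E.
  move=> sr rT; rewrite -(increment_sqr sr).
  have /andP[s0 s_r] := sr; have r0 : 0 <= r by exact: le_trans (ltW s_r).
  apply: ge0_ae_eq_integral => //.
  - by apply/measurable_EFinP; exact: measurable_funX.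
  - by apply/measurable_EFinP; apply: measurable_funX; exact: measurable_incr.
  - by move=> w _; rewrite lee_fin sqr_ge0.
  - by move=> w _; rewrite lee_fin sqr_ge0.
  - have [M [mM M0 sub]] := incrE s r sr rT.
    exists M; split => // w /= h; apply: sub => /= h'; apply: h => _.
    by rewrite h'.
have HD s : H s = fun w => H s w - H 0 w by apply/funext => w; rewrite H0 subr0.
have H2 s : 0 <= s <= T -> (\int[P]_w (H s w ^+ 2)%:E = s%:E)%E.
  move=> /andP[s0 sT]; move: s0; rewrite le_eqVlt => /predU1P[<-|s0].
    by rewrite integral0_eq// => w _; rewrite H0 expr0n.
  by rewrite HD D2 ?subr0// lexx.
have iH s : 0 <= s <= T -> P.-integrable setT (EFin \o H s).
  by move=> sT; apply: integrable_of_sqr => //; rewrite H2// ltry.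
have i2 s : 0 <= s <= T -> P.-integrable setT (EFin \o (fun w => H s w ^+ 2)).
  by move=> sT; apply: integrable_sqr => //; rewrite H2// ltry.
have H1 s : 0 <= s <= T -> \int[P]_w H s w = 0.
  move=> /andP[s0 sT]; move: s0; rewrite le_eqVlt => /predU1P[<-|s0].
    by rewrite /Rintegral integral0_eq// => w _; rewrite H0.
  have sr : (0 : R) <= 0 < s by rewrite lexx s0.
  rewrite -(increment_mean sr) HD; congr fine; apply: ae_eq_integral => //.
  - exact/measurable_EFinP.
  - by apply/measurable_EFinP; exact: measurable_incr (lexx _) (ltW s0).
  - have [M [mM M0 sub]] := incrE 0 s sr sT.
    exists M; split => // w /= h; apply: sub => /= h'; apply: h => _.
    by rewrite h'.
have H12 s r : 0 <= s <= T -> 0 <= r <= T -> s < r -> \int[P]_w (H s w * H r w) = s.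
  move=> sT rT sr; have s_r : 0 <= s < r by have /andP[-> _] := sT.
  have rT' : r <= T by have /andP[] := rT.
  have id2 : P.-integrable setT (EFin \o (fun w => (H r w - H s w) ^+ 2)).
    by apply: integrable_sqr => //; rewrite D2// ltry.
  have isum := integrable_add (i2 s sT) (i2 r rT).
  have idiff := integrable_sub isum id2.
  (* Polarisation: the covariance follows from the second moments of [H s], [H r] and their
     increment. *)
  transitivity (\int[P]_w (2^-1 * (H s w ^+ 2 + H r w ^+ 2 - (H r w - H s w) ^+ 2))).
    by apply: eq_Rintegral => w _; field.
  rewrite RintegralZl// RintegralB// RintegralD//; [|exact: i2|exact: i2].
  by rewrite /Rintegral H2// H2// D2//=; field.
exists H; split => //.
- exists N; split => // w /= h; apply: contrapT => Nw; apply: h => s sT.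
  exact: HE.
- by move=> s sT; split; [exact: iH|exact: H1|exact: H2].
- move=> s r sT rT; case: (ltgtP s r) => [sr|rs|<-].
  + exact: H12.
  + by under eq_Rintegral do rewrite mulrC; exact: H12.
  + by under eq_Rintegral do rewrite -expr2; rewrite /Rintegral H2.
Qed.

End brownian_moments.

Section almost_sure_moments.
Context {R : realType} d {Omega : measurableType d}.
Variable P : probability Omega R.

Lemma moments_ae_affine (f N : Omega -> R) (c k v : R) :
  measurable_fun setT f -> measurable_fun setT N ->
  {ae P, forall w, f w = c + k * N w} ->
  P.-integrable setT (EFin \o N) -> \int[P]_w N w = 0 ->
  P.-integrable setT (EFin \o (fun w => N w ^+ 2)) -> \int[P]_w N w ^+ 2 = v ->
  ('E_P[f] = c%:E)%E /\ ('V_P[f] = (k ^+ 2 * v)%:E)%E.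
Proof.
move=> mf mN [Z [mZ Z0 fN]] iN N0 iN2 N2.
have ik := integrable_scale k iN.
have ic : P.-integrable setT (EFin \o (fun=> c)) := finite_measure_integrable_cst P c measurableT.
have ick := integrable_add ic ik.
have mkN : measurable_fun setT (fun w => k * N w) by exact: measurable_funM.
have mck : measurable_fun setT (fun w => c + k * N w) by exact: measurable_funD.
have P1 : P setT = 1%E := probability_setT P.
have ckN : \int[P]_w (c + k * N w) = c.
  rewrite RintegralD// RintegralZl// N0 mulr0 addr0 Rintegral_cst//.
  by transitivity (c * fine (P setT)); [|rewrite P1 mulr1].
have Ef : ('E_P[f] = c%:E)%E.
  rewrite unlock (@ae_eq_integral _ _ _ P setT (EFin \o (fun w => c + k * N w)) (EFin \o f))//.
  - by rewrite -[in RHS]ckN /Rintegral fineK//; exact: (integrable_fin_num _ ick).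
  - exact/measurable_EFinP.
  - exact/measurable_EFinP.
  - exists Z; split => // w /= h; apply: fN => /= h'; apply: h => _.
    by rewrite h'.
split => //.
rewrite /variance unlock Ef unlock.
rewrite (@ae_eq_integral _ _ _ P setT (fun w => (k ^+ 2 * N w ^+ 2)%:E)
  (fun w => (((f \- cst (fine c%:E)) * (f \- cst (fine c%:E)))%R w)%:E))//.
- rewrite -N2 -RintegralZl// /Rintegral fineK//; apply: integrable_fin_num => //.
  exact: integrable_scale.
- apply/measurable_EFinP; apply: measurable_funM; exact: measurable_funB.
- by apply/measurable_EFinP; apply: measurable_funM => //; exact: measurable_funX.
- exists Z; split => // w /= h; apply: fN => /= h'; apply: h => _.
  congr _%:E; transitivity ((f w - c) * (f w - c)); first by [].
  by rewrite h'; ring.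
Qed.

Lemma ae0_sqr_integral (f : Omega -> R) : measurable_fun setT f ->
  (\int[P]_w (f w ^+ 2)%:E = 0)%E -> {ae P, forall w, f w = 0}.
Proof.
move=> mf f2.
have mf2 : measurable_fun setT (fun w => (f w ^+ 2)%:E : \bar R).
  by apply/measurable_EFinP; exact: measurable_funX.
have : (\int[P]_w `|(f w ^+ 2)%:E| = 0)%E.
  by rewrite -f2; apply: eq_integral => w _; rewrite gee0_abs// lee_fin sqr_ge0.
move/(ae_eq_integral_abs P measurableT mf2) => [Z [mZ Z0 h]].
exists Z; split => // w /= fw; apply: h => /= h; apply: fw.
by have [] := h I => /eqP; rewrite sqrf_eq0 => /eqP.
Qed.

End almost_sure_moments.

Section propagator_exponential.
Context {R : realType}.
Variables (T : R) (A At e : R -> R).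
Hypothesis cAt : continuous At.
Hypothesis e0 : e 0 = 1.
Hypothesis e_gt0 : forall t : R, 0 < e t.
Hypothesis de : forall t : R, is_derive t (1 : R) e (- (2 * At t * e t)).
Hypothesis AE : forall t : R, 0 < t <= T -> A t = At t.

Lemma propagatorE (t : R) : 0 <= t <= T -> propagator A 0 t = (e t)%:E.
Proof.
move=> /andP[t0 tT].
have AtE s : 0 < s <= t -> A s = At s.
  by move=> /andP[s0 st]; rewrite AE// s0 (le_trans st).
have [iA IA] := eq_integrable_oc AtE (continuous_integrable_itv 0 t cAt).
have dl (s : R) : is_derive s (1 : R) (fun r => - 2^-1 * ln (e r)) (At s).
  have es := gt_eqF (e_gt0 s).
  apply: is_derive_eq (derZ (- 2^-1) (der_comp (is_derive1_ln (e_gt0 s)) (de s))) _.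
  by field; rewrite es.
have IAt : \int[lebesgue_measure]_(s in `[0, t]) At s = - 2^-1 * ln (e t).
  by apply: Rintegral_antiderivative => //; rewrite e0 ln1 mulr0.
rewrite /propagator -(@fineK _ (\int[_]_(_ in _) _)%E); last exact: (integrable_fin_num _ iA).
move: IA; rewrite IAt /Rintegral => ->.
rewrite -EFinM -EFinN /expeR; congr _%:E.
rewrite (_ : - _ = ln (e t)); first by rewrite lnK// posrE.
by field.
Qed.

End propagator_exponential.

Section controlled_process.
Context {R : realType} {n : nat} d {Omega : measurableType d}.
Variable P : probability Omega R.
Variables (T delta : R) (A : R -> R) (B : R -> 'rV[R]_n).
Variables (W X : R -> Omega -> 'rV[R]_n).
Hypothesis n_gt0 : (0 < n)%N.
Hypothesis T_gt0 : 0 < T.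
Hypothesis W_bm : brownian_motion P W.
Hypothesis X_sde : solves_sde P T delta W (fun s w => - grad_value A B s (X s w)) X.
Hypothesis X0_mean : mean P (X 0) = 0.
Hypothesis X0_var : scalar_variance P (X 0) = 0%E.

Let measurable_X t i : 0 <= t <= T -> measurable_fun setT (fun w => X t w ord0 i).
Proof. by move=> tT; have [/(_ t tT) + _] := X_sde; move/measurable_fun_rVP; exact. Qed.

(** A vanishing sum of nonnegative variances vanishes termwise, and as the means are 0 each variance
    is a second moment. *)
Lemma initial_value_ae0 (i : 'I_n) : {ae P, forall w, X 0 w ord0 i = 0}.
Proof.
have mX0 j : measurable_fun setT (fun w => X 0 w ord0 j).
  by apply: measurable_X; rewrite lexx ltW.
have VE j : ('V_P[fun w => X 0 w ord0 j] = \int[P]_w (X 0 w ord0 j ^+ 2)%:E)%E.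
  have := congr1 (fun x : 'rV[R]_n => x ord0 j) X0_mean; rewrite !mxE => E0.
  rewrite /variance unlock E0 unlock; apply: eq_integral => w _.
  by rewrite /= /cst; congr _%:E; rewrite /GRing.mul/= subr0.
apply: ae0_sqr_integral => //.
have V0 j : (0 <= 'V_P[fun w => X 0 w ord0 j])%E.
  by rewrite VE; apply: integral_ge0 => w _; rewrite lee_fin sqr_ge0.
have : (\sum_(j < n) 'V_P[fun w => X 0 w ord0 j] = 0)%E.
  apply/eqP; move: X0_var => /eqP; rewrite /scalar_variance mule_eq0 => /orP[//|].
  by rewrite eqe invr_eq0 pnatr_eq0 gtn_eqF.
move=> /eqP; rewrite seq_psume_eq0// => /allP/(_ i).
by rewrite mem_index_enum VE => /(_ isT)/eqP.
Qed.

Variables (At : R -> R) (Bt : R -> 'rV[R]_n) (e : R -> R) (mb : R -> 'rV[R]_n) (q : R -> R).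
Hypothesis cAt : continuous At.
Hypothesis cBt : forall i, continuous (fun t => Bt t ord0 i).
Hypothesis e_gt0 : forall t : R, 0 < e t.
Hypothesis de : forall t : R, is_derive t (1 : R) e (- (2 * At t * e t)).
Hypothesis mb0 : mb 0 = 0.
Hypothesis dmb : forall (t : R) i, is_derive t (1 : R) (fun r => mb r ord0 i)
  (- (2 * At t * mb t ord0 i + Bt t ord0 i)).
Hypothesis q0 : q 0 = 0.
Hypothesis dq : forall t : R, is_derive t (1 : R) q ((e t ^+ 2)^-1).
Hypothesis ABE : forall t : R, 0 < t <= T -> A t = At t /\ B t = Bt t.

Lemma coordinate_moments (t : R) (i : 'I_n) : 0 <= t <= T ->
  ('E_P[fun w => X t w ord0 i] = (mb t ord0 i)%:E)%E /\
  ('V_P[fun w => X t w ord0 i] = (flow_var delta e q t)%:E)%E.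
Proof.
move=> tT.
have [H [mH cH HW H12 Hmin]] := brownian_modification W_bm i (ltW T_gt0).
have H1 s : 0 <= s <= T -> P.-integrable setT (EFin \o H s) /\ \int[P]_w H s w = 0.
  by move=> /H12[].
have H2 s : 0 <= s <= T -> (\int[P]_w (H s w ^+ 2)%:E = s%:E)%E by move=> /H12[].
have [iN N0] := noise_part_mean mH cH H1 H2 cAt e_gt0 de tT.
have [iN2 N2] := noise_part_sqr mH cH H2 Hmin cAt e_gt0 de q0 dq tT.
have mN := measurable_noise_part mH cH H2 cAt e_gt0 de tT.
apply: (moments_ae_affine (measurable_X i tT) mN _ iN N0 iN2 N2).
have [_ Xw] := X_sde.
(* Outside a null set the modification agrees with [W], the path equation holds and the path starts
   at 0; the rest is deterministic, one path at a time. *)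
apply: filterS3 HW Xw (initial_value_ae0 i) => w HW Xw X0.
have ABE' (s : R) : 0 < s <= T -> A s = At s /\ B s ord0 i = Bt s ord0 i.
  by move=> /ABE[-> ->].
have alE (s : R) : (- grad_value A B s (X s w)) ord0 i = - (2 * A s * X s w ord0 i + B s ord0 i).
  by rewrite !mxE.
have TT : 0 <= T <= T by rewrite lexx ltW.
apply: (@linear_path _ delta At (fun s => Bt s ord0 i) e (fun s => mb s ord0 i) cAt (cBt (i := i))
  e_gt0 de _ (fun s => dmb s i) T A (fun s => B s ord0 i) (fun s => X s w ord0 i) (fun s => H s w)) => //.
- by rewrite mb0 mxE.
- by have [h _] := Xw T TT i; apply: eq_integrable h => // s _; rewrite /= alE.
- move=> s sT; have [_ ->] := Xw s sT i.
  by rewrite X0 add0r HW//; congr (_ + _); apply: eq_Rintegral => r _; rewrite alE.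
Qed.

Lemma controlled_mean (t : R) : 0 <= t <= T -> mean P (X t) = mb t.
Proof. by move=> tT; apply/rowP => i; rewrite mxE (coordinate_moments i tT).1. Qed.

Lemma controlled_variance (t : R) : 0 <= t <= T ->
  scalar_variance P (X t) = (flow_var delta e q t)%:E.
Proof.
move=> tT; rewrite /scalar_variance.
under eq_bigr do rewrite (coordinate_moments _ tT).2.
rewrite sumEFin sumr_const card_ord -EFinM -(mulr_natr (flow_var delta e q t) n) mulfK//.
by rewrite pnatr_eq0 -lt0n.
Qed.

End controlled_process.

(** * The Gaussian kernel as fundamental solution *)

Theorem corollary1 (R : realType) (n : nat) (n_gt0 : (0 < n)%N)
  (T delta : R) (T_gt0 : 0 < T) (delta_ge0 : 0 <= delta)
  (a : R -> R) (b : R -> 'rV[R]_n)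
  (a_cont : {within `[0, T], continuous a})
  (b_cont : {within `[0, T], continuous b})
  (AT : R) (BT : 'rV[R]_n) (A : R -> R) (B : R -> 'rV[R]_n)
  (AB_sol : riccati_solution T a b AT BT A B)
  (A_fin : (propagator A 0 T < +oo)%E)
  (B_fin : forall i, lebesgue_measure.-integrable `[0, T]
     (fun eta => (propagator A eta T * (B eta ord0 i)%:E)%E))
  (d : measure_display) (Omega : measurableType d) (P : probability Omega R)
  (W : R -> Omega -> 'rV[R]_n) (W_bm : brownian_motion P W)
  (X : R -> Omega -> 'rV[R]_n)
  (X_sde : solves_sde P T delta W
     (fun s w => - grad_value A B s (X s w)) X)
  (X0_mean : mean P (X 0) = 0)
  (X0_var : scalar_variance P (X 0) = 0%E)
  (y : 'rV[R]_n) :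
  exists G : R -> probability 'rV[R]_n R,
    [/\ weak_solution T delta A B y G,
        forall mu : R -> probability 'rV[R]_n R,
          weak_solution T delta A B y mu ->
          forall t, 0 <= t <= T ->
          forall S, measurable S -> mu t S = G t S &
        forall t, 0 <= t <= T -> forall S, measurable S ->
          G t S = gaussian_law
            (fine (propagator A 0 t) *: y + mean P (X t))
            (fine (scalar_variance P (X t))) S].
Proof.
have [At [Bt [cAt cBt ABE]]] := exists_continuous_coefficients T_gt0 a_cont b_cont AB_sol A_fin.
have [e [mb [q [[e0 e_gt0] de [mb0 dmb] q0 dq]]]] := exists_flow cAt cBt.
have [Phi [L [L_gt0 dPhi Phi_bd Phi_n Phi_p]]] := @exists_gaussian_primitive R.
have G_sol := flow_law_weak_solution delta cAt cBt e0 e_gt0 de mb0 dmb q0 dq y ABE.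
exists (flow_law delta e mb q y); split.
- exact: G_sol.
- move=> mu mu_sol t tT S mS.
  exact: (weak_solution_unique cAt cBt e_gt0 de ABE L_gt0 dPhi Phi_bd Phi_n Phi_p mu_sol G_sol).
- move=> t tT S mS; have /andP[t0 _] := tT.
  (* The kernel was built from the flow; its parameters are now recognised as the propagator and the
     moments of X, expressed through the same [e], [mb] and [q]. *)
  rewrite (propagatorE cAt e0 e_gt0 de (fun s sT => (ABE s sT).1) tT).
  rewrite (controlled_mean n_gt0 T_gt0 W_bm X_sde X0_mean X0_var cAt cBt e_gt0 de mb0 dmb q0 dq ABE tT)//.
  rewrite (controlled_variance n_gt0 T_gt0 W_bm X_sde X0_mean X0_var cAt cBt e_gt0 de mb0 dmb q0 dq ABE tT)//.
  rewrite /flow_law gauss_lawE ?sqrtr_ge0// sqr_sqrtr//.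
  exact: (flow_var_ge0 delta e_gt0 q0 dq t0).
Qed.
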